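(* There is a function $H=H(l_1,l_2,a,m)$ of four real variables with the following property. Let $P\subset\mathbf{R}^2$ be a bounded open convex polygon having the origin as a vertex, coinciding near the origin with the quadrant $\{x_1>0,x_2>0\}$, and such that the two vertices adjacent to the origin are $(2l_1,0)$ and $(0,2l_2)$, with $l_1,l_2>0$. Let $\sigma$ be a measure on $\partial P$ which is a positive constant multiple of Lebesgue measure on each edge and is the standard Lebesgue measure on the two edges through the origin. Let $A$ be a smooth function on $\overline P$, and let $u$ be a function satisfying the Guillemin boundary conditions for $(P,\sigma)$ and solving $$\sum_{i,j}\frac{\partial^2u^{ij}}{\partial x_i\partial x_j}=-A\quad\text{in }P,$$ such that $\frac{\partial u}{\partial x_1}=-1$ at $(l_1,0)$, $\frac{\partial u}{\partial x_2}=-1$ at $(0,l_2)$, and the minimum value of $u$ on $P$ is $0$. Then $$u(0,0)\le H\Big(l_1,l_2,\Vert A\Vert_{L^\infty},\int_{\partial P}u\,d\sigma\Big).$$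
   Context: $(u^{ij})$ is the inverse of the Hessian matrix $(u_{ij})$ of $u$. The derivatives at $(l_1,0)$ and $(0,l_2)$ are tangential derivatives of the restriction of $u$ to the edges. Guillemin boundary conditions for $(P,\sigma)$: $u$ is continuous and convex on $\overline P$, smooth with positive definite Hessian in $P$; its restriction to each open edge is smooth with positive second derivative; and near every point $q\in\partial P$ the function $u-\sum_E\lambda_E\log\lambda_E$ extends smoothly up to the boundary, where the sum is over the edges $E$ containing $q$, and $\lambda_E$ is the affine-linear function vanishing on $E$, positive in $P$, normalised by $|d\lambda_E\wedge d\sigma|=d\mu$ along $E$ ($d\mu$ being Lebesgue measure on $\mathbf R^2$); i.e. $\lambda_E$ is the Euclidean distance to the line containing $E$ divided by the density of $\sigma$ with respect to arc length on $E$. *)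

(* Defs.v *)
(* MathComp-Analysis.  Points of the plane are pairs, so that the product      *)
(* Lebesgue measure is available.                                              *)
From HB Require Import structures.
From mathcomp Require Import all_boot all_order all_algebra.
From mathcomp Require Import all_classical all_reals all_analysis.

Set Implicit Arguments.
Unset Strict Implicit.
Unset Printing Implicit Defensive.

Import Order.TTheory GRing.Theory Num.Theory.
Import numFieldNormedType.Exports.

Local Open Scope classical_set_scope.
Local Open Scope ring_scope.

Section Smoothness.
Context {R : realType}.
Implicit Types (D V : set (R * R)) (f g u : R * R -> R).

Definition basis2 (i : 'I_2) : R * R := ((i == 0)%:R, (i == 1)%:R).

Definition partial (i : 'I_2) f : R * R -> R := fun x => 'D_(basis2 i) f x.

Definition iter_partial (s : seq 'I_2) f : R * R -> R := foldr partial f s.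

(* C^oo on V, meant for open V. *)
Definition smooth_in V f : Prop :=
  forall (s : seq 'I_2) (x : R * R), V x -> differentiable (iter_partial s f) x.

Definition extends_smoothly_at D f (q : R * R) : Prop :=
  exists V g, [/\ open_nbhs q V, smooth_in V g &
    forall x, V x -> D x -> g x = f x].

(* Smoothness on a set that need not be open, such as a closed polygon. *)
Definition smooth_on D f : Prop := forall q, D q -> extends_smoothly_at D f q.

Definition hessian u (x : R * R) : 'M[R]_2 :=
  \matrix_(i, j) partial i (partial j u) x.

Definition posdef2 (M : 'M[R]_2) : Prop :=
  forall w : 'rV[R]_2, w != 0 -> 0 < (w *m M *m w^T) 0 0.

(* \sum_{i,j} (u^{ij})_{ij}, where (u^{ij}) is the inverse Hessian. *)
Definition abreu u (x : R * R) : R :=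
  \sum_(i < 2) \sum_(j < 2)
    partial i (partial j (fun y => invmx (hessian u y) i j)) x.

(* The norm of L^oo(P), P having its Lebesgue measure. *)
Definition Linfty_norm (P : set (R * R)) (A : R * R -> R) : R :=
  fine (Lnorm (@lebesgue_measure R \x @lebesgue_measure R)%E +oo%E
         (fun x => (A x * \1_P x)%:E)).

End Smoothness.

Section Polygon.
Context {R : realType}.
Implicit Types (x y q : R * R).

Definition cross x y : R := x.1 * y.2 - x.2 * y.1.

Definition enorm x : R := Num.sqrt (x.1 ^+ 2 + x.2 ^+ 2).

(* The vertices are v 0, ..., v (n - 1) in counterclockwise order, and the     *)
(* i-th edge joins v i to its cyclic successor v (ordS i).                     *)
Definition edge_vec n (v : 'I_n -> R * R) (i : 'I_n) : R * R :=
  v (ordS i) - v i.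

Definition edge_path n (v : 'I_n -> R * R) (i : 'I_n) (t : R) : R * R :=
  v i + t *: edge_vec v i.

Definition closed_edge n (v : 'I_n -> R * R) (i : 'I_n) : set (R * R) :=
  [set edge_path v i t | t in `[0, 1]].

(* P is a bounded open convex polygon with vertices v.  Every vertex off the   *)
(* i-th edge lies strictly to the left of the oriented line through it; this   *)
(* makes v the cyclic list of the corners of a convex polygon (without         *)
(* repetitions or flat angles), and P is the intersection of the open          *)
(* half-planes on the left of the edges.  Boundedness is then automatic.       *)
Record convex_polygon n (v : 'I_n -> R * R) (P : set (R * R)) : Prop := {
  polygon_size : (2 < n)%N ;
  polygon_ccw : forall i j : 'I_n, j != i -> j != ordS i ->
    0 < cross (edge_vec v i) (v j - v i) ;
  polygonE : P = [set x | forall i, 0 < cross (edge_vec v i) (x - v i)] ;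
  polygon_bounded : bounded_set P
}.

(* A boundary measure sigma is given by its densities s i with respect to arc  *)
(* length on the edges; this is the integral of f against it.                  *)
Definition boundary_integral n (v : 'I_n -> R * R) (s : 'I_n -> R)
    (f : R * R -> R) : R :=
  \sum_(i < n) s i * enorm (edge_vec v i) *
    \int[lebesgue_measure]_(t in `[0, 1]) f (edge_path v i t).

(* cross e (x - v i) / enorm e is the distance from x to the line of the i-th  *)
(* edge, positive on the side of the polygon.                                  *)
Definition edge_lambda n (v : 'I_n -> R * R) (s : 'I_n -> R) (i : 'I_n) x : R :=
  cross (edge_vec v i) (x - v i) / enorm (edge_vec v i) / s i.

Record guillemin n (v : 'I_n -> R * R) (s : 'I_n -> R) (P : set (R * R))
    (u : R * R -> R) : Prop := {
  guillemin_continuous : {within closure P, continuous u} ;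
  guillemin_convex : convex_function (closure P) u ;
  guillemin_smooth : smooth_in P u ;
  guillemin_posdef : forall x, P x -> posdef2 (hessian u x) ;
  guillemin_edge_smooth : forall i (k : nat) (t : R), 0 < t < 1 ->
    derivable (derive1n k (u \o edge_path v i)) t 1 ;
  guillemin_edge_convex : forall i (t : R), 0 < t < 1 ->
    0 < derive1n 2 (u \o edge_path v i) t ;
  guillemin_boundary : forall q, (closure P `\` P) q ->
    extends_smoothly_at P
      (fun x => u x - \sum_(i < n | `[< closed_edge v i q >])
         edge_lambda v s i x * ln (edge_lambda v s i x)) q
}.

End Polygon.

(* Main.v *)
From HB Require Import structures.
Require Import Defs.
From mathcomp Require Import all_boot all_order all_algebra.
From mathcomp Require Import all_classical all_reals all_analysis.
From mathcomp Require Import ess_sup_inf.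
From mathcomp Require Import ring lra.
Import Order.TTheory GRing.Theory Num.Theory.
Import numFieldNormedType.Exports.
Local Open Scope classical_set_scope.
Local Open Scope ring_scope.

(** Write h for the value u(0,0), I(x) = u(x) - x . Du(x) for the height over
    the origin of the tangent plane of u at x, M for the inverse Hessian of u
    and V_i for the sum over j of d_j M_ij, so that the equation is
    div V = -A.  Let a bound |A|, let m be the boundary integral of u, and let
    f(t) = u(t,0), g(t) = u(0,t) be the values along the two edges at the
    origin.

    Convexity gives three things.  As f and g have slope -1 at l_1 and l_2,
    they decrease up to there, so that t f(t) <= m and t g(t) <= m.  All
    tangent planes pass below the graph at the origin, so I <= h.  And u is at
    most max(f(r), g(r)) on the segment from (r,0) to (0,r), so that the
    tangent planes at points much farther out pass below that value at the
    origin, up to a small error.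

    The main estimate ([edge_value_estimate]) says how fast f can grow towards
    the vertex: if f(r0), g(r0) <= D and f(r1) >= D + 2 tau, then
    r1 <= 144 (a h + 2) R^2 / tau with R = 2 h r0 / tau, as long as 4R stays
    below l_1 and l_2.  Here r1 is bounded by the square of r0, which is what
    makes the estimate useful near the vertex.
    For the proof, I <= D + tau/2 where x_1 + x_2 >= R, whereas
    I >= D + 3 tau/2 near the part of the edge with x_1 <= r1, because
    I(x) >= 2 u(x) - u(2x).  Let G be a convex C^2 function of I that vanishes
    for I <= D + tau, and test div V = -A against the average over s in [1,2],
    with weight s^-2, of the functions p |-> G(I(sp)).  At the edge x_2 = 0 the
    Guillemin conditions give M_12 = M_22 = 0 and V_2 = 1, so the boundary term
    there is at least a multiple of tau r1, and nothing enters through the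
    outer boundary.  The interior term contains M(p) contracted with the second
    derivatives of G(I(sp)), hence third derivatives of u at z = sp; but these
    appear only in the radial direction, and radial differentiation is
    differentiation in s.  Treating s as a third variable, one completes the
    flux by a component W3 = s G'(I(z)) tr(M(p) D^2u(z)); the third derivatives
    cancel, and what is left of G'' is
    - G''(I(z)) det D^2u(z) (M_11 z_2^2 - 2 M_12 z_1 z_2 + M_22 z_1^2) <= 0
    ([divergence_eq]).  So the divergence of the three-dimensional field is at
    most a h, and its flux through s = 1 is at most 2 per unit area since
    tr(M D^2u) = 2.  The comparison of flux and divergence ([box_flux]) is made
    on a grid by telescoping, with the mean value theorem on each cell.

    The main estimate is then iterated ([corner_bound]).  Start with
    r0 = 2m/h, where f and g are at most h/2, and pass from r to r/16 while the
    increment tau is halved, tau = h p/16 with p = 2^-j.  If h is larger than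
    the asserted bound, each step is an instance of the main estimate, and the
    values of f along r0 16^-j stay below h/2 + h/4 (1 - p) < 3h/4.  This
    contradicts the continuity of u at the origin. *)

Set Implicit Arguments.
Unset Strict Implicit.
Unset Printing Implicit Defensive.

(** * Partial derivatives and smooth functions *)

Section DiffExt.
Context {R : realType} {V W : normedModType R}.

(** The remainder of the first-order expansion vanishes near the point, so the
    differential is 0; this makes differentiability a local property. *)
Lemma differentiable_near0 (k : V -> W) (x : V) :
  (\forall y \near x, k y = 0) -> differentiable k x.
Proof.
move=> k0.
have dk : k \o shift x = cst (k x) + (0 : V -> W) +o_ (0 : V) id.
  apply/eqaddoP => _/posnumP[e].
  have : \forall y \near (0:V), k (y + x) = 0.
    by move: k0; rewrite (near_shift 0) /=; apply: filterS => y /=; rewrite subr0.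
  apply: filterS => y /= ky.
  have kx : k x = 0 by exact: nbhs_singleton k0.
  rewrite /= !fctE [X in `|X|](_ : _ = 0) ?normr0 ?mulr_ge0//.
  by rewrite ky kx !add0r; exact: oppr0.
apply/diff_locallyP.
have -> : ('d k x : V -> W) = 0.
  by apply: diff_unique => //; exact: cst_continuous.
by split => //; exact: cst_continuous.
Qed.

Lemma near_eq_differentiable (f g : V -> W) (x : V) :
  (\forall y \near x, f y = g y) -> differentiable f x -> differentiable g x.
Proof.
move=> fg df; have -> : g = f + (g - f) by apply/funext => y; rewrite !fctE addrC subrK.
apply: differentiableD => //; apply: differentiable_near0.
by move: fg; apply: filterS => y; rewrite !fctE => ->; rewrite subrr.
Qed.
End DiffExt.

Section Partial.
Context {R : realType}.
Implicit Types (f g : R * R -> R) (x : R * R) (V : set (R * R)).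

Lemma partial0E f (x y : R) : partial 0 f (x, y) = 'D_1 (fun t => f (t, y)) x.
Proof.
rewrite /partial /derive; congr (lim _); apply: (congr1 (fun k => k @ 0^')); apply/funext => h /=.
congr (_ *: (f _ - _)); rewrite /basis2 /=.
by congr pair => /=; rewrite ?scaler0 ?add0r.
Qed.

Lemma partial1E f (x y : R) : partial 1 f (x, y) = 'D_1 (fun t => f (x, t)) y.
Proof.
rewrite /partial /derive; congr (lim _); apply: (congr1 (fun k => k @ 0^')); apply/funext => h /=.
congr (_ *: (f _ - _)); rewrite /basis2 /=.
by congr pair => /=; rewrite ?scaler0 ?add0r.
Qed.

Lemma is_derive_fst f (x y : R) : differentiable f (x, y) ->
  is_derive x 1 (fun t => f (t, y)) (partial 0 f (x, y)).
Proof.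
move=> df; apply: DeriveDef; last by rewrite partial0E.
apply/derivable1_diffP.
apply: (@differentiable_comp _ _ _ _ (fun t : R => (t, y)) f) => //.
Qed.

Lemma is_derive_snd f (x y : R) : differentiable f (x, y) ->
  is_derive y 1 (fun t => f (x, t)) (partial 1 f (x, y)).
Proof.
move=> df; apply: DeriveDef; last by rewrite partial1E.
apply/derivable1_diffP.
apply: (@differentiable_comp _ _ _ _ (fun t : R => (x, t)) f) => //.
Qed.

Lemma derive_dirE f x (v : R * R) : differentiable f x ->
  'D_v f x = v.1 * partial 0 f x + v.2 * partial 1 f x.
Proof.
move=> df; rewrite /partial !deriveE//.
have {1}-> : v = v.1 *: basis2 0 + v.2 *: basis2 1.
  case: v => a b; rewrite /basis2 /=.
  have -> : a *: (1, 0) + b *: (0, 1) = (a * 1 + b * 0, a * 0 + b * 1) :> R * R by [].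
  by rewrite !mulr0 !mulr1 addr0 add0r.
by rewrite linearD !linearZ.
Qed.

Lemma is_derive_line f (p v : R * R) (s : R) :
  differentiable f (p.1 + s * v.1, p.2 + s * v.2) ->
  is_derive s 1 (fun t => f (p.1 + t * v.1, p.2 + t * v.2))
   (v.1 * partial 0 f (p.1 + s * v.1, p.2 + s * v.2)
   + v.2 * partial 1 f (p.1 + s * v.1, p.2 + s * v.2)).
Proof.
move=> df; apply: DeriveDef.
  apply/derivable1_diffP.
  apply: (@differentiable_comp _ _ _ _ (fun t : R => (p.1 + t * v.1, p.2 + t * v.2)) f) => //.
rewrite -derive_dirE// /derive; congr (lim _); apply: (congr1 (fun k => k @ 0^')); apply/funext => h /=.
congr (_ *: (f _ - _)); case: v df => a b /= _.
by congr pair => /=; rewrite /GRing.scale /= ?mulr1; ring.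
Qed.

End Partial.

Section Ck.
Context {R : realType}.
Implicit Types (f g : R * R -> R) (x : R * R) (V : set (R * R)).

(** A one-step recursion for iterated differentiability, because the product and
    quotient rules lower the order of only one factor at a time. *)
Fixpoint Ck (n : nat) V f : Prop := if n is m.+1 then
  (forall x, V x -> differentiable f x) /\ forall i, Ck m V (partial i f)
  else True.

Lemma smooth_inP V f : smooth_in V f <-> forall n, Ck n V f.
Proof.
split.
  move=> sf n; elim: n f sf => // n IH f sf; split; first by move=> x Vx; exact: (sf [::]).
  by move=> i; apply: IH => s; move: (sf (rcons s i)); rewrite /iter_partial foldr_rcons.
move=> cf s; elim/last_ind: s f cf => [|s i IH] f cf x Vx.
  by have [+ _] := cf 1%N; exact.
rewrite /iter_partial foldr_rcons; apply: IH => // n.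
by have [_ +] := cf n.+1; exact.
Qed.

Lemma CkS n V f : Ck n.+1 V f -> Ck n V f.
Proof. by elim: n f => // n IH f [df cf]; split => // i; apply: IH. Qed.

Lemma partial_eq V f g i : open V -> (forall x, V x -> f x = g x) ->
  forall x, V x -> partial i f x = partial i g x.
Proof.
move=> oV fg x Vx; apply: near_eq_derive.
by apply: filterS (open_nbhs_nbhs (conj oV Vx)) => y; exact: fg.
Qed.

Lemma Ck_eq n V f g : open V -> (forall x, V x -> f x = g x) -> Ck n V f -> Ck n V g.
Proof.
move=> oV; elim: n f g => // n IH f g fg [df cf]; split.
  move=> x Vx; apply: (near_eq_differentiable _ (df _ Vx)).
  by apply: filterS (open_nbhs_nbhs (conj oV Vx)) => y; exact: fg.
by move=> i; apply: IH (cf i) => x Vx; exact: partial_eq Vx.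
Qed.

Lemma partialD i f g x : differentiable f x -> differentiable g x ->
  partial i (fun y => f y + g y) x = partial i f x + partial i g x.
Proof. by move=> df dg; rewrite /partial -deriveD//; exact: diff_derivable. Qed.

Lemma partialM i f g x : differentiable f x -> differentiable g x ->
  partial i (fun y => f y * g y) x = partial i f x * g x + f x * partial i g x.
Proof.
move=> df dg; rewrite /partial.
have := @deriveM _ _ f g x (basis2 i) (diff_derivable df) (diff_derivable dg).
by move=> /= E; rewrite [LHS]E addrC; congr (_ + _); rewrite /GRing.scale /= mulrC.
Qed.

Lemma partialV i f x : differentiable f x -> f x != 0 ->
  partial i (fun y => (f y)^-1) x = - (partial i f x * ((f x)^-1 * (f x)^-1)).
Proof.
move=> df f0; rewrite /partial.
have E := deriveV f0 (diff_derivable df).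
by rewrite [LHS]E /GRing.scale /= -exprVn expr2; ring.
Qed.

Lemma partial_cst i (c : R) x : partial i (fun=> c) x = 0.
Proof. exact: derive_cst. Qed.

Lemma Ck_cst n V (c : R) : Ck n V (fun=> c).
Proof.
elim: n c => // n IH c; split; first by move=> x _; exact: differentiable_cst.
by move=> i; have -> : partial i (fun=> c) = (fun=> 0 : R); [apply/funext => x; exact: partial_cst|exact: IH].
Qed.

Lemma CkD n V f g : open V -> Ck n V f -> Ck n V g -> Ck n V (fun x => f x + g x).
Proof.
move=> oV; elim: n f g => // n IH f g [df cf] [dg cg]; split.
  by move=> x Vx; apply: differentiableD; [exact: df|exact: dg].
move=> i; apply: Ck_eq (IH _ _ (cf i) (cg i)) => // x Vx.
by rewrite partialD//; [exact: df|exact: dg].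
Qed.

Lemma CkM n V f g : open V -> Ck n V f -> Ck n V g -> Ck n V (fun x => f x * g x).
Proof.
move=> oV; elim: n f g => // n IH f g cf' cg'.
have [df cf] := cf'; have [dg cg] := cg'; split.
  by move=> x Vx; apply: differentiableM; [exact: df|exact: dg].
move=> i; apply: Ck_eq (CkD oV (IH _ _ (cf i) (CkS cg')) (IH _ _ (CkS cf') (cg i))) => // x Vx.
by rewrite partialM//; [exact: df|exact: dg].
Qed.

Lemma CkN n V f : open V -> Ck n V f -> Ck n V (fun x => - f x).
Proof.
move=> oV cf; apply: Ck_eq (CkM oV (Ck_cst n V (-1)) cf) => // x _.
by rewrite mulN1r.
Qed.

Lemma CkV n V f : open V -> (forall x, V x -> f x != 0) -> Ck n V f ->
  Ck n V (fun x => (f x)^-1).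
Proof.
move=> oV f0; elim: n => // n IH cf'; have [df cf] := cf'.
have ci := IH (CkS cf'); split.
  by move=> x Vx; apply: differentiableV; [exact: df|exact: f0].
move=> i; apply: Ck_eq (CkN oV (CkM oV (cf i) (CkM oV ci ci))) => // x Vx.
by rewrite partialV//; [exact: df|exact: f0].
Qed.

Lemma ord2P (i : 'I_2) : i = 0 \/ i = 1.
Proof. by case: i => -[|[|//]] p; [left|right]; exact: val_inj. Qed.

Lemma differentiable_fst x : differentiable (fst : R * R -> R) x.
Proof. exact: (@linear_differentiable _ _ _ (fst : R * R -> R)) (fun y => cvg_fst). Qed.

Lemma differentiable_snd x : differentiable (snd : R * R -> R) x.
Proof. exact: (@linear_differentiable _ _ _ (snd : R * R -> R)) (fun y => cvg_snd). Qed.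

Lemma partial_fst i x : partial i (fst : R * R -> R) x = (i == 0)%:R.
Proof.
case: x => a b; have [->|->] := ord2P i.
  by rewrite partial0E /= derive_id.
by rewrite partial1E /= derive_cst.
Qed.

Lemma partial_snd i x : partial i (snd : R * R -> R) x = (i == 1)%:R.
Proof.
case: x => a b; have [->|->] := ord2P i.
  by rewrite partial0E /= derive_cst.
by rewrite partial1E /= derive_id.
Qed.

Lemma Ck_fst n V : Ck n V fst.
Proof.
case: n => // n; split; first by move=> x _; exact: differentiable_fst.
move=> i; have -> : partial i (fst : R * R -> R) = (fun=> (i == 0)%:R : R).
  by apply/funext => x; exact: partial_fst.
exact: Ck_cst.
Qed.

Lemma Ck_snd n V : Ck n V snd.
Proof.
case: n => // n; split; first by move=> x _; exact: differentiable_snd.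
move=> i; have -> : partial i (snd : R * R -> R) = (fun=> (i == 1)%:R : R).
  by apply/funext => x; exact: partial_snd.
exact: Ck_cst.
Qed.

Lemma smooth_partial V f i : smooth_in V f -> smooth_in V (partial i f).
Proof. by move=> sf s x Vx; move: (sf (rcons s i) x Vx); rewrite /iter_partial foldr_rcons. Qed.

Lemma smooth_diff V f x : smooth_in V f -> V x -> differentiable f x.
Proof. by move=> sf Vx; exact: (sf [::]). Qed.

Lemma smooth_cont V f x : smooth_in V f -> V x -> {for x, continuous f}.
Proof. by move=> sf Vx; apply: differentiable_continuous; exact: smooth_diff Vx. Qed.

(** The mean value theorem twice, first for the difference of two horizontal
    slices, then for the vertical derivative of the slope. *)
Lemma second_difference f (a b h k : R) : 0 < h -> 0 < k ->
  (forall x y : R, a <= x <= a + h -> b <= y <= b + k -> differentiable f (x, y)) ->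
  (forall x y : R, a <= x <= a + h -> b <= y <= b + k -> differentiable (partial 0 f) (x, y)) ->
  exists x y : R, [/\ a <= x <= a + h, b <= y <= b + k &
   f (a + h, b + k) - f (a + h, b) - (f (a, b + k) - f (a, b)) =
     h * k * partial 1 (partial 0 f) (x, y)].
Proof.
move=> h0 k0 df d1f.
have bk : b <= b + k <= b + k by rewrite lexx andbT lerDl ltW.
have bb : b <= b <= b + k by rewrite lexx lerDl ltW.
pose phi t := f (t, b + k) - f (t, b).
have dphi (x : R) : a <= x <= a + h -> is_derive x 1 phi (partial 0 f (x, b + k) - partial 0 f (x, b)).
  by move=> xa; apply: is_deriveB; apply: is_derive_fst; exact: df.
have [x xI E1] : exists2 x : R, x \in `]a, a + h[%R & phi (a + h) - phi a =
    (partial 0 f (x, b + k) - partial 0 f (x, b)) * (a + h - a).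
  apply: (@MVT _ phi (fun x : R => partial 0 f (x, b + k) - partial 0 f (x, b))).
  - by rewrite ltrDl.
  - by move=> x; rewrite in_itv /= => /andP[/ltW ax /ltW xh]; apply: dphi; rewrite ax.
  - apply: derivable_within_continuous => x; rewrite in_itv /= => xI.
    by have [] := dphi x xI.
have xI' : a <= x <= a + h by move: xI; rewrite in_itv /= => /andP[/ltW -> /ltW ->].
have [y yI E2] : exists2 y, y \in `]b, b + k[%R & partial 0 f (x, b + k) - partial 0 f (x, b) =
    partial 1 (partial 0 f) (x, y) * (b + k - b).
  apply: (@MVT _ (fun y => partial 0 f (x, y)) (fun y => partial 1 (partial 0 f) (x, y))).
  - by rewrite ltrDl.
  - move=> y; rewrite in_itv /= => /andP[/ltW ay /ltW yk]; apply: is_derive_snd.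
    by apply: d1f => //; rewrite ay.
  - apply: derivable_within_continuous => y; rewrite in_itv /= => yI.
    by have [] := is_derive_snd (d1f x y xI' yI).
exists x, y; split=> //; first by move: yI; rewrite in_itv /= => /andP[/ltW -> /ltW ->].
move: E1; rewrite /phi E2 => ->; ring.
Qed.

End Ck.

Section Swap.
Context {R : realType}.
Implicit Types (f g : R * R -> R) (x : R * R) (V : set (R * R)).

(** The reflection exchanges the two edges at the vertex; every estimate is proved
    at one of them and reflected. *)
Definition swap (x : R * R) : R * R := (x.2, x.1).
Definition swap_index (i : 'I_2) : 'I_2 := if i == 0 then 1 else 0.

Lemma swapK : involutive swap. Proof. by case. Qed.

Lemma partial_swap i f : partial i (f \o swap) = partial (swap_index i) f \o swap.
Proof.
apply/funext => -[a b]; have [->|->] := ord2P i; rewrite /swap_index /=.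
  by rewrite partial0E partial1E.
by rewrite partial0E partial1E.
Qed.

Lemma iter_partial_swap s f :
  iter_partial s (f \o swap) = iter_partial (map swap_index s) f \o swap.
Proof. by elim: s => //= i s ->; rewrite partial_swap. Qed.

Lemma differentiable_swap x : differentiable swap x.
Proof. by apply: differentiable_pair; [exact: differentiable_snd|exact: differentiable_fst]. Qed.

Lemma continuous_swap : continuous swap.
Proof. by move=> x; apply: differentiable_continuous; exact: differentiable_swap. Qed.

Lemma open_swap V : open V -> open (swap @^-1` V).
Proof. by move=> oV; apply: open_comp => // x _; exact: continuous_swap. Qed.

Lemma smooth_swap V f : smooth_in V f -> smooth_in (swap @^-1` V) (f \o swap).
Proof.
move=> sf s x Vx; rewrite iter_partial_swap; apply: differentiable_comp.
  exact: differentiable_swap.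
exact: sf.
Qed.

(** Both mixed derivatives, at suitable points of a small square, are equal to
    its second difference divided by the area; let the square shrink. *)
Lemma schwarz V f x : open V -> smooth_in V f -> V x ->
  partial 0 (partial 1 f) x = partial 1 (partial 0 f) x.
Proof.
move=> oV sf Vx; apply/eqP; rewrite -subr_eq0 -normr_eq0; apply/eqP/le_anti.
rewrite normr_ge0 andbT; apply/ler_addgt0Pl => e e0; rewrite addr0.
have e4 : 0 < e / 2 by rewrite divr_gt0.
have c01 : {for x, continuous (partial 0 (partial 1 f))}.
  by apply: (@smooth_cont _ V) => //; do 2 apply: smooth_partial.
have c10 : {for x, continuous (partial 1 (partial 0 f))}.
  by apply: (@smooth_cont _ V) => //; do 2 apply: smooth_partial.
have : \forall y \near x, V y /\ `|partial 0 (partial 1 f) x - partial 0 (partial 1 f) y| < e / 2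
    /\ `|partial 1 (partial 0 f) x - partial 1 (partial 0 f) y| < e / 2.
  apply: filterI; first exact: open_nbhs_nbhs.
  apply: filterI; first by move/cvgrPdist_lt : c01; exact.
  by move/cvgrPdist_lt : c10; exact.
move=> /nbhs_ballP[r /= r0 Br]; case: x Vx c01 c10 Br => a b Vx c01 c10 Br.
pose h := r / 2; have h0 : 0 < h by rewrite divr_gt0.
have inB y z : a <= y <= a + h -> b <= z <= b + h -> ball (a, b) r (y, z).
  move=> /andP[ay yh] /andP[bz zh]; split; rewrite /ball /= ltr_norml; apply/andP; split;
    rewrite /h in yh zh; lra.
have [y [z [yI zI E1]]] := @second_difference R f a b h h h0 h0
  (fun y z yI zI => smooth_diff sf (Br _ (inB y z yI zI)).1)
  (fun y z yI zI => smooth_diff (smooth_partial 0 sf) (Br _ (inB y z yI zI)).1).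
(* The same second difference with the roles of the variables exchanged. *)
have sfs := smooth_swap sf.
have [z' [y' [zI' yI' E2]]] := @second_difference R (f \o swap) b a h h h0 h0
  (fun y z yI zI => @smooth_diff _ _ _ (y, z) sfs (Br _ (inB z y zI yI)).1)
  (fun y z yI zI => @smooth_diff _ _ _ (y, z) (smooth_partial 0 sfs) (Br _ (inB z y zI yI)).1).
have := (Br _ (inB y z yI zI)).2.2; have := (Br _ (inB y' z' yI' zI')).2.1.
move: E2; rewrite partial_swap partial_swap /= /swap_index /= /swap /=.
have hh : h * h != 0 by rewrite mulf_neq0 ?gt_eqF.
move: E1; clear -hh.
move: (partial 0 (partial 1 f) (y', z')) (partial 1 (partial 0 f) (y, z)) => p q.
move: (partial 0 (partial 1 f) (a, b)) (partial 1 (partial 0 f) (a, b)) => A B E1 E2.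
have E : h * h * q = h * h * p by rewrite -E2 -E1; ring.
move/(mulfI hh): E => -> n1 n2.
have := ler_normB (A - p) (B - p); rewrite (_ : A - p - (B - p) = A - B); last by ring.
lra.
Qed.

End Swap.

Section SmoothRing.
Context {R : realType}.
Implicit Types (f g : R * R -> R) (V : set (R * R)).

Lemma smoothD V f g : open V -> smooth_in V f -> smooth_in V g ->
  smooth_in V (fun x => f x + g x).
Proof. by move=> oV /smooth_inP cf /smooth_inP cg; apply/smooth_inP => n; exact: CkD. Qed.

Lemma smoothM V f g : open V -> smooth_in V f -> smooth_in V g ->
  smooth_in V (fun x => f x * g x).
Proof. by move=> oV /smooth_inP cf /smooth_inP cg; apply/smooth_inP => n; exact: CkM. Qed.

Lemma smoothN V f : open V -> smooth_in V f -> smooth_in V (fun x => - f x).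
Proof. by move=> oV /smooth_inP cf; apply/smooth_inP => n; exact: CkN. Qed.

Lemma smoothV V f : open V -> (forall x, V x -> f x != 0) -> smooth_in V f ->
  smooth_in V (fun x => (f x)^-1).
Proof. by move=> oV f0 /smooth_inP cf; apply/smooth_inP => n; exact: CkV. Qed.

Lemma smooth_cst V (c : R) : smooth_in V (fun=> c).
Proof. by apply/smooth_inP => n; exact: Ck_cst. Qed.

Lemma smooth_fst V : smooth_in V fst.
Proof. by apply/smooth_inP => n; exact: Ck_fst. Qed.

Lemma smooth_snd V : smooth_in V snd.
Proof. by apply/smooth_inP => n; exact: Ck_snd. Qed.

Lemma smooth_sub U V f : U `<=` V -> smooth_in V f -> smooth_in U f.
Proof. by move=> UV sf s x /UV; exact: sf. Qed.

End SmoothRing.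

(** Sealed, so that conversion never unfolds a derivative into the limit defining it. *)
HB.lock Definition pd {R : realType} (i : 'I_2) (f : R * R -> R) : R * R -> R := partial i f.

Section LockedPartial.
Context {R : realType}.
Implicit Types (f g : R * R -> R) (V : set (R * R)).

Lemma pdE i f : pd i f = partial i f.
Proof. by rewrite unlock. Qed.

Lemma smooth_pd V f i : smooth_in V f -> smooth_in V (pd i f).
Proof. by rewrite pdE; exact: smooth_partial. Qed.

Lemma schwarz_pd V f x : open V -> smooth_in V f -> V x ->
  pd 0 (pd 1 f) x = pd 1 (pd 0 f) x.
Proof. by rewrite !pdE; exact: schwarz. Qed.

Lemma pd_eq V f g i : open V -> (forall x, V x -> f x = g x) ->
  forall x, V x -> pd i f x = pd i g x.
Proof. by rewrite !pdE; exact: partial_eq. Qed.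

Lemma pdD i f g x : differentiable f x -> differentiable g x ->
  pd i (fun y => f y + g y) x = pd i f x + pd i g x.
Proof. by rewrite !pdE; exact: partialD. Qed.

Lemma pdM i f g x : differentiable f x -> differentiable g x ->
  pd i (fun y => f y * g y) x = pd i f x * g x + f x * pd i g x.
Proof. by rewrite !pdE; exact: partialM. Qed.

Lemma pdN V f i x : smooth_in V f -> V x -> pd i (fun y => - f y) x = - pd i f x.
Proof.
move=> sf Vx; rewrite !pdE.
have := deriveN (diff_derivable (v := basis2 i) (smooth_diff sf Vx)).
exact.
Qed.

Lemma pd_fst i x : pd i (fst : R * R -> R) x = (i == 0)%:R.
Proof. by rewrite pdE; exact: partial_fst. Qed.

Lemma pd_snd i x : pd i (snd : R * R -> R) x = (i == 1)%:R.
Proof. by rewrite pdE; exact: partial_snd. Qed.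

Lemma is_derive_fst_pd f (x y : R) : differentiable f (x, y) ->
  is_derive x 1 (fun t => f (t, y)) (pd 0 f (x, y)).
Proof. by rewrite pdE; exact: is_derive_fst. Qed.

Lemma is_derive_snd_pd f (x y : R) : differentiable f (x, y) ->
  is_derive y 1 (fun t => f (x, t)) (pd 1 f (x, y)).
Proof. by rewrite pdE; exact: is_derive_snd. Qed.

Lemma is_derive_line_pd f (p v : R * R) (s : R) :
  differentiable f (p.1 + s * v.1, p.2 + s * v.2) ->
  is_derive s 1 (fun t => f (p.1 + t * v.1, p.2 + t * v.2))
   (v.1 * pd 0 f (p.1 + s * v.1, p.2 + s * v.2)
   + v.2 * pd 1 f (p.1 + s * v.1, p.2 + s * v.2)).
Proof. by rewrite !pdE; exact: is_derive_line. Qed.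

End LockedPartial.

(** * A divergence inequality on a box *)

Section BoxFlux.
Context {R : realType}.

Lemma compact_unif (K : set (R * R * R)) (D : R * R * R -> R) (eta : R) :
  compact K -> (forall p, K p -> {for p, continuous D}) -> 0 < eta ->
  exists2 rho : R, 0 < rho &
    forall p q, K p -> ball p rho q -> `|D p - D q| < eta.
Proof.
move=> cK cD e0.
have e2 : 0 < eta / 2 by rewrite divr_gt0.
have /compact_near_coveringP/(_ _ ((0:R)^'+)
  (fun r p => forall q, ball p r q -> `|D p - D q| < eta)) := cK.
have near_ok : forall x, K x -> \forall x' \near x & i \near ((0:R)^'+),
    forall q, ball x' i q -> `|D x' - D q| < eta.
  move=> x Kx; move: (cD x Kx) => /cvgrPdist_lt/(_ _ e2)/nbhs_ballP[r /= r0 Br].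
  have r2 : 0 < r / 2 by rewrite divr_gt0.
  exists (ball x (r / 2), [set i | i < r / 2]) => /=.
    split; first exact: nbhsx_ballx.
    by near=> i; near: i; exact: nbhs_right_lt.
  move=> [x' i] /= [xx' ir] q xq.
  have -> : D x' - D q = (D x - D q) - (D x - D x') by ring.
  rewrite (splitr eta) (le_lt_trans (ler_normB _ _))// ltrD//.
    apply: Br; rewrite (splitr r); apply: ball_triangle xx' _.
    by apply: le_ball xq; exact: ltW.
  by apply: Br; apply: le_ball xx'; rewrite ler_pdivrMr// ler_peMr ?ler1n// ltW.
move=> /(_ _ near_ok)/= nr.
have [rho [rho0 Hr]] : exists rho : R, 0 < rho /\
    K `<=` (fun p => forall q, ball p rho q -> `|D p - D q| < eta).
  near ((0:R)^'+) => rho; exists rho; split; first by near: rho; exact: nbhs_right_gt.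
  by near: rho.
by exists rho => // p q Kp; exact: Hr.
Unshelve. all: by end_near. Qed.

Definition box3 (a b c d e f : R) : set (R * R * R) :=
  [set p | [/\ a <= p.1.1 <= b, c <= p.1.2 <= d & e <= p.2 <= f]].

Lemma compact_box3 a b c d e f : compact (box3 a b c d e f).
Proof.
have -> : box3 a b c d e f = (`[a, b] `*` `[c, d]) `*` `[e, f].
  apply/seteqP; split => -[[x y] s] /=; rewrite /box3 /= !in_itv /=; first by case.
  by move=> [[]].
by do 2 (apply: compact_setX; last exact: segment_compact); exact: segment_compact.
Qed.

Lemma sum_step (X : nat -> R) n (w : R) :
  \sum_(0 <= i < n) w * (X i.+1 - X i) = w * (X n - X 0).
Proof. by rewrite -mulr_sumr telescope_sumr. Qed.

Section Cells.
Variables (W1 W2 W3 : R -> R -> R -> R) (a b c d e f : R).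
Variables (X Y S : nat -> R) (nx ny ns : nat).
Hypotheses (X0 : X 0 = a) (Xn : X nx = b) (Xi : forall i, X i <= X i.+1).
Hypotheses (Y0 : Y 0 = c) (Yn : Y ny = d) (Yi : forall i, Y i <= Y i.+1).
Hypotheses (S0 : S 0 = e) (Sn : S ns = f) (Si : forall i, S i <= S i.+1).
Variables (K : R).
Hypothesis cell : forall i j k, (i < nx)%N -> (j < ny)%N -> (k < ns)%N ->
  (W1 (X i.+1) (Y j) (S k) - W1 (X i) (Y j) (S k)) * (Y j.+1 - Y j) * (S k.+1 - S k)
  + (W2 (X i) (Y j.+1) (S k) - W2 (X i) (Y j) (S k)) * (X i.+1 - X i) * (S k.+1 - S k)
  + (W3 (X i) (Y j) (S k.+1) - W3 (X i) (Y j) (S k)) * (X i.+1 - X i) * (Y j.+1 - Y j)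
  <= K * (X i.+1 - X i) * (Y j.+1 - Y j) * (S k.+1 - S k).

Let vol : \sum_(0 <= i < nx) \sum_(0 <= j < ny) \sum_(0 <= k < ns)
    K * (X i.+1 - X i) * (Y j.+1 - Y j) * (S k.+1 - S k) =
  K * (b - a) * (d - c) * (f - e).
Proof.
under eq_bigr do under eq_bigr do rewrite sum_step.
transitivity (\sum_(0 <= i < nx) K * (d - c) * (f - e) * (X i.+1 - X i)).
  apply: eq_bigr => i _.
  transitivity (\sum_(0 <= j < ny) K * (X i.+1 - X i) * (S ns - S 0) * (Y j.+1 - Y j)).
    by apply: eq_bigr => j _; ring.
  by rewrite sum_step Y0 Yn S0 Sn; ring.
by rewrite sum_step X0 Xn; ring.
Qed.

Variables (k1 k3 : R) (beta : nat -> R).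
Hypothesis W1a : forall j k, (j < ny)%N -> (k < ns)%N -> W1 a (Y j) (S k) <= k1.
Hypothesis W1b : forall j k, (j < ny)%N -> (k < ns)%N -> 0 <= W1 b (Y j) (S k).
Hypothesis W2c : forall i k, (i < nx)%N -> (k < ns)%N -> beta i <= - W2 (X i) c (S k).
Hypothesis W2d : forall i k, (i < nx)%N -> (k < ns)%N -> 0 <= W2 (X i) d (S k).
Hypothesis W3e : forall i j, (i < nx)%N -> (j < ny)%N -> W3 (X i) (Y j) e <= k3.
Hypothesis W3f : forall i j, (i < nx)%N -> (j < ny)%N -> 0 <= W3 (X i) (Y j) f.

Let dX i : 0 <= X i.+1 - X i. Proof. by rewrite subr_ge0. Qed.
Let dY i : 0 <= Y i.+1 - Y i. Proof. by rewrite subr_ge0. Qed.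
Let dS i : 0 <= S i.+1 - S i. Proof. by rewrite subr_ge0. Qed.

Let face1 : - k1 * (d - c) * (f - e) <= \sum_(0 <= i < nx) \sum_(0 <= j < ny) \sum_(0 <= k < ns)
  (W1 (X i.+1) (Y j) (S k) - W1 (X i) (Y j) (S k)) * (Y j.+1 - Y j) * (S k.+1 - S k).
Proof.
rewrite exchange_big_nat /=.
under eq_bigr do rewrite exchange_big_nat /=.
rewrite [X in X <= _](_ : _ = \sum_(0 <= j < ny) (- k1 * (f - e)) * (Y j.+1 - Y j)); last by rewrite sum_step Y0 Yn; ring.
rewrite !big_nat; apply: ler_sum => j /andP[_ jn].
rewrite [X in X <= _](_ : _ = \sum_(0 <= k < ns) (- k1 * (Y j.+1 - Y j)) * (S k.+1 - S k)); last first.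
  by rewrite sum_step S0 Sn; ring.
rewrite !big_nat; apply: ler_sum => k /andP[_ kn].
under eq_bigr do rewrite -mulrA.
rewrite -mulr_suml (telescope_sumr (fun i => W1 (X i) (Y j) (S k)))// X0 Xn -!mulrA.
apply: ler_wpM2r; first by rewrite mulr_ge0.
by have := W1a jn kn; have := W1b jn kn; lra.
Qed.

Let face2 : (\sum_(0 <= i < nx) beta i * (X i.+1 - X i)) * (f - e) <=
  \sum_(0 <= i < nx) \sum_(0 <= j < ny) \sum_(0 <= k < ns)
  (W2 (X i) (Y j.+1) (S k) - W2 (X i) (Y j) (S k)) * (X i.+1 - X i) * (S k.+1 - S k).
Proof.
under [X in _ <= X]eq_bigr do rewrite exchange_big_nat /=.
rewrite mulr_suml !big_nat; apply: ler_sum => i /andP[_ ix].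
rewrite [X in X <= _](_ : _ = \sum_(0 <= k < ns) (beta i * (X i.+1 - X i)) * (S k.+1 - S k)); last first.
  by rewrite sum_step S0 Sn.
rewrite !big_nat; apply: ler_sum => k /andP[_ kn].
under eq_bigr do rewrite -mulrA.
rewrite -mulr_suml (telescope_sumr (fun j => W2 (X i) (Y j) (S k)))// Y0 Yn -!mulrA.
apply: ler_wpM2r; first by rewrite mulr_ge0.
by have := W2c ix kn; have := W2d ix kn; lra.
Qed.

Let face3 : - k3 * (b - a) * (d - c) <= \sum_(0 <= i < nx) \sum_(0 <= j < ny) \sum_(0 <= k < ns)
  (W3 (X i) (Y j) (S k.+1) - W3 (X i) (Y j) (S k)) * (X i.+1 - X i) * (Y j.+1 - Y j).
Proof.
rewrite [X in X <= _](_ : _ = \sum_(0 <= i < nx) (- k3 * (d - c)) * (X i.+1 - X i)); last first.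
  by rewrite sum_step X0 Xn; ring.
rewrite !big_nat; apply: ler_sum => i /andP[_ ix].
rewrite [X in X <= _](_ : _ = \sum_(0 <= j < ny) (- k3 * (X i.+1 - X i)) * (Y j.+1 - Y j)); last first.
  by rewrite sum_step Y0 Yn; ring.
rewrite !big_nat; apply: ler_sum => j /andP[_ jy].
under eq_bigr do rewrite -mulrA.
rewrite -mulr_suml (telescope_sumr (fun k => W3 (X i) (Y j) (S k)))// S0 Sn -!mulrA.
apply: ler_wpM2r; first by rewrite mulr_ge0.
by have := W3e ix jy; have := W3f ix jy; lra.
Qed.

(** Telescoping: the sum over the cells of the three differences is the flux
    through the faces of the box, and the bounds on the faces are summed up.  Only the
    sign or one bound is available on each face; on the face where the second variable
    is c the bound beta may depend on the first variable. *)
Lemma cell_flux : (\sum_(0 <= i < nx) beta i * (X i.+1 - X i)) * (f - e) <=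
  K * (b - a) * (d - c) * (f - e) + k1 * (d - c) * (f - e) + k3 * (b - a) * (d - c).
Proof.
have := face2; set B := \sum_(0 <= i < nx) beta _ * _ => F2.
have := lerD (lerD face1 F2) face3; clearbody B; rewrite -!big_split /=.
under eq_bigr do rewrite -!big_split /=.
under eq_bigr do under eq_bigr do rewrite -!big_split /=.
move=> H.
have : - k1 * (d - c) * (f - e) + B * (f - e)
   + - k3 * (b - a) * (d - c) <= K * (b - a) * (d - c) * (f - e).
  apply: (le_trans H); rewrite -vol !big_nat; apply: ler_sum => i /andP[_ ix].
  rewrite !big_nat; apply: ler_sum => j /andP[_ jy].
  by rewrite !big_nat; apply: ler_sum => k /andP[_ kn]; exact: cell.
lra.
Qed.

End Cells.

Lemma mvt_uniform (F DF : R -> R) (x x' eta : R) : x <= x' ->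
  (forall t, x <= t <= x' -> is_derive t 1 F (DF t)) ->
  (forall t, x <= t <= x' -> `|DF x - DF t| < eta) ->
  F x' - F x <= (DF x + eta) * (x' - x).
Proof.
move=> xx' dF uF.
have [t + ->] : exists2 t, t \in `[x, x']%R & F x' - F x = DF t * (x' - x).
  apply: MVT_segment => //.
    by move=> t; rewrite in_itv /= => /andP[/ltW xt /ltW tx]; apply: dF; rewrite xt.
  apply: derivable_within_continuous => t; rewrite in_itv /= => tI.
  by have [] := dF t tI.
rewrite in_itv /= => /uF; rewrite ltr_norml => /andP[lb _].
by apply: ler_wpM2r; [rewrite subr_ge0|lra].
Qed.

Definition grid (x h : R) (i : nat) : R := x + h * i%:R.

Lemma gridS x h i : grid x h i.+1 - grid x h i = h.
Proof. by rewrite /grid -natr1; ring. Qed.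

Lemma grid_le (x y : R) N i : x <= y -> (i <= N)%N -> (0 < N)%N ->
  x <= grid x ((y - x) / N%:R) i <= y.
Proof.
move=> xy iN N0; have N0' : 0 < N%:R :> R by rewrite ltr0n.
rewrite /grid lerDl mulr_ge0 ?divr_ge0 ?subr_ge0 ?ler0n//=.
rewrite -lerBrDl mulrAC ler_pdivrMr//.
by apply: ler_wpM2l; rewrite ?subr_ge0 ?ler_nat.
Qed.

Lemma gridN (x y : R) N : (0 < N)%N -> grid x ((y - x) / N%:R) N = y.
Proof. by move=> N0; rewrite /grid divfK ?pnatr_eq0 -?lt0n// addrC subrK. Qed.

(** A grid with x0 among its nodes: the bound on one face changes at x0. *)
Definition grid2 (a x0 b : R) (N i : nat) : R :=
  if (i < N)%N then grid a ((x0 - a) / N%:R) i else grid x0 ((b - x0) / N%:R) (i - N).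

Lemma grid2E a x0 b N i : (0 < N)%N -> (i <= N)%N ->
  grid2 a x0 b N i = grid a ((x0 - a) / N%:R) i.
Proof.
move=> N0; rewrite leq_eqVlt => /predU1P[->|iN]; last by rewrite /grid2 iN.
by rewrite /grid2 ltnn subnn gridN// /grid mulr0 addr0.
Qed.

Section Flux.
Variables (W1 W2 W3 D1 D2 D3 : R -> R -> R -> R) (a x0 b c d e f K k1 k2 k3 k4 : R).
Hypotheses (ax0 : a <= x0) (x0b : x0 <= b) (cd : c <= d) (ef : e <= f).
Let box x y s := [/\ a <= x <= b, c <= y <= d & e <= s <= f].
Hypothesis dW1 : forall x y s, box x y s -> is_derive x 1 (fun t => W1 t y s) (D1 x y s).
Hypothesis dW2 : forall x y s, box x y s -> is_derive y 1 (fun t => W2 x t s) (D2 x y s).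
Hypothesis dW3 : forall x y s, box x y s -> is_derive s 1 (fun t => W3 x y t) (D3 x y s).
Hypothesis cD1 : forall x y s, box x y s ->
  {for (x, y, s), continuous (fun p : R * R * R => D1 p.1.1 p.1.2 p.2)}.
Hypothesis cD2 : forall x y s, box x y s ->
  {for (x, y, s), continuous (fun p : R * R * R => D2 p.1.1 p.1.2 p.2)}.
Hypothesis cD3 : forall x y s, box x y s ->
  {for (x, y, s), continuous (fun p : R * R * R => D3 p.1.1 p.1.2 p.2)}.
Hypothesis divW : forall x y s, box x y s -> D1 x y s + D2 x y s + D3 x y s <= K.
Hypothesis W1a : forall y s, c <= y <= d -> e <= s <= f -> W1 a y s <= k1.
Hypothesis W1b : forall y s, c <= y <= d -> e <= s <= f -> 0 <= W1 b y s.
Hypothesis W2c : forall x s, a <= x <= x0 -> e <= s <= f -> k4 <= - W2 x c s.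
Hypothesis W2c' : forall x s, x0 <= x <= b -> e <= s <= f -> - k2 <= - W2 x c s.
Hypothesis W2d : forall x s, a <= x <= b -> e <= s <= f -> 0 <= W2 x d s.
Hypothesis W3e : forall x y, a <= x <= b -> c <= y <= d -> W3 x y e <= k3.
Hypothesis W3f : forall x y, a <= x <= b -> c <= y <= d -> 0 <= W3 x y f.

(** The divergence theorem as an inequality, without integrals.  On a cell of a fine
    grid the mean value theorem bounds each difference by the derivative at a corner plus
    eta, so the three differences add up to at most (K + 3 eta) times the volume, and eta
    is arbitrary. *)
Lemma box_flux : (k4 * (x0 - a) - k2 * (b - x0)) * (f - e) <=
  K * (b - a) * (d - c) * (f - e) + k1 * (d - c) * (f - e) + k3 * (b - a) * (d - c).
Proof.
have vol0 : 0 <= (b - a) * (d - c) * (f - e) by rewrite !mulr_ge0 ?subr_ge0// (le_trans ax0).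
(* It suffices to bound the divergence by K + 3 eta. *)
suff H (eta : R) : 0 < eta -> (k4 * (x0 - a) - k2 * (b - x0)) * (f - e) <=
  (K + 3 * eta) * (b - a) * (d - c) * (f - e) + k1 * (d - c) * (f - e) + k3 * (b - a) * (d - c).
  apply/ler_addgt0Pr => eps eps0.
  set V := (b - a) * (d - c) * (f - e) in vol0.
  have V3 : 0 < 3 * (V + 1) by rewrite mulr_gt0// ltr_wpDl.
  pose et := eps / (3 * (V + 1)); have et0 : 0 < et by rewrite divr_gt0.
  have etE : et * (3 * (V + 1)) = eps by rewrite /et divfK// gt_eqF.
  apply: (le_trans (H _ et0)).
  have -> : (K + 3 * et) * (b - a) * (d - c) * (f - e) =
    K * (b - a) * (d - c) * (f - e) + (eps - 3 * et) by rewrite -etE /V; ring.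
  lra.
move=> eta0.
have cK := @compact_box3 a b c d e f.
have inb x y s : box3 a b c d e f (x, y, s) -> box x y s by [].
have [r1 r10 u1] := compact_unif cK (fun p => match p with (x, y, s) => fun Kp => cD1 (inb x y s Kp) end) eta0.
have [r2 r20 u2] := compact_unif cK (fun p => match p with (x, y, s) => fun Kp => cD2 (inb x y s Kp) end) eta0.
have [r3 r30 u3] := compact_unif cK (fun p => match p with (x, y, s) => fun Kp => cD3 (inb x y s Kp) end) eta0.
pose rho := Num.min r1 (Num.min r2 r3).
have rho0 : 0 < rho by rewrite !lt_min r10 r20 r30.
have [N N0 Nrho] : exists2 N : nat, (0 < N)%N & ((b - a) + (d - c) + (f - e)) / rho < N%:R.
  exists (Num.trunc (((b - a) + (d - c) + (f - e)) / rho)).+1 => //.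
  exact: truncnS_gt.
have N0' : 0 < N%:R :> R by rewrite ltr0n.
have ax0' : 0 <= x0 - a by rewrite subr_ge0.
have x0b' : 0 <= b - x0 by rewrite subr_ge0.
have cd' : 0 <= d - c by rewrite subr_ge0.
have ef' : 0 <= f - e by rewrite subr_ge0.
have small1 : x0 - a <= (b - a) + (d - c) + (f - e) by lra.
have small2 : b - x0 <= (b - a) + (d - c) + (f - e) by lra.
have small3 : d - c <= (b - a) + (d - c) + (f - e) by lra.
have small4 : f - e <= (b - a) + (d - c) + (f - e) by lra.
have small z : 0 <= z -> z <= (b - a) + (d - c) + (f - e) -> 0 <= z / N%:R /\ z / N%:R < rho.
  move=> z0 zL; split; first by rewrite divr_ge0// ltW.
  by rewrite ltr_pdivrMr// mulrC -ltr_pdivrMr//; apply: le_lt_trans Nrho; rewrite ler_pM2r ?invr_gt0.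
have [hx1 hx1r] : 0 <= (x0 - a) / N%:R /\ (x0 - a) / N%:R < rho by apply: small.
have [hx2 hx2r] : 0 <= (b - x0) / N%:R /\ (b - x0) / N%:R < rho by apply: small.
have [hy hyr] : 0 <= (d - c) / N%:R /\ (d - c) / N%:R < rho by apply: small.
have [hs hsr] : 0 <= (f - e) / N%:R /\ (f - e) / N%:R < rho by apply: small.
pose X := grid2 a x0 b N; pose Y := grid c ((d - c) / N%:R); pose S := grid e ((f - e) / N%:R).
have XL i : (i < N)%N -> X i.+1 - X i = (x0 - a) / N%:R.
  by move=> iN; rewrite /X !grid2E// ?gridS// ltnW.
have XR i : (N <= i)%N -> X i.+1 - X i = (b - x0) / N%:R.
  by move=> iN; rewrite /X /grid2 !ltnNge iN (leq_trans iN)//= subSn// gridS.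
have Xinc i : 0 <= X i.+1 - X i < rho.
  by case: (ltnP i N) => iN; [rewrite XL// hx1|rewrite XR// hx2].
have XbL i : (i <= N)%N -> a <= X i <= x0.
  by move=> iN; rewrite /X grid2E//; exact: grid_le.
have XbR i : (N <= i)%N -> (i <= N + N)%N -> x0 <= X i <= b.
  move=> Ni iN; rewrite /X /grid2 ltnNge Ni /=; apply: grid_le => //.
  by rewrite leq_subLR.
have Xb i : (i <= N + N)%N -> a <= X i <= b.
  move=> iN; case: (leqP i N) => [/XbL|/ltnW/XbR/(_ iN)] /andP[l r]; apply/andP; split; lra.
have Yb j : (j <= N)%N -> c <= Y j <= d by move=> jN; exact: grid_le.
have Sb k : (k <= N)%N -> e <= S k <= f by move=> kN; exact: grid_le.
have X0 : X 0 = a by rewrite /X /grid2 N0 /grid mulr0 addr0.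
have Xn : X (N + N)%N = b by rewrite /X /grid2 ltnNge leq_addl /= addnK gridN.
have Y0 : Y 0 = c by rewrite /Y /grid mulr0 addr0.
have S0 : S 0 = e by rewrite /S /grid mulr0 addr0.
pose beta i := if (i < N)%N then k4 else - k2.
have ballP (x y s x' y' s' r : R) : 0 < r -> `|x - x'| < r -> `|y - y'| < r -> `|s - s'| < r ->
  ball (x, y, s) r (x', y', s') by move=> _ h1 h2 h3; split; [split; [exact: h1|exact: h2]|exact: h3].
have rr : [/\ rho <= r1, rho <= r2 & rho <= r3] by rewrite /rho !ge_min !lexx ?orbT.
case: rr => rr1 rr2 rr3.
have sum_beta : \sum_(0 <= i < N + N) beta i * (X i.+1 - X i) = k4 * (x0 - a) - k2 * (b - x0).
  rewrite (big_cat_nat (leq0n N) (leq_addr N N))/=.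
  rewrite (_ : \sum_(0 <= i < N) _ = k4 * (x0 - a)); last first.
    transitivity (\sum_(0 <= i < N) k4 * (X i.+1 - X i)).
      by rewrite !big_nat; apply: eq_bigr => i /andP[_ iN]; rewrite /beta iN.
    by rewrite -mulr_sumr telescope_sumr// X0 /X grid2E// gridN.
  rewrite (_ : \sum_(N <= i < N + N) _ = - k2 * (b - x0)) ?mulNr//.
  transitivity (\sum_(N <= i < N + N) - k2 * (X i.+1 - X i)).
    by rewrite !big_nat; apply: eq_bigr => i /andP[iN _]; rewrite /beta ltnNge iN.
  by rewrite -mulr_sumr telescope_sumr ?leq_addr// Xn /X grid2E// gridN// mulNr.
rewrite -sum_beta.
have seg (p h t r : R) : 0 <= h -> h < r -> p <= t <= p + h -> `|p - t| < r.
  by move=> h0 hr /andP[pt th]; rewrite ltr_norml; apply/andP; split; lra.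
have Xm i : X i <= X i.+1 by have /andP[] := Xinc i; rewrite subr_ge0.
have Ym i : Y i <= Y i.+1 by rewrite -subr_ge0 gridS.
have Sm i : S i <= S i.+1 by rewrite -subr_ge0 gridS.
have YN : Y N = d by exact: gridN.
have SN : S N = f by exact: gridN.
apply: (@cell_flux W1 W2 W3 a b c d e f X Y S (N + N)%N N N X0 Xn Xm Y0 YN Ym S0
  SN Sm (K + 3 * eta)).
- move=> i j k iN jN kN.
  have /andP[Xi0 Xir] := Xinc i.
  have [xi xi1] := (Xb _ (ltnW iN), Xb _ iN).
  have [yj yj1] := (Yb _ (ltnW jN), Yb _ jN).
  have [sk sk1] := (Sb _ (ltnW kN), Sb _ kN).
  have sYj : Y j.+1 - Y j = (d - c) / N%:R by exact: gridS.
  have sSk : S k.+1 - S k = (f - e) / N%:R by exact: gridS.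
  have hYj : 0 <= Y j.+1 - Y j by rewrite sYj.
  have hSk : 0 <= S k.+1 - S k by rewrite sSk.
  have rYj : Y j.+1 - Y j < rho by rewrite sYj.
  have rSk : S k.+1 - S k < rho by rewrite sSk.
  move: (X i) (X i.+1) (Y j) (Y j.+1) (S k) (S k.+1) Xi0 Xir xi xi1 yj yj1 sk sk1 hYj hSk rYj rSk
    => x x' y y' s s' {}hx {}hxr xb x'b yb y'b sb s'b {}hy hs' hyr' hsr'.
  have m1 : W1 x' y s - W1 x y s <= (D1 x y s + eta) * (x' - x).
    apply: (@mvt_uniform (fun t => W1 t y s) (fun t => D1 t y s)); first by rewrite -subr_ge0.
      by move=> t tx; apply: dW1; split=> //; lra.
    move=> t tx; apply: (u1 (x, y, s) (t, y, s)); first by split.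
    by apply: ballP; rewrite ?subrr ?normr0// ltr_norml; lra.
  have m2 : W2 x y' s - W2 x y s <= (D2 x y s + eta) * (y' - y).
    apply: (@mvt_uniform (fun t => W2 x t s) (fun t => D2 x t s)); first by rewrite -subr_ge0.
      by move=> t tx; apply: dW2; split=> //; lra.
    move=> t tx; apply: (u2 (x, y, s) (x, t, s)); first by split.
    by apply: ballP; rewrite ?subrr ?normr0// ltr_norml; lra.
  have m3 : W3 x y s' - W3 x y s <= (D3 x y s + eta) * (s' - s).
    apply: (@mvt_uniform (fun t => W3 x y t) (fun t => D3 x y t)); first by rewrite -subr_ge0.
      by move=> t tx; apply: dW3; split=> //; lra.
    move=> t tx; apply: (u3 (x, y, s) (x, y, t)); first by split.
    by apply: ballP; rewrite ?subrr ?normr0// ltr_norml; lra.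
  have dv := divW (And3 xb yb sb).
  have e1 := ler_wpM2r hs' (ler_wpM2r hy m1).
  have e2 := ler_wpM2r hs' (ler_wpM2r hx m2).
  have e3 := ler_wpM2r hy (ler_wpM2r hx m3).
  have e4 := ler_wpM2r hs' (ler_wpM2r hy (ler_wpM2r hx dv)).
  apply: (le_trans (lerD (lerD e1 e2) e3)).
  rewrite (_ : _ + _ + _ = (D1 x y s + D2 x y s + D3 x y s) * (x' - x) * (y' - y) * (s' - s) +
    3 * eta * (x' - x) * (y' - y) * (s' - s)); last by ring.
  rewrite (_ : (K + 3 * eta) * _ * _ * _ = K * (x' - x) * (y' - y) * (s' - s) +
    3 * eta * (x' - x) * (y' - y) * (s' - s)); last by ring.
  by rewrite lerD2r.
- by move=> j k jN kN; apply: W1a; [apply: Yb|apply: Sb]; exact: ltnW.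
- by move=> j k jN kN; apply: W1b; [apply: Yb|apply: Sb]; exact: ltnW.
- move=> i k iN kN; rewrite /beta; case: ltnP => iN'.
    by apply: W2c; [apply: XbL|apply: Sb]; exact: ltnW.
  by apply: W2c'; [apply: XbR => //|apply: Sb]; exact: ltnW.
- by move=> i k iN kN; apply: W2d; [apply: Xb|apply: Sb]; exact: ltnW.
- by move=> i j iN jN; apply: W3e; [apply: Xb|apply: Yb]; exact: ltnW.
- by move=> i j iN jN; apply: W3f; [apply: Xb|apply: Yb]; exact: ltnW.
Qed.
End Flux.
End BoxFlux.

(** * Derivatives in one variable and the cutoff *)

Section Rules.
Context {R : realType}.
Implicit Types (f g : R -> R) (t df dg c : R).

Lemma is_derive_mul f g t df dg : is_derive t 1 f df -> is_derive t 1 g dg ->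
  is_derive t 1 (fun z => f z * g z) (df * g t + f t * dg).
Proof.
move=> hf hg; apply: (@is_derive_eq _ _ _ _ _ _ _ _ (is_deriveM hf hg)).
by rewrite addrC; congr (_ + _); exact: mulrC.
Qed.

Lemma is_derive_add f g t df dg : is_derive t 1 f df -> is_derive t 1 g dg ->
  is_derive t 1 (fun z => f z + g z) (df + dg).
Proof. by move=> hf hg; exact: is_deriveD. Qed.

Lemma is_derive_opp f t df : is_derive t 1 f df -> is_derive t 1 (fun z => - f z) (- df).
Proof. by move=> hf; exact: is_deriveN. Qed.

Lemma is_derive_const c t : is_derive t 1 (fun=> c) 0.
Proof. exact: is_derive_cst. Qed.

Lemma is_derive_var t : is_derive t 1 (fun z => z) 1.
Proof. exact: is_derive_id. Qed.

Lemma is_derive_inv f t df : f t != 0 -> is_derive t 1 f df ->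
  is_derive t 1 (fun z => (f z)^-1) (- (df * ((f t)^-1 * (f t)^-1))).
Proof.
move=> f0 hf; apply: (@is_derive_eq _ _ _ _ _ _ _ _ (is_deriveV f0 hf)).
by rewrite /GRing.scale /= -exprVn expr2; ring.
Qed.

Lemma is_derive_comp f g t df dg : is_derive (g t) 1 f df -> is_derive t 1 g dg ->
  is_derive t 1 (fun z => f (g z)) (df * dg).
Proof. by move=> hf hg; exact: is_derive1_comp. Qed.

Lemma is_derive_conv f t df dg : is_derive t 1 f df -> df = dg -> is_derive t 1 f dg.
Proof. by move=> h <-. Qed.

End Rules.

Section Cutoff.
Context {R : realType}.
Implicit Types (P : R -> R) (t k tau : R).

(** Extension by 0 to the negative half-line; it keeps as many derivatives as vanish
    at 0. *)
Definition cut P t : R := if t <= 0 then 0 else P t.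

Lemma is_derive_cut P (P' : R -> R) t : P 0 = 0 -> P' 0 = 0 ->
  (forall t, 0 <= t -> is_derive t 1 P (P' t)) -> is_derive t 1 (cut P) (cut P' t).
Proof.
move=> P0 P'0 dP; rewrite [cut P' t]/cut; case: ltgtP => t0.
- apply: (@near_eq_is_derive _ _ _ (cst 0)).
  near=> z; rewrite /cut ltW//; near: z.
  exact: lt_nbhsl.
- apply: (near_eq_is_derive _ (dP t (ltW t0))).
  near=> z; rewrite /cut leNgt (_ : 0 < z)//; near: z.
  exact: lt_nbhsr.
- rewrite t0; have [dp ep] := dP 0 (lexx _); rewrite P'0 in ep.
  have cvP : h^-1 *: (P (h *: 1 + 0) - P 0) @[h --> 0^'] --> (0 : R).
    by rewrite -[X in _ --> X]ep; exact: dp.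
  suff cv : h^-1 *: (cut P (h *: 1 + 0) - cut P 0) @[h --> 0^'] --> (0 : R).
    by apply: DeriveDef; [apply/cvg_ex; exists 0|apply/cvg_lim].
  apply/cvgrPdist_lt => e e0; move/cvgrPdist_lt : cvP => /(_ e e0).
  apply: filterS => h; rewrite !sub0r !normrN; apply: le_lt_trans.
  rewrite /cut lexx subr0 P0 subr0; case: ifP => _ //.
  by rewrite scaler0 normr0.
Unshelve. all: by end_near. Qed.

Lemma continuous_cut P t : P 0 = 0 ->
  (forall t, 0 <= t -> {for t, continuous P}) -> {for t, continuous (cut P)}.
Proof.
move=> P0 cP; apply/cvgrPdist_lt => e e0; case: (ltgtP t 0) => t0.
- near=> z; rewrite /cut !ltW ?subrr ?normr0//; near: z.
  exact: lt_nbhsl.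
- have := cP t (ltW t0) => /cvgrPdist_lt/(_ e e0) H.
  near=> z; rewrite /cut !leNgt t0 (_ : 0 < z) /=; last by near: z; exact: lt_nbhsr.
  by near: z.
- have := cP 0 (lexx _) => /cvgrPdist_lt/(_ e e0); rewrite t0; apply: filterS => z.
  by rewrite P0 /cut lexx; case: ifP => // _; rewrite subrr normr0.
Unshelve. all: by end_near. Qed.

(** On the half-line t >= 0 this is convex with slope at most 1, it vanishes at 0
    with its first two derivatives, and it is comparable with t once t is at least a
    multiple of tau.  [ramp1] and [ramp2] are its derivatives. *)
Definition ramp tau t : R := t * (t * t) * ((tau + t) * (tau + t))^-1.
Definition ramp1 tau t : R :=
  t * (t * (t + 3 * tau)) * ((tau + t) * ((tau + t) * (tau + t)))^-1.
Definition ramp2 tau t : R := 6 * tau ^+ 2 * t * ((tau + t) ^+ 4)^-1.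

Lemma is_derive_ramp tau t : 0 < tau -> 0 <= t ->
  is_derive t 1 (ramp tau) (ramp1 tau t).
Proof.
move=> tau0 t0; have tt : tau + t != 0 by rewrite gt_eqF// ltr_wpDr.
have d1 := is_derive_add (is_derive_const tau t) (is_derive_var t).
have i := is_derive_var t.
have t2 : (tau + t) * (tau + t) != 0 by rewrite mulf_neq0.
refine (is_derive_conv (is_derive_mul (is_derive_mul i (is_derive_mul i i)) (is_derive_inv _ (is_derive_mul d1 d1))) _) => //.
by rewrite /ramp1; field.
Qed.

Lemma is_derive_ramp1 tau t : 0 < tau -> 0 <= t ->
  is_derive t 1 (ramp1 tau) (ramp2 tau t).
Proof.
move=> tau0 t0; have tt : tau + t != 0 by rewrite gt_eqF// ltr_wpDr.
have d1 := is_derive_add (is_derive_const tau t) (is_derive_var t).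
have i := is_derive_var t.
have t2 : (tau + t) * ((tau + t) * (tau + t)) != 0 by rewrite !mulf_neq0.
refine (is_derive_conv (is_derive_mul (is_derive_mul i (is_derive_mul i (is_derive_add i (is_derive_const (3 * tau) t)))) (is_derive_inv _ (is_derive_mul d1 (is_derive_mul d1 d1)))) _) => //.
by rewrite /ramp2; field.
Qed.

Lemma continuous_ramp2 tau t : 0 < tau -> 0 <= t -> {for t, continuous (ramp2 tau)}.
Proof.
move=> tau0 t0; have tt : tau + t != 0 by rewrite gt_eqF// ltr_wpDr.
apply: cvgM; first by apply: cvgM; [exact: cvg_cst|exact: cvg_id].
apply: cvgV; first by rewrite expf_neq0.
apply: (@continuous_comp _ _ _ (fun z => tau + z) (fun z => z ^+ 4)).
  by apply: cvgD; [exact: cvg_cst|exact: cvg_id].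
exact: exprn_continuous.
Qed.

Variables (k tau : R).
Hypothesis tau0 : 0 < tau.

(** The convex cutoff: zero up to k, growing on the scale tau. *)
Definition G0 t := cut (ramp tau) (t - k).
Definition G1 t := cut (ramp1 tau) (t - k).
Definition G2 t := cut (ramp2 tau) (t - k).

Let isd_sub t : is_derive t 1 (fun z => z - k) 1.
Proof. by apply: (is_derive_conv (is_derive_add (is_derive_var t) (is_derive_const (- k) t))); rewrite addr0. Qed.

Lemma is_derive_G0 t : is_derive t 1 G0 (G1 t).
Proof.
refine (is_derive_conv (is_derive_comp (@is_derive_cut _ (ramp1 tau) _ _ _ (fun z => @is_derive_ramp tau z tau0)) (isd_sub t)) _).
- by rewrite /ramp !mul0r.
- by rewrite /ramp1 !mul0r.
- by rewrite mulr1.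
Qed.

Lemma is_derive_G1 t : is_derive t 1 G1 (G2 t).
Proof.
refine (is_derive_conv (is_derive_comp (@is_derive_cut _ (ramp2 tau) _ _ _ (fun z => @is_derive_ramp1 tau z tau0)) (isd_sub t)) _).
- by rewrite /ramp1 !mul0r.
- by rewrite /ramp2 mulr0 mul0r.
- by rewrite mulr1.
Qed.

Lemma continuous_G2 : continuous G2.
Proof.
move=> t; apply: (@continuous_comp _ _ _ (fun z => z - k) (cut (ramp2 tau))).
  by apply: cvgB; [exact: cvg_id|exact: cvg_cst].
apply: continuous_cut; first by rewrite /ramp2 mulr0 mul0r.
by move=> z z0; exact: continuous_ramp2.
Qed.

Lemma continuous_G1 : continuous G1.
Proof.
by move=> t; apply/differentiable_continuous/derivable1_diffP; have [] := is_derive_G1 t.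
Qed.

Lemma continuous_G0 : continuous G0.
Proof.
by move=> t; apply/differentiable_continuous/derivable1_diffP; have [] := is_derive_G0 t.
Qed.

Lemma G_eq0 t : t <= k -> [/\ G0 t = 0, G1 t = 0 & G2 t = 0].
Proof. by rewrite -subr_le0 /G0 /G1 /G2 /cut => ->. Qed.

Let pos3 t : ~~ (t - k <= 0) -> exists2 w, 0 < w & t - k = w.
Proof. by rewrite -ltNge => h; exists (t - k). Qed.

Lemma G0_ge0 t : 0 <= G0 t.
Proof.
rewrite /G0 /cut; case: ifPn => // /pos3[w w0 ->]; rewrite /ramp.
by rewrite mulr_ge0 ?invr_ge0 ?mulr_ge0 ?addr_ge0// ltW.
Qed.

Lemma G0_le t z : 0 <= z -> t - k <= z -> G0 t <= z.
Proof.
move=> z0; rewrite /G0 /cut; case: ifPn => // /pos3[w w0 ->] wz; rewrite /ramp.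
apply: le_trans wz; have wt : 0 < tau + w by rewrite addr_gt0.
rewrite ler_pdivrMr ?mulr_gt0// ler_pM2l//.
have ww : w <= tau + w by rewrite lerDr ltW.
by apply: ler_pM => //; exact: ltW.
Qed.

Lemma G1_ge0 t : 0 <= G1 t.
Proof.
rewrite /G1 /cut; case: ifPn => // /pos3[w w0 ->]; rewrite /ramp1.
by rewrite mulr_ge0 ?invr_ge0 ?mulr_ge0 ?addr_ge0 ?mulr_ge0// ltW.
Qed.

Lemma G1_le1 t : G1 t <= 1.
Proof.
rewrite /G1 /cut; case: ifPn => // /pos3[w w0 ->]; rewrite /ramp1.
have wt : 0 < tau + w by rewrite addr_gt0.
rewrite ler_pdivrMr ?mulr_gt0// mul1r -subr_ge0.
rewrite (_ : _ - _ = tau * (tau * (tau + 3 * w))); last by ring.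
by rewrite !mulr_ge0 ?addr_ge0 ?mulr_ge0// ltW.
Qed.

Lemma G2_ge0 t : 0 <= G2 t.
Proof.
rewrite /G2 /cut; case: ifPn => // /pos3[w w0 ->]; rewrite /ramp2.
by rewrite mulr_ge0 ?invr_ge0 ?exprn_ge0 ?mulr_ge0 ?exprn_ge0 ?addr_ge0// ltW.
Qed.

(** On t >= tau/2 one has tau + t <= 3 t, hence t^3 / (tau + t)^2 >= t/9. *)
Lemma G0_lower t : k + tau / 2 <= t -> tau / 18 <= G0 t.
Proof.
have tau0' := tau0; move=> kt; have h : 0 < t - k by lra.
rewrite /G0 /cut (leNgt (t - k)) h /=; have : tau / 2 <= t - k by rewrite lerBrDl.
move: (t - k) h => w w0 hw; rewrite /ramp.
have wt : 0 < tau + w by rewrite addr_gt0.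
rewrite ler_pdivlMr ?mulr_gt0//.
have h3 : tau + w <= 3 * w by lra.
have h9 : (tau + w) * (tau + w) <= 9 * (w * w).
  by rewrite (_ : 9 * _ = (3 * w) * (3 * w)); [apply: ler_pM => //; exact: ltW|ring].
apply: (@le_trans _ _ (tau / 18 * (9 * (w * w)))).
  by apply: ler_wpM2l => //; lra.
rewrite (_ : _ / _ * _ = tau / 2 * (w * w)); last by field.
by apply: ler_wpM2r => //; rewrite mulr_ge0// ltW.
Qed.

End Cutoff.

(** * The inverse Hessian and the intercept of the tangent planes *)

Ltac gen_atoms := repeat match goal with
  | |- context [pd ?i ?f ?x] => move: (pd i f x) => ?
  end.

Section Potential.
Context {R : realType}.
Implicit Types (u : R * R -> R) (x p z : R * R).

Definition H11 u := pd 0 (pd 0 u).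
Definition H12 u := pd 0 (pd 1 u).
Definition H22 u := pd 1 (pd 1 u).
Definition hdet u x : R := H11 u x * H22 u x - H12 u x * H12 u x.
Definition m11 u x : R := H22 u x * (hdet u x)^-1.
Definition m12 u x : R := - (H12 u x * (hdet u x)^-1).
Definition m22 u x : R := H11 u x * (hdet u x)^-1.
(** [V1] and [V2] are the row divergences of the inverse Hessian: the operator of the
    equation is the divergence of this field. *)
Definition V1 u x : R := pd 0 (m11 u) x + pd 1 (m12 u) x.
Definition V2 u x : R := pd 0 (m12 u) x + pd 1 (m22 u) x.
(** The value at the origin of the tangent plane at x; convexity bounds it by u(0,0),
    and its gradient [J1], [J2] is - D^2u(x) x, so no first derivatives of u remain. *)
Definition icpt u x : R := u x - (x.1 * pd 0 u x + x.2 * pd 1 u x).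
Definition J1 u x : R := - (x.1 * H11 u x + x.2 * H12 u x).
Definition J2 u x : R := - (x.1 * H12 u x + x.2 * H22 u x).

Lemma hdetE u x : hdet u x = H11 u x * H22 u x - H12 u x * H12 u x. Proof. by []. Qed.
Lemma m11E u x : m11 u x = H22 u x * (hdet u x)^-1. Proof. by []. Qed.
Lemma m12E u x : m12 u x = - (H12 u x * (hdet u x)^-1). Proof. by []. Qed.
Lemma m22E u x : m22 u x = H11 u x * (hdet u x)^-1. Proof. by []. Qed.

Definition quad (dl : R) : set (R * R) := [set x | [/\ 0 < x.1, 0 < x.2 & x.1 + x.2 < dl]].

Lemma open_quad dl : open (quad dl).
Proof.
have -> : quad dl = [set x : R * R | 0 < x.1] `&` [set x : R * R | 0 < x.2]
    `&` [set x : R * R | x.1 + x.2 < dl].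
  by apply/seteqP; split => x; [case|move=> [[]]].
have cf : continuous (fst : R * R -> R) by move=> y; exact: cvg_fst.
have cs : continuous (snd : R * R -> R) by move=> y; exact: cvg_snd.
apply: openI; first apply: openI.
- exact: (@open_comp _ _ (fst : R * R -> R) [set x | 0 < x] (fun x _ => cf x) (@open_gt R 0)).
- exact: (@open_comp _ _ (snd : R * R -> R) [set x | 0 < x] (fun x _ => cs x) (@open_gt R 0)).
- apply: (@open_comp _ _ (fun x : R * R => x.1 + x.2) [set x | x < dl]); last exact: open_lt.
  by move=> x _; apply: cvgD; [exact: cf|exact: cs].
Qed.

Section OnQuad.
Variables (u : R * R -> R) (dl : R).
Let Q := quad dl.
Hypothesis su : smooth_in Q u.
Hypothesis pu : forall x, Q x -> 0 < H11 u x /\ 0 < hdet u x.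
Let oQ : open Q := @open_quad dl.

Lemma smooth_H11 : smooth_in Q (H11 u). Proof. by do 2 apply: smooth_pd. Qed.
Lemma smooth_H12 : smooth_in Q (H12 u). Proof. by do 2 apply: smooth_pd. Qed.
Lemma smooth_H22 : smooth_in Q (H22 u). Proof. by do 2 apply: smooth_pd. Qed.
Let s1 := smooth_H11. Let s2 := smooth_H12. Let s3 := smooth_H22.

Lemma smooth_hdet : smooth_in Q (hdet u).
Proof.
by apply: smoothD => //; [exact: smoothM|apply: smoothN => //; exact: smoothM].
Qed.

Lemma smooth_hdetV : smooth_in Q (fun x => (hdet u x)^-1).
Proof. by apply: smoothV => //; [move=> x /pu[_ /gt_eqF->]|exact: smooth_hdet]. Qed.
Let s4 := smooth_hdetV.

Lemma smooth_m11 : smooth_in Q (m11 u). Proof. exact: smoothM. Qed.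
Lemma smooth_m12 : smooth_in Q (m12 u). Proof. by apply: smoothN => //; exact: smoothM. Qed.
Lemma smooth_m22 : smooth_in Q (m22 u). Proof. exact: smoothM. Qed.

Lemma smooth_V1 : smooth_in Q (V1 u).
Proof. by apply: smoothD => //; apply: smooth_pd; [exact: smooth_m11|exact: smooth_m12]. Qed.

Lemma smooth_V2 : smooth_in Q (V2 u).
Proof. by apply: smoothD => //; apply: smooth_pd; [exact: smooth_m12|exact: smooth_m22]. Qed.

Lemma smooth_icpt : smooth_in Q (icpt u).
Proof.
apply: smoothD => //; apply: smoothN => //; apply: smoothD => //; apply: smoothM => //.
- exact: smooth_fst.
- exact: smooth_pd.
- exact: smooth_snd.
- exact: smooth_pd.
Qed.

Lemma smooth_J1 : smooth_in Q (J1 u).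
Proof.
by apply: smoothN => //; apply: smoothD => //; apply: smoothM => //; [exact: smooth_fst|exact: smooth_snd].
Qed.

Lemma smooth_J2 : smooth_in Q (J2 u).
Proof.
by apply: smoothN => //; apply: smoothD => //; apply: smoothM => //; [exact: smooth_fst|exact: smooth_snd].
Qed.

Lemma schwarz_u x : Q x -> pd 1 (pd 0 u) x = H12 u x.
Proof. by move=> Qx; rewrite -(schwarz_pd oQ su Qx). Qed.

Lemma pd1_H11 x : Q x -> pd 1 (H11 u) x = pd 0 (H12 u) x.
Proof.
move=> Qx; rewrite /H11 -(schwarz_pd oQ (smooth_pd 0 su) Qx).
exact: (@pd_eq _ Q (pd 1 (pd 0 u)) (H12 u) 0 oQ schwarz_u).
Qed.

Lemma pd0_H22 x : Q x -> pd 0 (H22 u) x = pd 1 (H12 u) x.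
Proof. by move=> Qx; rewrite /H22 (schwarz_pd oQ (smooth_pd 1 su) Qx). Qed.

Lemma euler_pd i (f g : R * R -> R) x : smooth_in Q f -> smooth_in Q g -> Q x ->
  pd i (fun y => y.1 * f y + y.2 * g y) x =
  (i == 0)%:R * f x + x.1 * pd i f x + ((i == 1)%:R * g x + x.2 * pd i g x).
Proof.
move=> sf sg Qx.
have df := smooth_diff sf Qx; have dg := smooth_diff sg Qx.
have d1 := differentiable_fst x; have d2 := differentiable_snd x.
rewrite pdD ?pdM ?pd_fst ?pd_snd//; exact: differentiableM.
Qed.

Lemma pd0_icpt x : Q x -> pd 0 (icpt u) x = J1 u x.
Proof.
move=> Qx; have su0 := smooth_pd 0 su; have su1 := smooth_pd 1 su.
have se : smooth_in Q (fun y => y.1 * pd 0 u y + y.2 * pd 1 u y).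
  by apply: smoothD => //; apply: smoothM => //; [exact: smooth_fst|exact: smooth_snd].
rewrite /icpt pdD.
- rewrite (pdN 0 se Qx) (euler_pd 0 su0 su1 Qx) /= mul1r mul0r /J1 /H11 /H12; gen_atoms; ring.
- exact: smooth_diff Qx.
- by apply: smooth_diff Qx; exact: smoothN.
Qed.

Lemma pd1_icpt x : Q x -> pd 1 (icpt u) x = J2 u x.
Proof.
move=> Qx; have su0 := smooth_pd 0 su; have su1 := smooth_pd 1 su.
have se : smooth_in Q (fun y => y.1 * pd 0 u y + y.2 * pd 1 u y).
  by apply: smoothD => //; apply: smoothM => //; [exact: smooth_fst|exact: smooth_snd].
rewrite /icpt pdD.
- rewrite (pdN 1 se Qx) (euler_pd 1 su0 su1 Qx) /= mul1r mul0r /J2 -(schwarz_u Qx) /H22; gen_atoms; ring.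
- exact: smooth_diff Qx.
- by apply: smooth_diff Qx; exact: smoothN.
Qed.

Let seul (f g : R * R -> R) : smooth_in Q f -> smooth_in Q g ->
  smooth_in Q (fun y => y.1 * f y + y.2 * g y).
Proof.
by move=> sf sg; apply: smoothD => //; apply: smoothM => //; [exact: smooth_fst|exact: smooth_snd].
Qed.

Lemma pd_J1 i x : Q x -> pd i (J1 u) x =
  - ((i == 0)%:R * H11 u x + x.1 * pd i (H11 u) x +
    ((i == 1)%:R * H12 u x + x.2 * pd i (H12 u) x)).
Proof. by move=> Qx; rewrite (pdN i (seul s1 s2) Qx) (euler_pd i s1 s2 Qx). Qed.

Lemma pd_J2 i x : Q x -> pd i (J2 u) x =
  - ((i == 0)%:R * H12 u x + x.1 * pd i (H12 u) x +
    ((i == 1)%:R * H22 u x + x.2 * pd i (H22 u) x)).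
Proof. by move=> Qx; rewrite (pdN i (seul s2 s3) Qx) (euler_pd i s2 s3 Qx). Qed.

End OnQuad.
End Potential.

(** * The field on pairs of collinear points *)

Section Rules3.
Context {R : realType}.
Notation R3 := (R * R * R)%type.
Implicit Types (f g : R3 -> R) (p : R3).

Lemma cont_mul f g p : {for p, continuous f} -> {for p, continuous g} ->
  {for p, continuous (fun z => f z * g z)}.
Proof. by move=> cf cg; exact: cvgM. Qed.

Lemma cont_add f g p : {for p, continuous f} -> {for p, continuous g} ->
  {for p, continuous (fun z => f z + g z)}.
Proof. by move=> cf cg; exact: cvgD. Qed.

Lemma cont_opp f p : {for p, continuous f} -> {for p, continuous (fun z => - f z)}.
Proof. by move=> cf; exact: cvgN. Qed.

Lemma cont_x p : {for p, continuous (fun z : R3 => z.1.1)}.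
Proof. by apply: (@continuous_comp R3 _ _ fst fst); exact: cvg_fst. Qed.

Lemma cont_y p : {for p, continuous (fun z : R3 => z.1.2)}.
Proof. by apply: (@continuous_comp R3 _ _ fst snd); [exact: cvg_fst|exact: cvg_snd]. Qed.

Lemma cont_s p : {for p, continuous (fun z : R3 => z.2)}.
Proof. exact: cvg_snd. Qed.

Lemma cont_sV p : p.2 != 0 -> {for p, continuous (fun z : R3 => z.2^-1)}.
Proof. by move=> p0; apply: cvgV => //; exact: cont_s. Qed.

Lemma cont_const (c : R) p : {for p, continuous (fun _ : R3 => c)}.
Proof. exact: cvg_cst. Qed.

Lemma cont_comp (F : R -> R) f p : continuous F -> {for p, continuous f} ->
  {for p, continuous (fun z => F (f z))}.
Proof. by move=> cF cf; apply: (@continuous_comp _ _ _ f F) => //; exact: cF. Qed.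

Lemma cont_point (phi : R * R -> R) p : {for (p.1.1, p.1.2), continuous phi} ->
  {for p, continuous (fun z : R3 => phi (z.1.1, z.1.2))}.
Proof.
move=> cphi; apply: (@continuous_comp R3 (R * R)%type R (fun z => (z.1.1, z.1.2)) phi) => //.
exact: (cvg_pair (@cont_x p) (@cont_y p)).
Qed.

Lemma cont_ray (phi : R * R -> R) p : {for (p.2 * p.1.1, p.2 * p.1.2), continuous phi} ->
  {for p, continuous (fun z : R3 => phi (z.2 * z.1.1, z.2 * z.1.2))}.
Proof.
move=> cphi.
apply: (@continuous_comp R3 (R * R)%type R (fun z => (z.2 * z.1.1, z.2 * z.1.2)) phi) => //.
exact: (cvg_pair (cont_mul (@cont_s p) (@cont_x p)) (cont_mul (@cont_s p) (@cont_y p))).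
Qed.

Variables (V : set (R * R)) (phi : R * R -> R).
Hypothesis sphi : smooth_in V phi.

Lemma is_derive_x (x y : R) : V (x, y) -> is_derive x 1 (fun t => phi (t, y)) (pd 0 phi (x, y)).
Proof. by move=> Vx; apply: is_derive_fst_pd; exact: smooth_diff Vx. Qed.

Lemma is_derive_y (x y : R) : V (x, y) -> is_derive y 1 (fun t => phi (x, t)) (pd 1 phi (x, y)).
Proof. by move=> Vx; apply: is_derive_snd_pd; exact: smooth_diff Vx. Qed.

Let isds (s x : R) : is_derive x 1 (fun t => s * t) s.
Proof. by apply: (is_derive_conv (is_derive_mul (is_derive_const s x) (is_derive_var x))); rewrite mul0r add0r mulr1. Qed.

Lemma is_derive_x_ray (s x y : R) : V (s * x, s * y) ->
  is_derive x 1 (fun t => phi (s * t, s * y)) (s * pd 0 phi (s * x, s * y)).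
Proof.
move=> Vx; refine (is_derive_conv (@is_derive_comp _ (fun t => phi (t, s * y)) (fun t => s * t) x _ _ _ (isds s x)) _).
  exact: is_derive_x.
exact: mulrC.
Qed.

Lemma is_derive_y_ray (s x y : R) : V (s * x, s * y) ->
  is_derive y 1 (fun t => phi (s * x, s * t)) (s * pd 1 phi (s * x, s * y)).
Proof.
move=> Vx; refine (is_derive_conv (@is_derive_comp _ (fun t => phi (s * x, t)) (fun t => s * t) y _ _ _ (isds s y)) _).
  exact: is_derive_y.
exact: mulrC.
Qed.

Lemma is_derive_s_ray (s x y : R) : V (s * x, s * y) ->
  is_derive s 1 (fun t => phi (t * x, t * y))
   (x * pd 0 phi (s * x, s * y) + y * pd 1 phi (s * x, s * y)).
Proof.
move=> Vx; have := @is_derive_line_pd R phi (0, 0) (x, y) s; rewrite /= !add0r => /(_ (smooth_diff sphi Vx)).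
by under eq_fun do rewrite !add0r.
Qed.

End Rules3.

Section Rules1.
Context {R : realType}.
Variables (k tau : R).
Hypothesis tau0 : 0 < tau.

(** Differentiates the first two components of the field along their own variable.
    The factors s in the hypotheses come from functions of s p differentiated in p. *)
Lemma flux_rule (s t : R) (I m m' J J' V : R -> R) (dI dm dm' dJ dJ' dV : R) : s != 0 ->
  is_derive t 1 I (s * dI) -> is_derive t 1 m dm -> is_derive t 1 m' dm' ->
  is_derive t 1 J (s * dJ) -> is_derive t 1 J' (s * dJ') -> is_derive t 1 V dV ->
  is_derive t 1 (fun z => s^-1 * (G1 k tau (I z) * (m z * J z + m' z * J' z))
     + - (s^-1 * s^-1 * (G0 k tau (I z) * V z)))
   (G2 k tau (I t) * dI * (m t * J t + m' t * J' t)
    + s^-1 * (G1 k tau (I t) * (dm * J t + dm' * J' t))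
    + G1 k tau (I t) * (m t * dJ + m' t * dJ')
    + - (s^-1 * (G1 k tau (I t) * dI * V t))
    + - (s^-1 * s^-1 * (G0 k tau (I t) * dV))).
Proof.
move=> s0 hI hm hm' hJ hJ' hV.
have dG1 := is_derive_comp (is_derive_G1 k tau0 (I t)) hI.
have dG0 := is_derive_comp (is_derive_G0 k tau0 (I t)) hI.
refine (is_derive_conv (is_derive_add (is_derive_mul (is_derive_const s^-1 t) (is_derive_mul dG1 (is_derive_add (is_derive_mul hm hJ) (is_derive_mul hm' hJ'))))
  (is_derive_opp (is_derive_mul (is_derive_const (s^-1 * s^-1) t) (is_derive_mul dG0 hV)))) _).
cbv beta; clear dG1 dG0 hI hm hm' hJ hJ' hV.
move: (G0 k tau (I t)) (G1 k tau (I t)) (G2 k tau (I t)) (m t) (m' t) (J t) (J' t) (V t).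
by move=> *; field.
Qed.

(** Differentiates the third component of the field in s; the inverse Hessian does not
    depend on s. *)
Lemma radial_rule (s : R) (I H K L : R -> R) (m m' m'' dI dH dK dL : R) :
  is_derive s 1 I dI -> is_derive s 1 H dH -> is_derive s 1 K dK -> is_derive s 1 L dL ->
  is_derive s 1 (fun t => t * (G1 k tau (I t) * (m * H t + 2 * (m' * K t) + m'' * L t)))
   ((G1 k tau (I s) + s * (G2 k tau (I s) * dI)) * (m * H s + 2 * (m' * K s) + m'' * L s)
   + s * G1 k tau (I s) * (m * dH + 2 * (m' * dK) + m'' * dL)).
Proof.
move=> hI h1 h2 h3.
have dG1 := is_derive_comp (is_derive_G1 k tau0 (I s)) hI.
refine (is_derive_conv (is_derive_mul (is_derive_var s) (is_derive_mul dG1 (is_derive_add (is_derive_add (is_derive_mul (is_derive_const m s) h1)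
  (is_derive_mul (is_derive_const 2 s) (is_derive_mul (is_derive_const m' s) h2))) (is_derive_mul (is_derive_const m'' s) h3)))) _).
cbv beta; clear dG1 hI h1 h2 h3.
move: (G1 k tau (I s)) (G2 k tau (I s)) (H s) (K s) (L s) => *.
by ring.
Qed.
End Rules1.

(** The identity behind [divergence_eq], with all derivatives replaced by variables:
    a for the inverse Hessian at p = (x, y), h and t for the second and third derivatives
    of u at s p, g for the cutoff and its derivatives.  The terms with t cancel because
    mixed third derivatives agree; the rest uses that for symmetric matrices A, H of order
    2, the product H A H minus tr(A H) H is - det(H) times the adjugate of A. *)
Lemma divergence_algebra (R : realType) (s x y g0 g1 g2 j1 j2 a11 a12 a22 a110 a120 a121 a221
    j10 j20 j11 j21 v1 v2 v10 v21 h11 h12 h22 t110 t111 t120 t121 t220 t221 det : R) :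
  s != 0 -> v1 = a110 + a121 -> v2 = a120 + a221 ->
  j1 = - (s * x * h11 + s * y * h12) -> j2 = - (s * x * h12 + s * y * h22) ->
  det = h11 * h22 - h12 * h12 -> t111 = t120 -> t220 = t121 ->
  j10 = - (1 * h11 + s * x * t110 + (0 * h12 + s * y * t120)) ->
  j11 = - (0 * h11 + s * x * t111 + (1 * h12 + s * y * t121)) ->
  j20 = - (1 * h12 + s * x * t120 + (0 * h22 + s * y * t220)) ->
  j21 = - (0 * h12 + s * x * t121 + (1 * h22 + s * y * t221)) ->
  (g2 * j1 * (a11 * j1 + a12 * j2) + s^-1 * (g1 * (a110 * j1 + a120 * j2))
    + g1 * (a11 * j10 + a12 * j20) + - (s^-1 * (g1 * j1 * v1)) + - (s^-1 * s^-1 * (g0 * v10)))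
  + (g2 * j2 * (a12 * j1 + a22 * j2) + s^-1 * (g1 * (a121 * j1 + a221 * j2))
    + g1 * (a12 * j11 + a22 * j21) + - (s^-1 * (g1 * j2 * v2)) + - (s^-1 * s^-1 * (g0 * v21)))
  + ((g1 + s * (g2 * (x * j1 + y * j2))) * (a11 * h11 + 2 * (a12 * h12) + a22 * h22)
    + s * g1 * (a11 * (x * t110 + y * t111) + 2 * (a12 * (x * t120 + y * t121))
       + a22 * (x * t220 + y * t221)))
  = - (s^-1 * s^-1 * (g0 * (v10 + v21)))
    - g2 * det * (a11 * (s * y) ^+ 2 - 2 * a12 * (s * x) * (s * y) + a22 * (s * x) ^+ 2).
Proof. by move=> s0 -> -> -> -> -> -> -> -> -> -> ->; field. Qed.

Section Field.
Context {R : realType}.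
Variables (u : R * R -> R) (dl k tau : R).
Let Q := quad dl.
Hypothesis su : smooth_in Q u.
Hypothesis pu : forall x, Q x -> 0 < H11 u x /\ 0 < hdet u x.
Hypothesis tau0 : 0 < tau.

(** With p = (x, y) and F(p) = G0(I(sp)), the vector of [W1] and [W2] is
    s^-2 (M grad F - F V), whose divergence is s^-2 (M : D^2F - F div V). *)
Definition W1 (x y s : R) : R :=
  s^-1 * (G1 k tau (icpt u (s * x, s * y)) * (m11 u (x, y) * J1 u (s * x, s * y) + m12 u (x, y) * J2 u (s * x, s * y)))
  + - (s^-1 * s^-1 * (G0 k tau (icpt u (s * x, s * y)) * V1 u (x, y))).

Definition W2 (x y s : R) : R :=
  s^-1 * (G1 k tau (icpt u (s * x, s * y)) * (m12 u (x, y) * J1 u (s * x, s * y) + m22 u (x, y) * J2 u (s * x, s * y)))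
  + - (s^-1 * s^-1 * (G0 k tau (icpt u (s * x, s * y)) * V2 u (x, y))).

(** The radial derivative of s G1(I(sp)) D^2u(sp), contracted with M(p), contains the
    third derivatives of u that occur in M : D^2 (G0(I(sp))), with the opposite sign. *)
Definition W3 (x y s : R) : R :=
  s * (G1 k tau (icpt u (s * x, s * y)) *
   (m11 u (x, y) * H11 u (s * x, s * y) + 2 * (m12 u (x, y) * H12 u (s * x, s * y)) + m22 u (x, y) * H22 u (s * x, s * y))).

Definition D1 (x y s : R) : R :=
  G2 k tau (icpt u (s * x, s * y)) * J1 u (s * x, s * y) *
    (m11 u (x, y) * J1 u (s * x, s * y) + m12 u (x, y) * J2 u (s * x, s * y))
  + s^-1 * (G1 k tau (icpt u (s * x, s * y)) *
    (pd 0 (m11 u) (x, y) * J1 u (s * x, s * y) + pd 0 (m12 u) (x, y) * J2 u (s * x, s * y)))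
  + G1 k tau (icpt u (s * x, s * y)) *
    (m11 u (x, y) * pd 0 (J1 u) (s * x, s * y) + m12 u (x, y) * pd 0 (J2 u) (s * x, s * y))
  + - (s^-1 * (G1 k tau (icpt u (s * x, s * y)) * J1 u (s * x, s * y) * V1 u (x, y)))
  + - (s^-1 * s^-1 * (G0 k tau (icpt u (s * x, s * y)) * pd 0 (V1 u) (x, y))).

Definition D2 (x y s : R) : R :=
  G2 k tau (icpt u (s * x, s * y)) * J2 u (s * x, s * y) *
    (m12 u (x, y) * J1 u (s * x, s * y) + m22 u (x, y) * J2 u (s * x, s * y))
  + s^-1 * (G1 k tau (icpt u (s * x, s * y)) *
    (pd 1 (m12 u) (x, y) * J1 u (s * x, s * y) + pd 1 (m22 u) (x, y) * J2 u (s * x, s * y)))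
  + G1 k tau (icpt u (s * x, s * y)) *
    (m12 u (x, y) * pd 1 (J1 u) (s * x, s * y) + m22 u (x, y) * pd 1 (J2 u) (s * x, s * y))
  + - (s^-1 * (G1 k tau (icpt u (s * x, s * y)) * J2 u (s * x, s * y) * V2 u (x, y)))
  + - (s^-1 * s^-1 * (G0 k tau (icpt u (s * x, s * y)) * pd 1 (V2 u) (x, y))).

Definition D3 (x y s : R) : R :=
  (G1 k tau (icpt u (s * x, s * y)) +
   s * (G2 k tau (icpt u (s * x, s * y)) * (x * J1 u (s * x, s * y) + y * J2 u (s * x, s * y)))) *
   (m11 u (x, y) * H11 u (s * x, s * y) + 2 * (m12 u (x, y) * H12 u (s * x, s * y)) + m22 u (x, y) * H22 u (s * x, s * y))
  + s * G1 k tau (icpt u (s * x, s * y)) *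
   (m11 u (x, y) * (x * pd 0 (H11 u) (s * x, s * y) + y * pd 1 (H11 u) (s * x, s * y))
   + 2 * (m12 u (x, y) * (x * pd 0 (H12 u) (s * x, s * y) + y * pd 1 (H12 u) (s * x, s * y)))
   + m22 u (x, y) * (x * pd 0 (H22 u) (s * x, s * y) + y * pd 1 (H22 u) (s * x, s * y))).

Section At.
Variables (x y s : R).
Hypotheses (Qp : Q (x, y)) (Qz : Q (s * x, s * y)) (s0 : s != 0).

Let dIx : is_derive x 1 (fun t => icpt u (s * t, s * y)) (s * J1 u (s * x, s * y)).
Proof. by rewrite -(pd0_icpt su Qz); exact: (is_derive_x_ray (smooth_icpt su) Qz). Qed.

Let dIy : is_derive y 1 (fun t => icpt u (s * x, s * t)) (s * J2 u (s * x, s * y)).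
Proof. by rewrite -(pd1_icpt su Qz); exact: (is_derive_y_ray (smooth_icpt su) Qz). Qed.

Let dIs : is_derive s 1 (fun t => icpt u (t * x, t * y)) (x * J1 u (s * x, s * y) + y * J2 u (s * x, s * y)).
Proof. by rewrite -(pd0_icpt su Qz) -(pd1_icpt su Qz); exact: (is_derive_s_ray (smooth_icpt su) Qz). Qed.

Lemma is_derive_W1 : is_derive x 1 (fun t => W1 t y s) (D1 x y s).
Proof.
exact: (flux_rule k tau0 s0 dIx (is_derive_x (smooth_m11 su pu) Qp) (is_derive_x (smooth_m12 su pu) Qp)
  (is_derive_x_ray (smooth_J1 su) Qz) (is_derive_x_ray (smooth_J2 su) Qz) (is_derive_x (smooth_V1 su pu) Qp)).
Qed.

Lemma is_derive_W2 : is_derive y 1 (fun t => W2 x t s) (D2 x y s).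
Proof.
exact: (flux_rule k tau0 s0 dIy (is_derive_y (smooth_m12 su pu) Qp) (is_derive_y (smooth_m22 su pu) Qp)
  (is_derive_y_ray (smooth_J1 su) Qz) (is_derive_y_ray (smooth_J2 su) Qz) (is_derive_y (smooth_V2 su pu) Qp)).
Qed.

Lemma is_derive_W3 : is_derive s 1 (fun t => W3 x y t) (D3 x y s).
Proof.
exact: (radial_rule k tau0 (m11 u (x, y)) (m12 u (x, y)) (m22 u (x, y)) dIs
  (is_derive_s_ray (smooth_H11 su) Qz) (is_derive_s_ray (smooth_H12 su) Qz) (is_derive_s_ray (smooth_H22 su) Qz)).
Qed.

(** The third derivatives of u cancel, and the terms with G1 cancel too; only the
    equation and a term with G2 that has a sign remain. *)
Lemma divergence_eq : D1 x y s + D2 x y s + D3 x y s =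
  - (s^-1 * s^-1 * (G0 k tau (icpt u (s * x, s * y)) *
       (pd 0 (V1 u) (x, y) + pd 1 (V2 u) (x, y))))
  - G2 k tau (icpt u (s * x, s * y)) * hdet u (s * x, s * y) *
    (m11 u (x, y) * (s * y) ^+ 2 - 2 * m12 u (x, y) * (s * x) * (s * y) + m22 u (x, y) * (s * x) ^+ 2).
Proof.
have E1 := pd_J1 su 0 Qz; have E2 := pd_J1 su 1 Qz.
have E3 := pd_J2 su 0 Qz; have E4 := pd_J2 su 1 Qz.
rewrite /D1 /D2 /D3; apply: divergence_algebra.
- exact: s0.
- by [].
- by [].
- by [].
- by [].
- by [].
- exact: (pd1_H11 su Qz).
- exact: (pd0_H22 su Qz).
- exact: E1.
- exact: E2.
- exact: E3.
- exact: E4.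
Qed.
End At.
End Field.

(** * Sign of the divergence *)

Section Algebra2.
Context {R : realType}.
Implicit Types a b c d X Y : R.

(** Complete the square, after multiplication by a. *)
Lemma quad_form_ge0 a b d X Y : 0 < a -> 0 < d -> a * d - b * b >= 0 ->
  0 <= d * Y ^+ 2 + 2 * b * X * Y + a * X ^+ 2.
Proof.
move=> a0 d0 D0; rewrite -(pmulr_rge0 _ a0).
rewrite [X in 0 <= X](_ : _ = (a * X + b * Y) ^+ 2 + (a * d - b * b) * Y ^+ 2); last by ring.
by rewrite addr_ge0 ?sqr_ge0// mulr_ge0// sqr_ge0.
Qed.

(** The trace of a product of positive matrices, one of them given by its adjugate;
    multiplied by a a' it is a square plus multiples of the two determinants. *)
Lemma trace_ge0 a b d a' b' d' : 0 < a -> a * d - b * b > 0 -> 0 < a' -> a' * d' - b' * b' > 0 ->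
  0 <= d * a' - 2 * (b * b') + a * d'.
Proof.
move=> a0 D0 a'0 D'0.
have aa : 0 < a * a' by rewrite mulr_gt0.
rewrite -(pmulr_rge0 _ aa).
rewrite [X in 0 <= X](_ : _ = (a * b' - b * a') ^+ 2 + (a * d - b * b) * (a' * a') + (a' * d' - b' * b') * (a * a)); last by ring.
by rewrite !addr_ge0 ?sqr_ge0// mulr_ge0 ?mulr_ge0// ltW.
Qed.
End Algebra2.

Section Core.
Context {R : realType}.
Variables (u : R * R -> R) (dl k tau : R).
Let Q := quad dl.
Hypothesis su : smooth_in Q u.
Hypothesis pu : forall x, Q x -> 0 < H11 u x /\ 0 < hdet u x.
Hypothesis tau0 : 0 < tau.
Notation I := (icpt u).

Let detE x : H11 u x * H22 u x - H12 u x * H12 u x = hdet u x. Proof. by rewrite hdetE. Qed.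

Lemma H22_gt0 x : Q x -> 0 < H22 u x.
Proof.
move=> /pu[h1 hd]; have : 0 < H11 u x * H22 u x.
  by have := detE x; have := sqr_ge0 (H12 u x); rewrite expr2; lra.
by rewrite pmulr_rgt0.
Qed.

Lemma m_quad_ge0 p X Y : Q p ->
  0 <= m11 u p * Y ^+ 2 - 2 * m12 u p * X * Y + m22 u p * X ^+ 2.
Proof.
move=> Qp; have [h1 hd] := pu Qp; have h2 := H22_gt0 Qp.
rewrite m11E m12E m22E.
have iv : 0 <= (hdet u p)^-1 by rewrite invr_ge0 ltW.
have := mulr_ge0 iv (@quad_form_ge0 R _ (H12 u p) _ X Y h1 h2 (ltW hd)).
clear h1 hd h2 iv Qp.
move: (H11 u p) (H12 u p) (H22 u p) (hdet u p)^-1 => A B C D.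
by congr (0 <= _); ring.
Qed.

Lemma m_trace_ge0 p z : Q p -> Q z ->
  0 <= m11 u p * H11 u z + 2 * (m12 u p * H12 u z) + m22 u p * H22 u z.
Proof.
move=> Qp Qz; have [h1 hd] := pu Qp; have [h1' hd'] := pu Qz.
rewrite m11E m12E m22E.
have iv : 0 <= (hdet u p)^-1 by rewrite invr_ge0 ltW.
have := mulr_ge0 iv (trace_ge0 h1 hd h1' hd').
clear h1 hd h1' hd' iv Qp Qz.
move: (H11 u p) (H12 u p) (H22 u p) (hdet u p)^-1 => A B C D.
move: (H11 u z) (H12 u z) (H22 u z) => A' B' C'.
by congr (0 <= _); ring.
Qed.

Lemma m_trace_eq2 p : Q p ->
  m11 u p * H11 u p + 2 * (m12 u p * H12 u p) + m22 u p * H22 u p = 2.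
Proof.
move=> Qp; have [h1 hd] := pu Qp.
rewrite m11E m12E m22E; have := gt_eqF hd; have := detE p.
move: (H11 u p) (H12 u p) (H22 u p) (hdet u p) => A B C D E /negbT D0.
rewrite (_ : _ + _ = 2 * (A * C - B * B) / D); last by field.
by rewrite E -mulrA mulfV// mulr1.
Qed.

(** The convexity of the cutoff makes the last term of [divergence_eq] nonpositive,
    and the cutoff is at most h. *)
Lemma divergence_le (a h x y s : R) : Q (x, y) -> Q (s * x, s * y) -> 1 <= s ->
  `|pd 0 (V1 u) (x, y) + pd 1 (V2 u) (x, y)| <= a ->
  0 <= h -> I (s * x, s * y) - k <= h ->
  D1 u k tau x y s + D2 u k tau x y s + D3 u k tau x y s <= a * h.
Proof.
move=> Qp Qz s1 Ha h0 Ih.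
have s0 : 0 < s by apply: lt_le_trans s1.
rewrite (divergence_eq k tau su Qz (lt0r_neq0 s0)).
have G2p := G2_ge0 k tau0 (I (s * x, s * y)).
have [_ hd] := pu Qz.
have mq := m_quad_ge0 (s * x) (s * y) Qp.
have g0 := G0_ge0 k tau0 (I (s * x, s * y)).
have gh := G0_le tau0 h0 Ih.
have : 0 <= G2 k tau (I (s * x, s * y)) * hdet u (s * x, s * y) *
    (m11 u (x, y) * (s * y) ^+ 2 - 2 * m12 u (x, y) * (s * x) * (s * y) + m22 u (x, y) * (s * x) ^+ 2).
  by rewrite !mulr_ge0// ltW.
have si : 0 <= s^-1 <= 1 by rewrite invr_ge0 ltW//= invf_le1.
move: (pd 0 (V1 u) (x, y) + pd 1 (V2 u) (x, y)) Ha => A Ha.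
move: (G0 k tau (I (s * x, s * y))) g0 gh => g g0 gh.
move: (G2 k tau _ * _ * _) => T T0.
have a0 : 0 <= a by exact: le_trans Ha.
have /andP[si0 si1] := si.
have ss : s^-1 * s^-1 <= 1 by rewrite mulr_ile1.
have : - (s^-1 * s^-1 * (g * A)) <= a * h.
  apply: (le_trans (ler_norm _)); rewrite normrN !normrM (ger0_norm si0) (ger0_norm g0).
  apply: (@le_trans _ _ (1 * (h * a))); last by rewrite mul1r mulrC.
  by apply: ler_pM => //; rewrite ?mulr_ge0//; apply: ler_pM.
by move=> H; lra.
Qed.

Section Cont.
Variables (x y s : R).
Hypotheses (Qp : Q (x, y)) (Qz : Q (s * x, s * y)) (s0 : s != 0).
Let P : R * R * R := (x, y, s).

Let cpt phi : smooth_in Q phi -> {for P, continuous (fun z : R * R * R => phi (z.1.1, z.1.2))}.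
Proof. by move=> sp; apply: cont_point; exact: smooth_cont sp Qp. Qed.

Let cray phi : smooth_in Q phi -> {for P, continuous (fun z : R * R * R => phi (z.2 * z.1.1, z.2 * z.1.2))}.
Proof. by move=> sp; apply: cont_ray; exact: smooth_cont sp Qz. Qed.

Let cI := cray (smooth_icpt su).
Let g0 := cont_comp (@continuous_G0 R k tau tau0) cI.
Let g1 := cont_comp (@continuous_G1 R k tau tau0) cI.
Let g2 := cont_comp (@continuous_G2 R k tau tau0) cI.
Let j1 := cray (smooth_J1 su).
Let j2 := cray (smooth_J2 su).
Let si : {for P, continuous (fun z : R * R * R => z.2^-1)} := cont_sV (p := P) s0.
Let cs : {for P, continuous (fun z : R * R * R => z.2)} := @cont_s R P.
Let cx : {for P, continuous (fun z : R * R * R => z.1.1)} := @cont_x R P.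
Let cy : {for P, continuous (fun z : R * R * R => z.1.2)} := @cont_y R P.
Let a11 := cpt (smooth_m11 su pu).
Let a12 := cpt (smooth_m12 su pu).
Let a22 := cpt (smooth_m22 su pu).

Lemma continuous_D1 : {for (x, y, s), continuous (fun p : R * R * R => D1 u k tau p.1.1 p.1.2 p.2)}.
Proof.
have a1' := cpt (smooth_pd 0 (smooth_m11 su pu)).
have a2' := cpt (smooth_pd 0 (smooth_m12 su pu)).
have dj1 := cray (smooth_pd 0 (smooth_J1 su)).
have dj2 := cray (smooth_pd 0 (smooth_J2 su)).
have v := cpt (smooth_V1 su pu).
have dv := cpt (smooth_pd 0 (smooth_V1 su pu)).
exact: (cont_add (cont_add (cont_add (cont_add (cont_mul (cont_mul g2 j1) (cont_add (cont_mul a11 j1) (cont_mul a12 j2)))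
  (cont_mul si (cont_mul g1 (cont_add (cont_mul a1' j1) (cont_mul a2' j2))))) (cont_mul g1 (cont_add (cont_mul a11 dj1) (cont_mul a12 dj2))))
  (cont_opp (cont_mul si (cont_mul (cont_mul g1 j1) v)))) (cont_opp (cont_mul (cont_mul si si) (cont_mul g0 dv)))).
Qed.

Lemma continuous_D2 : {for (x, y, s), continuous (fun p : R * R * R => D2 u k tau p.1.1 p.1.2 p.2)}.
Proof.
have a1' := cpt (smooth_pd 1 (smooth_m12 su pu)).
have a2' := cpt (smooth_pd 1 (smooth_m22 su pu)).
have dj1 := cray (smooth_pd 1 (smooth_J1 su)).
have dj2 := cray (smooth_pd 1 (smooth_J2 su)).
have v := cpt (smooth_V2 su pu).
have dv := cpt (smooth_pd 1 (smooth_V2 su pu)).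
exact: (cont_add (cont_add (cont_add (cont_add (cont_mul (cont_mul g2 j2) (cont_add (cont_mul a12 j1) (cont_mul a22 j2)))
  (cont_mul si (cont_mul g1 (cont_add (cont_mul a1' j1) (cont_mul a2' j2))))) (cont_mul g1 (cont_add (cont_mul a12 dj1) (cont_mul a22 dj2))))
  (cont_opp (cont_mul si (cont_mul (cont_mul g1 j2) v)))) (cont_opp (cont_mul (cont_mul si si) (cont_mul g0 dv)))).
Qed.

Lemma continuous_D3 : {for (x, y, s), continuous (fun p : R * R * R => D3 u k tau p.1.1 p.1.2 p.2)}.
Proof.
have h1 := cray (smooth_H11 su); have h2 := cray (smooth_H12 su); have h3 := cray (smooth_H22 su).
have h10 := cray (smooth_pd 0 (smooth_H11 su)); have h11 := cray (smooth_pd 1 (smooth_H11 su)).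
have h20 := cray (smooth_pd 0 (smooth_H12 su)); have h21 := cray (smooth_pd 1 (smooth_H12 su)).
have h30 := cray (smooth_pd 0 (smooth_H22 su)); have h31 := cray (smooth_pd 1 (smooth_H22 su)).
have c2 : {for P, continuous (fun _ : R * R * R => (2 : R))} := @cont_const R 2 P.
exact: (cont_add (cont_mul (cont_add g1 (cont_mul cs (cont_mul g2 (cont_add (cont_mul cx j1) (cont_mul cy j2)))))
   (cont_add (cont_add (cont_mul a11 h1) (cont_mul c2 (cont_mul a12 h2))) (cont_mul a22 h3)))
  (cont_mul (cont_mul cs g1) (cont_add (cont_add (cont_mul a11 (cont_add (cont_mul cx h10) (cont_mul cy h11)))
    (cont_mul c2 (cont_mul a12 (cont_add (cont_mul cx h20) (cont_mul cy h21))))) (cont_mul a22 (cont_add (cont_mul cx h30) (cont_mul cy h31)))))).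
Qed.

End Cont.
End Core.

(** * The flux inequality *)

(** [box_flux] on the box of e <= x, y <= R0 and 1 <= s <= 2, with e tending to 0.  The
    cutoff vanishes at x = R0 and at y = R0.  At the edge y = 0 the flux converges to
    s^-2 G0(I), which is at least (1/4) (tau/18) on the part x <= r and nonnegative on the
    rest; at the edge x = 0 the flux has the favourable sign in the limit.  At s = 1 it is at
    most 2 per unit area, at s = 2 it is nonnegative.  The divergence contributes a h. *)
Lemma flux_bound (R : realType) (u : R * R -> R) (dl a h k tau R0 r e0 C : R)
    (Q := quad dl) (I := icpt u) :
  smooth_in Q u -> (forall x, Q x -> 0 < H11 u x /\ 0 < hdet u x) ->
  0 < tau -> 0 <= a -> 0 <= h -> 0 <= k ->
  (forall x, Q x -> `|pd 0 (V1 u) x + pd 1 (V2 u) x| <= a) ->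
  (forall x, Q x -> I x <= h) ->
  0 < R0 -> 4 * R0 < dl ->
  (forall x, Q x -> R0 <= x.1 + x.2 -> I x <= k) ->
  0 < e0 -> 0 <= C -> 0 < r -> r <= R0 ->
  (forall x, Q x -> x.2 < e0 -> x.1 <= 2 * R0 ->
    [/\ `|m12 u x| <= C * x.2, `|m22 u x| <= C * x.2, `|V2 u x - 1| <= C * x.2,
        `|J1 u x| <= C & `|J2 u x| <= C]) ->
  (forall x, Q x -> x.1 < e0 -> x.2 <= 2 * R0 ->
    [/\ `|m11 u x| <= C * x.1, `|m12 u x| <= C * x.1, `|V1 u x - 1| <= C * x.1,
        `|J1 u x| <= C & `|J2 u x| <= C]) ->
  (forall x, Q x -> x.2 < e0 -> x.1 <= 2 * r -> k + tau / 2 <= I x) ->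
  tau / 72 * r <= (a * h + 2) * R0 ^+ 2.
Proof.
move=> su pu tau0 a0 h0 k0 HA Hh R00 R4 HR e00 C0 r0 rR HB1 HB2 HB3.
pose C' := C * h + 2 * C ^+ 2.
have C'0 : 0 <= C' by rewrite addr_ge0 ?mulr_ge0 ?exprn_ge0.
(* C' e bounds the error made at distance e from the two edges. *)
suff main (e : R) : 0 < e -> e < e0 / 2 -> e <= r -> C * e <= 1 ->
    (tau / 72 - C' * e) * (r - e) - C' * e * (R0 - r) <=
    a * h * (R0 - e) ^+ 2 + C' * e * (R0 - e) + 2 * (R0 - e) ^+ 2.
  have K0 : 0 <= tau / 72 + 3 * C' * R0 by rewrite addr_ge0 ?divr_ge0 ?mulr_ge0 ?(ltW tau0) ?(ltW R00).
  set K := tau / 72 + 3 * C' * R0 in K0.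
  apply/ler_addgt0Pr => d d0.
  pose e := Num.min (Num.min (e0 / 4) r) (Num.min (1 / (C + 1)) (d / (K + 1))).
  have C1 : 0 < C + 1 by rewrite ltr_wpDl.
  have K1 : 0 < K + 1 by rewrite ltr_wpDl.
  have e_gt0 : 0 < e by rewrite !lt_min r0 !divr_gt0.
  have eh : [/\ e <= e0 / 4, e <= r, e <= 1 / (C + 1) & e <= d / (K + 1)].
    by rewrite /e !ge_min !lexx ?orbT.
  case: eh => eh1 eh2 eh3 eh4.
  have Ce : C * e <= 1.
    move: eh3; rewrite ler_pdivlMr// mulrC mulrDl mul1r => h3.
    by apply: le_trans h3; rewrite lerDl ltW.
  have Ke : K * e <= d.
    move: eh4; rewrite ler_pdivlMr// mulrC mulrDl mul1r => h3.
    by apply: le_trans h3; rewrite lerDl ltW.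
  have := main e e_gt0 (le_lt_trans eh1 _) eh2 Ce.
  have -> : e0 / 4 < e0 / 2 by move: e00; clear; lra.
  move=> /(_ isT) H.
  have sq : (R0 - e) ^+ 2 <= R0 ^+ 2.
    have e1 : 0 <= R0 - e by rewrite subr_ge0 (le_trans eh2).
    have e2 : R0 - e <= R0 by rewrite gerBl ltW.
    by rewrite !expr2; apply: ler_pM.
  have ah0 : 0 <= a * h by rewrite mulr_ge0.
  have t1 := ler_wpM2l ah0 sq.
  have Ce0 : 0 <= C' * e by rewrite mulr_ge0// ltW.
  have t2 : C' * e * (r - e) <= C' * e * R0 by apply: ler_wpM2l => //; move: e_gt0 eh2 r0 rR; clear; lra.
  have t3 : C' * e * (R0 - r) <= C' * e * R0 by apply: ler_wpM2l => //; move: e_gt0 eh2 r0 rR; clear; lra.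
  have t4 : C' * e * (R0 - e) <= C' * e * R0 by apply: ler_wpM2l => //; move: e_gt0 eh2 r0 rR; clear; lra.
  have E1 : (tau / 72 - C' * e) * (r - e) = tau / 72 * r - tau / 72 * e - C' * e * (r - e) by ring.
  have E2 : K * e = tau / 72 * e + 3 * (C' * e * R0) by rewrite /K; ring.
  rewrite mulrDl; move: H; rewrite E1; move: Ke; rewrite E2; move: t1 t2 t3 t4 sq; clear; lra.
move=> e_gt0 ee0 er Ce.
have eR : e <= R0 by exact: le_trans rR.
have s1P (s : R) : 1 <= s <= 2 -> [/\ 0 < s, s != 0, 0 <= s^-1 & s^-1 <= 1].
  move=> /andP[s1 s2]; have s0 : 0 < s by apply: lt_le_trans ltr01 _.
  by rewrite s0 gt_eqF// invr_ge0 ltW// invf_le1.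
have inQ (x y s : R) : e <= x <= R0 -> e <= y <= R0 -> 1 <= s <= 2 -> Q (x, y) /\ Q (s * x, s * y).
  move=> /andP[x1 x2] /andP[y1 y2] /andP[z1 z2]; have s0 : 0 < s by apply: lt_le_trans ltr01 _.
  have x0 : 0 < x by apply: lt_le_trans x1.
  have y0 : 0 < y by apply: lt_le_trans y1.
  have xy : x + y <= 2 * R0 by move: x2 y2; clear; lra.
  have sxy : s * x + s * y <= 2 * (2 * R0).
    by rewrite -mulrDr; apply: ler_pM => //; [exact: ltW|rewrite addr_ge0// ltW].
  by split; split => //=; rewrite ?mulr_gt0//; move: R4 R00 xy sxy; clear; lra.
have sle (s x : R) : 1 <= s <= 2 -> 0 <= x -> x <= s * x /\ s * x <= 2 * x.
  move=> /andP[z1 z2] x0; split; last exact: ler_wpM2r.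
  by rewrite ler_peMl.
have Gh z : Q z -> 0 <= G0 k tau (I z) <= h.
  by move=> Qz; rewrite G0_ge0//= G0_le// lerBlDr (le_trans (Hh _ Qz))// lerDl.
(* The part of the flux with the gradient of the cutoff is O(e) near an edge. *)
have small (g m m' j j' s e' : R) : 0 <= g <= 1 -> 0 <= s^-1 -> s^-1 <= 1 -> 0 < e' ->
    `|m| <= C * e' -> `|m'| <= C * e' -> `|j| <= C -> `|j'| <= C ->
    `|s^-1 * (g * (m * j + m' * j'))| <= 2 * C ^+ 2 * e'.
  move=> /andP[g0 g1] si0 si1 e'0 hm hm' hj hj'.
  have b1 : `|m * j + m' * j'| <= 2 * C ^+ 2 * e'.
    apply: (le_trans (ler_normD _ _)); rewrite !normrM.
    rewrite (_ : 2 * _ * _ = C * e' * C + C * e' * C); last by ring.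
    by apply: lerD; apply: ler_pM.
  rewrite !normrM (ger0_norm si0) (ger0_norm g0).
  have b0 : 0 <= `|m * j + m' * j'| by [].
  apply: le_trans b1; rewrite mulrA ler_piMl// mulr_ile1//.
(* The remaining part differs from s^-2 G0 by O(e), because the normal component of V is 1 + O(e). *)
have lowerV (g v s e' : R) : 0 <= g <= h -> 0 <= s^-1 -> s^-1 <= 1 -> 0 < e' ->
    `|v - 1| <= C * e' -> s^-1 * s^-1 * g - C * h * e' <= s^-1 * s^-1 * (g * v).
  move=> /andP[g0 gh] si0 si1 e'0; rewrite ler_norml => /andP[v1 v2].
  have ss : 0 <= s^-1 * s^-1 <= 1 by rewrite mulr_ge0// mulr_ile1.
  case/andP: ss => ss0 ss1.
  have : s^-1 * s^-1 * (g * (1 - v)) <= 1 * (h * (C * e')).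
    apply: (@le_trans _ _ (s^-1 * s^-1 * (g * (C * e')))).
      by apply: ler_wpM2l => //; apply: ler_wpM2l => //; move: v1; clear; lra.
    have Ce'0 : 0 <= C * e' by rewrite mulr_ge0// ltW.
    have hh : g * (C * e') <= h * (C * e') by exact: ler_wpM2r.
    by apply: ler_pM => //; rewrite mulr_ge0.
  rewrite mul1r (_ : s^-1 * s^-1 * (g * (1 - v)) = s^-1 * s^-1 * g - s^-1 * s^-1 * (g * v)); last by ring.
  by rewrite (_ : h * (C * e') = C * h * e'); [clear; lra|ring].
have G1b (t : R) : 0 <= G1 k tau t <= 1 by rewrite G1_ge0// G1_le1.
have bot (x s : R) : e <= x <= R0 -> 1 <= s <= 2 ->
    s^-1 * s^-1 * G0 k tau (I (s * x, s * e)) - C' * e <= - W2 u k tau x e s.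
  move=> xb sb; have [s0 sn0 si0 si1] := s1P _ sb.
  have ebb : e <= e <= R0 by rewrite lexx.
  have [Qp Qz] := inQ x e s xb ebb sb.
  have /andP[x1 x2] := xb.
  have [Bm12 Bm22 BV _ _] : [/\ `|m12 u (x, e)| <= C * e, `|m22 u (x, e)| <= C * e, `|V2 u (x, e) - 1| <= C * e,
        `|J1 u (x, e)| <= C & `|J2 u (x, e)| <= C] by apply: HB1 => //=; move: ee0 e00 x2 R00; clear; lra.
  have [_ sx2] := sle s x sb (ltW (lt_le_trans e_gt0 x1)).
  have [_ se2] := sle s e sb (ltW e_gt0).
  have h1 : s * e < e0 by move: se2 ee0; clear; lra.
  have h2 : s * x <= 2 * R0 by move: sx2 x2; clear; lra.
  have [_ _ _ BJ1 BJ2] := HB1 (s * x, s * e) Qz h1 h2.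
  have := small _ _ _ _ _ _ _ (G1b (I (s * x, s * e))) si0 si1 e_gt0 Bm12 Bm22 BJ1 BJ2.
  rewrite ler_norml => /andP[_ P1].
  have P2 := lowerV _ _ _ _ (Gh _ Qz) si0 si1 e_gt0 BV.
  rewrite /W2 opprD opprK addrC; move: P1 P2.
  set T1 := s^-1 * (G1 _ _ _ * _); set T2 := s^-1 * s^-1 * (_ * V2 u (x, e)).
  rewrite (_ : C' * e = C * h * e + 2 * C ^+ 2 * e); last by rewrite /C'; ring.
  move: T1 T2 => T1 T2; clear; lra.
have lef (y s : R) : e <= y <= R0 -> 1 <= s <= 2 -> W1 u k tau e y s <= C' * e.
  move=> yb sb; have [s0 sn0 si0 si1] := s1P _ sb.
  have ebb : e <= e <= R0 by rewrite lexx.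
  have [Qp Qz] := inQ e y s ebb yb sb.
  have /andP[y1 y2] := yb.
  have [Bm12 Bm22 BV _ _] : [/\ `|m11 u (e, y)| <= C * e, `|m12 u (e, y)| <= C * e, `|V1 u (e, y) - 1| <= C * e,
        `|J1 u (e, y)| <= C & `|J2 u (e, y)| <= C] by apply: HB2 => //=; move: ee0 e00 y2 R00; clear; lra.
  have [_ sy2] := sle s y sb (ltW (lt_le_trans e_gt0 y1)).
  have [_ se2] := sle s e sb (ltW e_gt0).
  have h1 : s * e < e0 by move: se2 ee0; clear; lra.
  have h2 : s * y <= 2 * R0 by move: sy2 y2; clear; lra.
  have [_ _ _ BJ1 BJ2] := HB2 (s * e, s * y) Qz h1 h2.
  have := small _ _ _ _ _ _ _ (G1b (I (s * e, s * y))) si0 si1 e_gt0 Bm12 Bm22 BJ1 BJ2.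
  rewrite ler_norml => /andP[_ P1].
  have P2 := lowerV _ _ _ _ (Gh _ Qz) si0 si1 e_gt0 BV.
  have P3 : 0 <= s^-1 * s^-1 * G0 k tau (I (s * e, s * y)) by rewrite !mulr_ge0// G0_ge0.
  rewrite /W1; move: P1 P2 P3.
  set T1 := s^-1 * (G1 _ _ _ * _); set T2 := s^-1 * s^-1 * (_ * V1 u (e, y)).
  rewrite (_ : C' * e = C * h * e + 2 * C ^+ 2 * e); last by rewrite /C'; ring.
  move: T1 T2 => T1 T2; clear; lra.
(* Beyond R0 the intercept stays below k, where the cutoff vanishes. *)
have far (x y s : R) : e <= x <= R0 -> e <= y <= R0 -> 1 <= s <= 2 -> (R0 <= x) || (R0 <= y) ->
    W1 u k tau x y s = 0 /\ W2 u k tau x y s = 0.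
  move=> xb yb sb xy; have [Qp Qz] := inQ x y s xb yb sb.
  have x0 : 0 <= x by case/andP: xb => h1 _; apply: le_trans h1; exact: ltW.
  have y0 : 0 <= y by case/andP: yb => h1 _; apply: le_trans h1; exact: ltW.
  have [sx _] := sle s x sb x0; have [sy _] := sle s y sb y0.
  have Ik : I (s * x, s * y) <= k.
    by apply: HR => //=; case/orP: xy; move: sx sy x0 y0; clear; lra.
  have [g0 g1 _] := G_eq0 tau Ik.
  by rewrite /W1 /W2 g0 g1 !mul0r !mulr0 subr0.
have eRb : e <= R0 <= R0 by rewrite eR lexx.
have := @box_flux R (W1 u k tau) (W2 u k tau) (W3 u k tau) (D1 u k tau) (D2 u k tau) (D3 u k tau)
  e r R0 e R0 1 2 (a * h) (C' * e) (C' * e) 2 (tau / 72 - C' * e) er rR eR (ler1n R 2).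
rewrite (_ : 2 - 1 = 1 :> R) ?mulr1; last by ring.
rewrite -!mulrA -!expr2 !mulrA; apply.
- move=> x y s [xb yb sb]; have [Qp Qz] := inQ x y s xb yb sb; have [_ sn0 _ _] := s1P _ sb.
  exact: (is_derive_W1 k su pu tau0 Qp Qz sn0).
- move=> x y s [xb yb sb]; have [Qp Qz] := inQ x y s xb yb sb; have [_ sn0 _ _] := s1P _ sb.
  exact: (is_derive_W2 k su pu tau0 Qp Qz sn0).
- move=> x y s [xb yb sb]; have [Qp Qz] := inQ x y s xb yb sb; have [_ sn0 _ _] := s1P _ sb.
  exact: (is_derive_W3 k su tau0 Qz).
- move=> x y s [xb yb sb]; have [Qp Qz] := inQ x y s xb yb sb; have [_ sn0 _ _] := s1P _ sb.
  exact: (@continuous_D1 R u dl k tau su pu tau0 x y s Qp Qz sn0).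
- move=> x y s [xb yb sb]; have [Qp Qz] := inQ x y s xb yb sb; have [_ sn0 _ _] := s1P _ sb.
  exact: (@continuous_D2 R u dl k tau su pu tau0 x y s Qp Qz sn0).
- move=> x y s [xb yb sb]; have [Qp Qz] := inQ x y s xb yb sb; have [_ sn0 _ _] := s1P _ sb.
  exact: (@continuous_D3 R u dl k tau su pu tau0 x y s Qp Qz).
- move=> x y s [xb yb sb]; have [Qp Qz] := inQ x y s xb yb sb; have /andP[s1 _] := sb.
  apply: (divergence_le su pu tau0 Qp Qz s1) => //; first exact: HA.
  by rewrite lerBlDr (le_trans (Hh _ Qz))// lerDl.
- exact: lef.
- by move=> y s yb sb; have [|->] := far R0 y s eRb yb sb => //; rewrite lexx.
- move=> x s /andP[x1 x2] sb.
  have xb : e <= x <= R0 by apply/andP; split; move: x1 x2 er rR; clear; lra.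
  apply: le_trans (bot x s xb sb); rewrite lerB//.
  have [s0 sn0 si0 si1] := s1P _ sb.
  have ebb : e <= e <= R0 by rewrite lexx.
  have [Qp Qz] := inQ x e s xb ebb sb.
  have [_ sx2] := sle s x sb (ltW (lt_le_trans e_gt0 x1)).
  have [_ se2] := sle s e sb (ltW e_gt0).
  have h1 : s * e < e0 by move: se2 ee0; clear; lra.
  have h2 : s * x <= 2 * r by move: sx2 x2; clear; lra.
  have g := G0_lower tau0 (HB3 _ Qz h1 h2).
  have s2 : 1 / 2 <= s^-1.
    by case/andP: sb => _ s2; rewrite div1r lef_pV2 ?posrE.
  have ss4 : 1 / 4 <= s^-1 * s^-1.
    by rewrite (_ : 1 / 4 = 1 / 2 * (1 / 2)); [apply: ler_pM|field].
  rewrite (_ : tau / 72 = 1 / 4 * (tau / 18)); last by field.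
  by apply: ler_pM => //; rewrite divr_ge0// ltW.
- move=> x s /andP[x1 x2] sb.
  have xb : e <= x <= R0 by apply/andP; split; move: x1 x2 er rR; clear; lra.
  apply: le_trans (bot x s xb sb); rewrite lerDr.
  have [s0 sn0 si0 si1] := s1P _ sb.
  by rewrite !mulr_ge0// G0_ge0.
- by move=> x s xb sb; have [|_ ->] := far x R0 s xb eRb sb => //; rewrite lexx orbT.
- move=> x y xb yb; have s11 : 1 <= (1 : R) <= 2 by rewrite lexx ler1n.
  have [Qp _] := inQ x y 1 xb yb s11.
  rewrite /W3 !mul1r (m_trace_eq2 pu Qp).
  by have /andP[_] := G1b (I (x, y)); move: (G1 k tau _) => z; clear; lra.
- move=> x y xb yb; have s22 : 1 <= (2 : R) <= 2 by rewrite lexx ler1n.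
  have [Qp Qz] := inQ x y 2 xb yb s22.
  rewrite /W3; have /andP[g _] := G1b (I (2 * x, 2 * y)).
  apply: mulr_ge0 => //; apply: mulr_ge0 => //.
  exact: (m_trace_ge0 pu Qp Qz).
Qed.

(** * Expansions at an edge *)

Section EdgeExpansion.
Context {R : realType}.
Implicit Types (u g : R * R -> R) (dl t c : R) (x q : R * R).

Definition xlnx (t : R) : R := t * ln t.

(** The Guillemin expansion at the point (t,0).  One logarithmic term is always there;
    c is 1 at the vertex and 0 elsewhere.  The last condition says that the second derivative
    along the edge is positive (for c = 0, t > 0), and makes x.1 x.2 det D^2u positive in the
    limit. *)
Definition edge_reg u dl t := exists V g c, [/\ open_nbhs ((t, 0) : R * R) V, smooth_in V g,
  (forall x, V x -> quad dl x -> u x = c * xlnx x.1 + xlnx x.2 + g x) &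
  0 < c + t * H11 g (t, 0)].

(** At the edge x.2 = 0 the inverse Hessian degenerates in the normal direction, the normal
    component of its row divergence becomes 1, and the gradient of the intercept is bounded. *)
Definition edge_bounds u (C : R) x :=
  [/\ `|m12 u x| <= C * x.2, `|m22 u x| <= C * x.2, `|V2 u x - 1| <= C * x.2,
        `|J1 u x| <= C & `|J2 u x| <= C].

Lemma pd0E (f : R * R -> R) (a b : R) : pd 0 f (a, b) = 'D_1 (fun t => f (t, b)) a.
Proof. by rewrite pdE partial0E. Qed.

Lemma pd1E (f : R * R -> R) (a b : R) : pd 1 f (a, b) = 'D_1 (fun t => f (a, t)) b.
Proof. by rewrite pdE partial1E. Qed.

Lemma is_derive_xlnx t : 0 < t -> is_derive t 1 xlnx (ln t + 1).
Proof.
move=> t0; refine (is_derive_conv (is_derive_mul (is_derive_var t) (is_derive1_ln t0)) _).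
by rewrite mul1r mulfV ?gt_eqF.
Qed.

Lemma near_bounded (F : R * R -> R) q : {for q, continuous F} ->
  \forall x \near q, `|F x| <= `|F q| + 1.
Proof.
move=> /cvgrPdist_lt/(_ 1 ltr01); apply: filterS => x Fx.
rewrite -lerBlDl; apply: le_trans (ltW Fx).
by rewrite distrC; exact: lerB_dist.
Qed.

Section At.
Variables (u g : R * R -> R) (dl c : R) (V : set (R * R)).
Hypotheses (oV : open V) (sg : smooth_in V g).
Hypothesis uE : forall x, V x -> quad dl x -> u x = c * xlnx x.1 + xlnx x.2 + g x.
Let U := V `&` quad dl.
Let oU : open U. Proof. by apply: openI => //; exact: open_quad. Qed.
Let sgU : smooth_in U g. Proof. by apply: smooth_sub sg => x []. Qed.

Let pos x : U x -> 0 < x.1 /\ 0 < x.2. Proof. by move=> [_ []]. Qed.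

Lemma pd0_expansion x : U x -> pd 0 u x = c * (ln x.1 + 1) + pd 0 g x.
Proof.
move=> Ux; rewrite (pd_eq 0 oU (fun y Uy => uE Uy.1 Uy.2) Ux).
case: x Ux => a b Ux; have [/= a0 b0] := pos Ux.
have d1 := is_derive_mul (is_derive_const c a) (is_derive_xlnx a0).
have d2 := is_derive_fst_pd (smooth_diff sgU Ux).
have [_ E] := is_derive_add (is_derive_add d1 (is_derive_const (xlnx b) a)) d2.
by rewrite [LHS]pd0E [LHS]E /= mul0r add0r addr0.
Qed.

Lemma pd1_expansion x : U x -> pd 1 u x = ln x.2 + 1 + pd 1 g x.
Proof.
move=> Ux; rewrite (pd_eq 1 oU (fun y Uy => uE Uy.1 Uy.2) Ux).
case: x Ux => a b Ux; have [/= a0 b0] := pos Ux.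
have d2 := is_derive_snd_pd (smooth_diff sgU Ux).
have [_ E] := is_derive_add (is_derive_add (is_derive_const (c * xlnx a) b) (is_derive_xlnx b0)) d2.
by rewrite [LHS]pd1E [LHS]E /= add0r.
Qed.

Lemma H11_expansion x : U x -> H11 u x = c / x.1 + H11 g x.
Proof.
move=> Ux; rewrite /H11 (pd_eq 0 oU pd0_expansion Ux).
case: x Ux => a b Ux; have [/= a0 b0] := pos Ux.
have d1 := is_derive_mul (is_derive_const c a) (is_derive_add (is_derive1_ln a0) (is_derive_const 1 a)).
have d2 := is_derive_fst_pd (smooth_diff (smooth_pd 0 sgU) Ux).
have [_ E] := is_derive_add d1 d2.
by rewrite [LHS]pd0E [LHS]E /= mul0r add0r addr0.
Qed.

Lemma H12_expansion x : U x -> H12 u x = H12 g x.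
Proof.
move=> Ux; rewrite /H12 (pd_eq 0 oU pd1_expansion Ux).
case: x Ux => a b Ux; have [/= a0 b0] := pos Ux.
have d2 := is_derive_fst_pd (smooth_diff (smooth_pd 1 sgU) Ux).
have [_ E] := is_derive_add (is_derive_const (ln b + 1) a) d2.
by rewrite [LHS]pd0E [LHS]E /= add0r.
Qed.

Lemma H22_expansion x : U x -> H22 u x = x.2^-1 + H22 g x.
Proof.
move=> Ux; rewrite /H22 (pd_eq 1 oU pd1_expansion Ux).
case: x Ux => a b Ux; have [/= a0 b0] := pos Ux.
have d2 := is_derive_snd_pd (smooth_diff (smooth_pd 1 sgU) Ux).
have [_ E] := is_derive_add (is_derive_add (is_derive1_ln b0) (is_derive_const 1 b)) d2.
by rewrite [LHS]pd1E [LHS]E /= addr0.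
Qed.

(** The quantities x.1 u_11, u_12, x.2 u_22 and x.1 x.2 det D^2u, which are smooth up to
    the edge; then M_22 / x.2, - M_12 / x.2 and (M_22 / x.2 - 1) / x.2. *)
Definition edge_H11 x := c + x.1 * H11 g x.
Definition edge_H12 x := H12 g x.
Definition edge_H22 x := 1 + x.2 * H22 g x.
Definition edge_det x := edge_H11 x * edge_H22 x + - (x.1 * x.2 * (edge_H12 x * edge_H12 x)).
Definition edge_m22 x := edge_H11 x * (edge_det x)^-1.
Definition edge_m12 x := x.1 * edge_H12 x * (edge_det x)^-1.
Definition edge_m22_rem x := (x.1 * (edge_H12 x * edge_H12 x) + - (edge_H11 x * H22 g x)) * (edge_det x)^-1.

Lemma smooth_edge_H11 : smooth_in V edge_H11.
Proof.
apply: smoothD => //; first exact: smooth_cst.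
by apply: smoothM => //; [exact: smooth_fst|do 2 apply: smooth_pd].
Qed.

Lemma smooth_edge_H12 : smooth_in V edge_H12. Proof. by do 2 apply: smooth_pd. Qed.

Lemma smooth_edge_H22 : smooth_in V edge_H22.
Proof.
apply: smoothD => //; first exact: smooth_cst.
by apply: smoothM => //; [exact: smooth_snd|do 2 apply: smooth_pd].
Qed.

Lemma smooth_edge_det : smooth_in V edge_det.
Proof.
apply: smoothD => //; first by apply: smoothM => //; [exact: smooth_edge_H11|exact: smooth_edge_H22].
apply: smoothN => //; apply: smoothM => //.
  by apply: smoothM => //; [exact: smooth_fst|exact: smooth_snd].
by apply: smoothM => //; exact: smooth_edge_H12.
Qed.

Variable B : set (R * R).
Hypotheses (oB : open B) (BV : B `<=` V) (de0 : forall x, B x -> edge_det x != 0).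

Let sde : smooth_in B (fun x => (edge_det x)^-1).
Proof. by apply: smoothV => //; exact: smooth_sub BV smooth_edge_det. Qed.
Let sal : smooth_in B edge_H11. Proof. exact: smooth_sub BV smooth_edge_H11. Qed.
Let sbe : smooth_in B edge_H12. Proof. exact: smooth_sub BV smooth_edge_H12. Qed.
Let sf : smooth_in B (fst : R * R -> R). Proof. exact: smooth_fst. Qed.

Lemma smooth_edge_m22 : smooth_in B edge_m22. Proof. exact: smoothM. Qed.
Lemma smooth_edge_m12 : smooth_in B edge_m12. Proof. by apply: smoothM => //; exact: smoothM. Qed.
Lemma smooth_edge_m22_rem : smooth_in B edge_m22_rem.
Proof.
have sH : smooth_in B (H22 g) by apply: smooth_sub BV _; apply: smooth_pd; exact: smooth_pd.
exact: (smoothM oB (smoothD oB (smoothM oB sf (smoothM oB sbe sbe)) (smoothN oB (smoothM oB sal sH))) sde).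
Qed.

Let BU := B `&` quad dl.
Let oBU : open BU. Proof. by apply: openI => //; exact: open_quad. Qed.
Let UB x : BU x -> U x. Proof. by move=> [/BV]. Qed.

Lemma hdet_expansion x : BU x -> hdet u x = edge_det x / (x.1 * x.2).
Proof.
move=> Bx; have Ux := UB Bx; have [a0 b0] := pos Ux.
rewrite hdetE (H11_expansion Ux) (H12_expansion Ux) (H22_expansion Ux) /edge_det /edge_H11 /edge_H12 /edge_H22.
have := gt_eqF a0; have := gt_eqF b0; move: x.1 x.2 (H11 g x) (H12 g x) (H22 g x).
by move=> a b A B' C /negbT b1 /negbT a1; field; rewrite b1 a1.
Qed.

Lemma m22_expansion x : BU x -> m22 u x = x.2 * edge_m22 x.
Proof.
move=> Bx; have Ux := UB Bx; have [a0 b0] := pos Ux.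
rewrite m22E (hdet_expansion Bx) (H11_expansion Ux) /edge_m22.
have dx := de0 Bx.1.
rewrite /edge_H11; move: (edge_det x) dx; have := gt_eqF a0; have := gt_eqF b0; move: x.1 x.2 (H11 g x).
by move=> a b A /negbT b1 /negbT a1 d d0; field; rewrite d0 b1 a1.
Qed.

Lemma m12_expansion x : BU x -> m12 u x = - (x.2 * edge_m12 x).
Proof.
move=> Bx; have Ux := UB Bx; have [a0 b0] := pos Ux.
rewrite m12E (hdet_expansion Bx) (H12_expansion Ux) /edge_m12.
have dx := de0 Bx.1.
rewrite /edge_H12; move: (edge_det x) dx; have := gt_eqF a0; have := gt_eqF b0; move: x.1 x.2 (H12 g x).
by move=> a b A /negbT b1 /negbT a1 d d0; field; rewrite d0 b1 a1.
Qed.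

(** This is (V2 - 1) / x.2. *)
Definition edge_V2 x := - pd 0 edge_m12 x + pd 1 edge_m22 x + edge_m22_rem x.

Lemma V2_expansion x : BU x -> V2 u x - 1 = x.2 * edge_V2 x.
Proof.
move=> Bx; have Ux := UB Bx; have [a0 b0] := pos Ux.
have d1 := smooth_diff smooth_edge_m22 Bx.1; have d2 := smooth_diff smooth_edge_m12 Bx.1.
have ds := differentiable_snd x.
rewrite /V2 (pd_eq 0 oBU m12_expansion Bx) (pd_eq 1 oBU m22_expansion Bx).
have s2 : smooth_in B (fun y => y.2 * edge_m12 y) by apply: smoothM => //; [exact: smooth_snd|exact: smooth_edge_m12].
have E1 : pd 0 (fun y => y.2 * edge_m12 y) x = 0 * edge_m12 x + x.2 * pd 0 edge_m12 x.
  by have := pdM 0 ds d2; rewrite pd_snd.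
have E2 : pd 1 (fun y => y.2 * edge_m22 y) x = 1 * edge_m22 x + x.2 * pd 1 edge_m22 x.
  by have := pdM 1 ds d1; rewrite pd_snd.
rewrite (pdN 0 s2 Bx.1) E1 E2 mul0r add0r mul1r /edge_V2.
have -> : edge_m22 x = 1 + x.2 * edge_m22_rem x.
  rewrite /edge_m22 /edge_m22_rem; have := de0 Bx.1; rewrite /edge_det /edge_H22.
  by move: (edge_H11 x) (edge_H12 x) (H22 g x) x.1 x.2 => A Bb C a b d0; field.
by ring.
Qed.

Lemma J1_expansion x : BU x -> J1 u x = - (edge_H11 x + x.2 * edge_H12 x).
Proof.
move=> Bx; have Ux := UB Bx; have [a0 b0] := pos Ux.
rewrite /J1 (H11_expansion Ux) (H12_expansion Ux) /edge_H11 /edge_H12.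
have := gt_eqF a0; move: x.1 x.2 (H11 g x) (H12 g x) => a b A B' /negbT a1.
by field.
Qed.

Lemma J2_expansion x : BU x -> J2 u x = - (x.1 * edge_H12 x + edge_H22 x).
Proof.
move=> Bx; have Ux := UB Bx; have [a0 b0] := pos Ux.
rewrite /J2 (H22_expansion Ux) (H12_expansion Ux) /edge_H22 /edge_H12.
have := gt_eqF b0; move: x.1 x.2 (H22 g x) (H12 g x) => a b A B' /negbT b1.
by field.
Qed.

Lemma expansion_bounds q : B q -> exists C, \forall x \near q, quad dl x -> edge_bounds u C x.
Proof.
move=> Bq.
have sj1 : smooth_in B (fun x => edge_H11 x + x.2 * edge_H12 x).
  exact: (smoothD oB sal (smoothM oB (@smooth_snd _ B) sbe)).
have sj2 : smooth_in B (fun x => x.1 * edge_H12 x + edge_H22 x).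
  exact: (smoothD oB (smoothM oB sf sbe) (smooth_sub BV smooth_edge_H22)).
have s4 : smooth_in B edge_V2.
  exact: (smoothD oB (smoothD oB (smoothN oB (smooth_pd 0 smooth_edge_m12)) (smooth_pd 1 smooth_edge_m22)) smooth_edge_m22_rem).
have nb F : smooth_in B F -> exists2 C, 0 <= C & \forall x \near q, `|F x| <= C.
  by move=> sF; exists (`|F q| + 1); [rewrite addr_ge0|apply: near_bounded; exact: smooth_cont sF Bq].
have [C1 C10 n1] := nb _ smooth_edge_m22; have [C2 C20 n2] := nb _ smooth_edge_m12.
have [C3 C30 n3] := nb _ s4; have [C4 C40 n4] := nb _ sj1; have [C5 C50 n5] := nb _ sj2.
exists (C1 + C2 + C3 + C4 + C5).
have nB : \forall x \near q, B x by apply: open_nbhs_nbhs.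
near=> x => Qx.
have Bx : BU x by split => //; near: x.
have [_ b0] := pos (UB Bx).
split.
- rewrite (m12_expansion Bx) normrN normrM (gtr0_norm b0) mulrC; apply: ler_wpM2r; first exact: ltW.
  have : `|edge_m12 x| <= C2 by near: x.
  by move: C10 C20 C30 C40 C50; lra.
- rewrite (m22_expansion Bx) normrM (gtr0_norm b0) mulrC; apply: ler_wpM2r; first exact: ltW.
  have : `|edge_m22 x| <= C1 by near: x.
  by move: C10 C20 C30 C40 C50; lra.
- rewrite (V2_expansion Bx) normrM (gtr0_norm b0) mulrC; apply: ler_wpM2r; first exact: ltW.
  have : `|edge_V2 x| <= C3 by near: x.
  by move: C10 C20 C30 C40 C50; lra.
- rewrite (J1_expansion Bx) normrN.
  have : `|edge_H11 x + x.2 * edge_H12 x| <= C4 by near: x.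
  by move: C10 C20 C30 C40 C50; lra.
- rewrite (J2_expansion Bx) normrN.
  have : `|x.1 * edge_H12 x + edge_H22 x| <= C5 by near: x.
  by move: C10 C20 C30 C40 C50; lra.
Unshelve. all: by end_near. Qed.

End At.

(** The rescaled determinant is c + t g_11 > 0 at the point itself, so nearby all
    rescaled quantities are smooth, hence bounded. *)
Lemma edge_reg_bounds u dl t : edge_reg u dl t ->
  exists C, \forall x \near ((t, 0) : R * R), quad dl x -> edge_bounds u C x.
Proof.
move=> [V [g [c [[oV Vq] sg uE pos]]]].
have dq : 0 < edge_det g c (t, 0).
  by rewrite /edge_det /edge_H11 /edge_H22 /= !mul0r addr0 mulr1 mulr0 mul0r subr0.
have := smooth_cont (smooth_edge_det c oV sg) Vq => /cvgrPdist_lt/(_ _ dq) nd.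
have : \forall x \near ((t, 0) : R * R), V x /\ edge_det g c x != 0.
  apply: filterI; first exact: open_nbhs_nbhs.
  move: nd; apply: filterS => x; apply: contraTN => /eqP ->.
  by rewrite subr0 gtr0_norm// ltxx.
move=> /nbhs_ballP[r /= r0 Br].
apply: (@expansion_bounds u g dl c V oV sg uE (ball ((t, 0) : R * R) r)).
- exact: ball_open.
- by move=> x /Br[].
- by move=> x /Br[].
- exact: ballxx.
Qed.

End EdgeExpansion.

(** * Uniform bounds along an edge and reflection *)

Section EdgeUniform.
Context {R : realType}.

(** Compactness of the segment turns bounds near each of its points, with their own
    constants, into bounds in a strip with one constant.  The same number e measures the
    strip and, inverted, the constant. *)
Lemma edge_uniform (dl T : R) (Pr : R -> R * R -> Prop) :
  (forall C C' x, C <= C' -> quad dl x -> Pr C x -> Pr C' x) ->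
  (forall t, 0 <= t <= T -> exists C, \forall x \near ((t, 0) : R * R), quad dl x -> Pr C x) ->
  exists2 e : R, 0 < e & forall x, quad dl x -> x.2 < e -> x.1 <= T -> Pr e^-1 x.
Proof.
move=> mono loc.
have /compact_near_coveringP/(_ _ ((0:R)^'+)
  (fun e t => forall y, y < e -> quad dl (t, y) -> Pr e^-1 (t, y))) := @segment_compact R 0 T.
have ok t : `[0, T]%classic t -> \forall t' \near t & e \near (0:R)^'+,
    forall y, y < e -> quad dl (t', y) -> Pr e^-1 (t', y).
  rewrite /= in_itv /= => tT; have [C /nbhs_ballP[r /= r0 Br]] := loc t tT.
  have C1 : 0 < `|C| + 1 by rewrite ltr_wpDl.
  exists (ball t r, [set e | 0 < e /\ e < Num.min r (`|C| + 1)^-1]) => /=.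
    split; first exact: nbhsx_ballx.
    apply: filterI; first exact: nbhs_right_gt.
    by apply: nbhs_right_lt; rewrite lt_min r0 invr_gt0.
  move=> [t' e] /= [tt' [e0]]; rewrite lt_min => /andP[er eC] y ye Qy.
  have [_ /= y0 _] := Qy.
  apply: (mono C) => //.
    apply: (@le_trans _ _ (`|C| + 1)); first by rewrite (le_trans (ler_norm _))// lerDl.
    by rewrite -(invrK (`|C| + 1)) lef_pV2 ?posrE ?invr_gt0// ltW.
  apply: Br => //; split => //=; rewrite /ball /= sub0r normrN gtr0_norm//.
  exact: lt_trans er.
move=> /(_ _ ok)/= nr.
have [e [e0 He]] : exists e : R, 0 < e /\
    `[0, T]%classic `<=` (fun t => forall y, y < e -> quad dl (t, y) -> Pr e^-1 (t, y)).
  near ((0:R)^'+) => e; exists e; split; first by near: e; exact: nbhs_right_gt.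
  by near: e.
exists e => // -[x y] Qx /= ye xT.
apply: He => //=; rewrite in_itv /= xT andbT.
by have [/ltW] := Qx.
Unshelve. all: by end_near. Qed.

End EdgeUniform.

Section SwapPotential.
Context {R : realType}.
Implicit Types (u f : R * R -> R).

Lemma pd_swap i f : pd i (f \o swap) = pd (swap_index i) f \o swap.
Proof. by rewrite !pdE partial_swap. Qed.

Lemma swap_index0 : swap_index 0 = 1. Proof. by []. Qed.
Lemma swap_index1 : swap_index 1 = 0. Proof. by []. Qed.

Lemma quad_swap dl (x : R * R) : quad dl x -> quad dl (swap x).
Proof. by move=> [a b c]; split => //=; rewrite addrC. Qed.

Lemma H11_swap u : H11 (u \o swap) = H22 u \o swap.
Proof. by rewrite /H11 /H22 !pd_swap. Qed.

Lemma H22_swap u : H22 (u \o swap) = H11 u \o swap.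
Proof. by rewrite /H11 /H22 !pd_swap. Qed.

Variables (u : R * R -> R) (dl : R).
Hypothesis su : smooth_in (quad dl) u.
Let oQ := @open_quad R dl.

Lemma H12_swap x : quad dl x -> H12 (u \o swap) x = H12 u (swap x).
Proof.
by move=> /quad_swap Qx; rewrite {1}/H12 !pd_swap /= swap_index0 swap_index1; exact: (schwarz_u su Qx).
Qed.

Lemma hdet_swap x : quad dl x -> hdet (u \o swap) x = hdet u (swap x).
Proof.
move=> Qx; rewrite !hdetE (H12_swap Qx) H11_swap H22_swap /=.
by rewrite (mulrC (H22 u _)).
Qed.

Lemma m11_swap x : quad dl x -> m11 (u \o swap) x = m22 u (swap x).
Proof. by move=> Qx; rewrite m11E m22E (hdet_swap Qx) H22_swap. Qed.

Lemma m22_swap x : quad dl x -> m22 (u \o swap) x = m11 u (swap x).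
Proof. by move=> Qx; rewrite m22E m11E (hdet_swap Qx) H11_swap. Qed.

Lemma m12_swap x : quad dl x -> m12 (u \o swap) x = m12 u (swap x).
Proof. by move=> Qx; rewrite !m12E (hdet_swap Qx) (H12_swap Qx). Qed.

Lemma V2_swap x : quad dl x -> V2 (u \o swap) x = V1 u (swap x).
Proof.
move=> Qx; rewrite /V2 (pd_eq (g := m12 u \o swap) 0 oQ m12_swap Qx).
by rewrite (pd_eq (g := m11 u \o swap) 1 oQ m22_swap Qx) !pd_swap /= swap_index0 swap_index1 addrC.
Qed.

Lemma V1_swap x : quad dl x -> V1 (u \o swap) x = V2 u (swap x).
Proof.
move=> Qx; rewrite /V1 (pd_eq (g := m22 u \o swap) 0 oQ m11_swap Qx).
by rewrite (pd_eq (g := m12 u \o swap) 1 oQ m12_swap Qx) !pd_swap /= swap_index0 swap_index1 addrC.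
Qed.

Lemma divV_swap x : quad dl x ->
  pd 0 (V1 (u \o swap)) x + pd 1 (V2 (u \o swap)) x =
  pd 0 (V1 u) (swap x) + pd 1 (V2 u) (swap x).
Proof.
move=> Qx; rewrite (pd_eq (g := V2 u \o swap) 0 oQ V1_swap Qx).
by rewrite (pd_eq (g := V1 u \o swap) 1 oQ V2_swap Qx) !pd_swap /= swap_index0 swap_index1 addrC.
Qed.

Lemma J1_swap x : quad dl x -> J1 (u \o swap) x = J2 u (swap x).
Proof. by move=> Qx; rewrite /J1 /J2 (H12_swap Qx) H11_swap /= addrC. Qed.

Lemma J2_swap x : quad dl x -> J2 (u \o swap) x = J1 u (swap x).
Proof. by move=> Qx; rewrite /J1 /J2 (H12_swap Qx) H22_swap /= addrC. Qed.

End SwapPotential.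

(** * Potentials on a corner *)

Section Corner.
Context {R : realType}.
Implicit Types (u : R * R -> R) (dl a : R) (x z : R * R).

Definition cquad dl : set (R * R) := [set x | [/\ 0 <= x.1, 0 <= x.2 & x.1 + x.2 < dl]].

(** What the main argument uses of a solution: the equation, convexity, monotonicity
    along the two edges and their regularity.  The definition is symmetric under reflection. *)
Record corner u dl a : Prop := {
  corner_smooth : smooth_in (quad dl) u ;
  corner_pos : forall x, quad dl x -> 0 < H11 u x /\ 0 < hdet u x ;
  corner_abreu : forall x, quad dl x -> `|pd 0 (V1 u) x + pd 1 (V2 u) x| <= a ;
  corner_convex : forall x z t, cquad dl x -> cquad dl z -> 0 <= t <= 1 ->
    u (t * x.1 + (1 - t) * z.1, t * x.2 + (1 - t) * z.2) <= t * u x + (1 - t) * u z ;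
  corner_cont : forall x e, cquad dl x -> 0 < e ->
    \forall z \near x, cquad dl z -> `|u x - u z| < e ;
  corner_ge0 : forall x, cquad dl x -> 0 <= u x ;
  corner_dec1 : forall s t, 0 <= s -> s <= t -> t < dl -> u (t, 0) <= u (s, 0) ;
  corner_dec2 : forall s t, 0 <= s -> s <= t -> t < dl -> u (0, t) <= u (0, s) ;
  corner_reg1 : forall t, 0 <= t -> t < dl -> edge_reg u dl t ;
  corner_reg2 : forall t, 0 <= t -> t < dl -> edge_reg (u \o swap) dl t
}.

Lemma cquad_swap dl x : cquad dl x -> cquad dl (swap x).
Proof. by move=> [a b c]; split => //=; rewrite addrC. Qed.

Lemma swap_comp u : u \o swap \o swap = u.
Proof. by apply/funext => -[]. Qed.

Lemma corner_swap u dl a : corner u dl a -> corner (u \o swap) dl a.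
Proof.
case=> su pu au cu ku gu d1 d2 r1 r2; split.
- have := smooth_swap su; apply: smooth_sub => x; exact: quad_swap.
- move=> x Qx; have Qs := quad_swap Qx.
  by rewrite (hdet_swap su Qx) H11_swap /=; split; [exact: (H22_gt0 pu Qs)|have [] := pu _ Qs].
- by move=> x Qx; rewrite (divV_swap su Qx); exact/au/quad_swap.
- by move=> x z t /cquad_swap cx /cquad_swap cz t01; exact: (cu (swap x) (swap z)).
- move=> x e /cquad_swap cx e0.
  have nH : \forall z \near x, cquad dl (swap z) -> `|u (swap x) - u (swap z)| < e.
    exact: (@continuous_swap R x _ (ku _ _ cx e0)).
  by apply: filterS nH => z H /cquad_swap.
- by move=> x /cquad_swap; exact: gu.
- exact: d2.
- exact: d1.
- exact: r2.
- by rewrite swap_comp.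
Qed.

Lemma quadW dl x : quad dl x -> cquad dl x.
Proof. by move=> [/ltW a /ltW b c]. Qed.

(** The difference quotients of a convex function along a segment from x decrease to
    the derivative at x; z may lie on an edge, where u need not be differentiable. *)
Lemma tangent_plane u dl a x z : corner u dl a -> quad dl x -> cquad dl z ->
  u x + ((z.1 - x.1) * pd 0 u x + (z.2 - x.2) * pd 1 u x) <= u z.
Proof.
move=> cu; case: x => x1 x2 Qx Cz /=.
set L := _ * pd 0 u _ + _.
have dl_ : is_derive (0 : R) (1 : R) (fun t : R => u (x1 + t * (z.1 - x1), x2 + t * (z.2 - x2))) L.
  have := @is_derive_line_pd R u (x1, x2) (z.1 - x1, z.2 - x2) 0.
  by rewrite /= !mul0r !addr0; apply; exact: smooth_diff (corner_smooth cu) Qx.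
have [dphi ephi] := dl_.
have cv : h^-1 *: (u (x1 + (h *: 1 + 0) * (z.1 - x1), x2 + (h *: 1 + 0) * (z.2 - x2)) -
    u (x1 + 0 * (z.1 - x1), x2 + 0 * (z.2 - x2))) @[h --> (0:R)^'] --> L.
  by rewrite -[X in _ --> X]ephi; exact: dphi.
rewrite addrC -lerBrDr; apply/ler_addgt0Pr => e e0.
move/cvg_dnbhs_at_right/cvgrPdist_lt : cv => /(_ e e0) nL.
near ((0:R)^'+) => h.
have h0 : 0 < h by near: h; exact: nbhs_right_gt.
have h1 : h <= 1 by near: h; exact: nbhs_right_le.
have : `|L - h^-1 *: (u (x1 + (h *: 1 + 0) * (z.1 - x1), x2 + (h *: 1 + 0) * (z.2 - x2)) -
    u (x1 + 0 * (z.1 - x1), x2 + 0 * (z.2 - x2)))| < e by near: h.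
rewrite addr0 [h *: 1]mulr1 !mul0r !addr0 /GRing.scale /=.
have h01 : 0 <= h <= 1 by rewrite ltW.
have := corner_convex cu Cz (quadW Qx) h01.
rewrite (_ : h * z.1 + (1 - h) * (x1, x2).1 = x1 + h * (z.1 - x1)); last by rewrite /=; ring.
rewrite (_ : h * z.2 + (1 - h) * (x1, x2).2 = x2 + h * (z.2 - x2)); last by rewrite /=; ring.
move: (u (x1 + _, _)) (u (x1, x2)) (u z) => w A B cw; rewrite ltr_norml => /andP[_ up].
have : h^-1 * (w - A) <= B - A.
  by rewrite mulrC ler_pdivrMr//; move: cw; clear; lra.
by move: up; clear; lra.
Unshelve. all: by end_near. Qed.

Lemma icptE u x : x.1 * pd 0 u x + x.2 * pd 1 u x = u x - icpt u x.
Proof. by rewrite /icpt; ring. Qed.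

(** Along the ray through x, the tangent plane is the affine interpolation of I(x) at the
    origin and u(x) at x. *)
Lemma tangent_ray u dl a x s : corner u dl a -> quad dl x -> cquad dl (s * x.1, s * x.2) ->
  s * u x + (1 - s) * icpt u x <= u (s * x.1, s * x.2).
Proof.
move=> cu Qx Cz; have := tangent_plane cu Qx Cz; apply: le_trans => /=.
have := icptE u x; move: (u x) (icpt u x) (pd 0 u x) (pd 1 u x) => U I p q E.
rewrite (_ : (s * x.1 - x.1) * p + (s * x.2 - x.2) * q = (s - 1) * (x.1 * p + x.2 * q)); last by ring.
by rewrite E le_eqVlt (_ : _ == _)//; apply/eqP; ring.
Qed.

Lemma icpt_le u dl a x : corner u dl a -> quad dl x -> icpt u x <= u (0, 0).
Proof.
move=> cu Qx; have [x1 x2 xd] := Qx.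
have C0 : cquad dl (0 * x.1, 0 * x.2).
  by split; rewrite /= ?mul0r// addr0; apply: lt_trans xd; rewrite addr_gt0.
by have := tangent_ray cu Qx C0; rewrite !mul0r add0r subr0 mul1r.
Qed.

(** The values of u along the edge can exceed D by 2 tau only at distances quadratically
    small in r0.  The proof checks the hypotheses of [flux_bound] with k = D + tau and r = r1/2:
    the intercept is at most D + tau/2 beyond R0, by [tangent_ray] towards the segment between
    (r0,0) and (0,r0); it is at least D + 3 tau/2 near the edge up to r1, by [tangent_ray] at 2x. *)
Lemma edge_value_estimate u dl a (D tau r0 r1 : R) (h := u (0, 0)) (R0 := 2 * h * r0 / tau) :
  corner u dl a -> 0 <= a -> 0 < tau -> 0 <= D -> 0 < r0 -> 0 < r1 ->
  4 * R0 < dl -> u (r0, 0) <= D -> u (0, r0) <= D -> D + 2 * tau <= u (r1, 0) -> r1 < dl ->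
  tau / 144 * r1 <= (a * h + 2) * R0 ^+ 2.
Proof.
move=> cu a0 tau0 D0 r00 r10 R4 f0 g0 f1 r1dl.
have dl0 : 0 < dl by exact: lt_trans r1dl.
have hr1 : u (r1, 0) <= h by apply: (corner_dec1 cu) => //; exact: ltW.
have htau : tau <= h by move: (le_trans f1 hr1) D0 tau0; clear; lra.
have h0 : 0 < h by exact: lt_le_trans htau.
have R0r0 : 2 * r0 <= R0.
  by rewrite /R0 ler_pdivlMr// (_ : 2 * r0 * tau = 2 * tau * r0); [apply: ler_wpM2r; [exact: ltW|apply: ler_wpM2l]|ring].
have R00 : 0 < R0 by apply: lt_le_trans R0r0; rewrite mulr_gt0.
have r0dl : r0 < dl by move: R0r0 R4 R00; clear; lra.
have r1r0 : r1 < r0.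
  rewrite ltNge; apply/negP => r01.
  have := corner_dec1 cu (ltW r00) r01 r1dl.
  by move: f0 f1 tau0; clear; lra.
have c0 t : 0 <= t -> t < dl -> cquad dl (t, 0) by move=> t0 td; split => //=; rewrite addr0.
have c0' t : 0 <= t -> t < dl -> cquad dl (0, t) by move=> t0 td; split => //=; rewrite add0r.
(* s x lies on the segment between (r0,0) and (0,r0), where u <= D; and s <= r0/R0. *)
have HR x : quad dl x -> R0 <= x.1 + x.2 -> icpt u x <= D + tau / 2.
  move=> Qx nu; have [x1 x2 xd] := Qx.
  set n := x.1 + x.2 in nu; have n0 : 0 < n by exact: lt_le_trans nu.
  pose s := r0 / n; have s0 : 0 < s by rewrite divr_gt0.
  have sh : s * h <= tau / 2.
    rewrite /s mulrAC ler_pdivrMr// (le_trans _ (ler_wpM2l _ nu)) ?divr_ge0 ?(ltW tau0)//.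
    by rewrite /R0 (_ : tau / 2 * _ = r0 * h)//; have := gt_eqF tau0 => /negbT t0; field.
  have s1 : s <= 1.
    by rewrite /s ler_pdivrMr// mul1r; move: nu R0r0 r00; clear; lra.
  have sn : s * x.1 + s * x.2 = r0 by rewrite -mulrDr /s divfK// gt_eqF.
  have Cs : cquad dl (s * x.1, s * x.2).
    by split; [apply: mulr_ge0; exact: ltW|apply: mulr_ge0; exact: ltW|rewrite /= sn].
  have := tangent_ray cu Qx Cs.
  have w01 : 0 <= x.1 / n <= 1.
    by rewrite divr_ge0 ?(ltW x1) ?(ltW n0)//= ler_pdivrMr// mul1r /n lerDl ltW.
  have := corner_convex cu (c0 _ (ltW r00) r0dl) (c0' _ (ltW r00) r0dl) w01.
  have nn : n != 0 by rewrite gt_eqF.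
  rewrite (_ : x.1 / n * (r0, 0).1 + (1 - x.1 / n) * (0, r0).1 = s * x.1); last first.
    by rewrite /= /s; field.
  rewrite (_ : x.1 / n * (r0, 0).2 + (1 - x.1 / n) * (0, r0).2 = s * x.2); last first.
    by rewrite /= /s /n; field.
  move=> cvx.
  have uD : u (s * x.1, s * x.2) <= D.
    apply: (le_trans cvx); have /andP[w0 w1] := w01.
    have e1 := ler_wpM2l w0 f0.
    have w1' : 0 <= 1 - x.1 / n by rewrite subr_ge0.
    have e2 := ler_wpM2l w1' g0.
    by move: e1 e2; clear; lra.
  have ux0 := corner_ge0 cu (quadW Qx).
  have su0 : 0 <= s * u x by rewrite mulr_ge0// ltW.
  have smooth_icpt : s * icpt u x <= s * h by apply: ler_wpM2l; [exact: ltW|exact: icpt_le cu Qx].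
  by move: uD su0 smooth_icpt sh; clear; lra.
have c4 : 0 <= 4 * R0 by rewrite mulr_ge0// ltW.
have mono C C' (v : R * R -> R) x : C <= C' -> quad dl x -> edge_bounds v C x -> edge_bounds v C' x.
  move=> CC' [x1 x2 _] [b1 b2 b3 b4 b5].
  by split; [apply: le_trans b1 _|apply: le_trans b2 _|apply: le_trans b3 _
    |exact: le_trans CC'|exact: le_trans CC']; apply: ler_wpM2r => //; exact: ltW.
have T2 t : 0 <= t <= 2 * R0 -> 0 <= t /\ t < dl.
  by move=> /andP[t0 t2]; split => //; move: t2 R4 R00; clear; lra.
have [e1 e10 B1] := @edge_uniform R dl (2 * R0) (edge_bounds u) (fun C C' x => @mono C C' u x)
   (fun t tT => edge_reg_bounds (corner_reg1 cu (T2 t tT).1 (T2 t tT).2)).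
have [e2 e20 B2] := @edge_uniform R dl (2 * R0) (edge_bounds (u \o swap)) (fun C C' x => @mono C C' (u \o swap) x)
   (fun t tT => edge_reg_bounds (corner_reg2 cu (T2 t tT).1 (T2 t tT).2)).
(* As x tends to (t,0), 2 u(x) - u(2x) tends to 2 u(t,0) - u(2t,0) >= u(t,0). *)
have [e3 e30 B3] : exists2 e : R, 0 < e & forall x, quad dl x -> x.2 < e -> x.1 <= r1 ->
    D + tau + tau / 2 <= icpt u x.
  apply: (@edge_uniform R dl r1 (fun _ x => D + tau + tau / 2 <= icpt u x)) => // t /andP[t0 tr1].
  have t2 : t + t < dl by move: tr1 r1r0 R0r0 R4 R00 r00; clear; lra.
  have tdl : t < dl by move: t2 t0; clear; lra.
  have ft : D + 2 * tau <= u (t, 0) by apply: (le_trans f1); exact: (corner_dec1 cu).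
  have f2t : u (t + t, 0) <= u (t, 0) by apply: (corner_dec1 cu) => //; rewrite lerDl.
  have t8 : 0 < tau / 8 by rewrite divr_gt0.
  have n1 := corner_cont cu (c0 _ t0 tdl) t8.
  have /nbhs_ballP[r /= r_0 Br] := corner_cont cu (c0 _ (addr_ge0 t0 t0) t2) t8.
  have r2 : 0 < r / 2 by rewrite divr_gt0.
  have n2 : \forall x \near ((t, 0) : R * R), ball ((t, 0) : R * R) (r / 2) x by exact: nbhsx_ballx.
  have n3 : \forall x \near ((t, 0) : R * R), x.1 + x.1 + (x.2 + x.2) < dl.
    have cc : {for ((t, 0) : R * R), continuous (fun x : R * R => x.1 + x.1 + (x.2 + x.2))}.
      by apply: cvgD; apply: cvgD; (exact: cvg_fst || exact: cvg_snd).
    by apply: (cvgr_lt _ cc); rewrite /= addr0 addr0.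
  exists 0; near=> x => Qx; have [x1 x2 xd] := Qx.
  have b2 : x.1 + x.1 + (x.2 + x.2) < dl by near: x.
  have C2 : cquad dl (2 * x.1, 2 * x.2).
    by split; [apply: mulr_ge0 => //; exact: ltW|apply: mulr_ge0 => //; exact: ltW|move: b2 => /=; clear; lra].
  have /(_ (quadW Qx)) q1 : cquad dl x -> `|u (t, 0) - u x| < tau / 8 by near: x.
  have q2 : `|u (t + t, 0) - u (2 * x.1, 2 * x.2)| < tau / 8.
    apply: Br => //; have [/= bx by_] : ball ((t, 0) : R * R) (r / 2) x by near: x.
    move: bx by_; rewrite /ball /= !ltr_norml => /andP[k1 k2] /andP[k3 k4].
    by split; rewrite /ball /= ltr_norml; apply/andP; split; move: k1 k2 k3 k4; clear; lra.
  have := tangent_ray cu Qx C2.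
  move: q1 q2 ft f2t; rewrite !ltr_norml => /andP[q1 q1'] /andP[q2 q2'].
  move: q1 q1' q2 q2'.
  move: t8 (u (t, 0)) (u x) (u (t + t, 0)) (u (2 * _, _)) (icpt u x); clear.
  by move=> t8 A B C E F; lra.
pose e0 := Num.min e1 (Num.min e2 e3).
have e00 : 0 < e0 by rewrite !lt_min e10 e20 e30.
have ee : [/\ e0 <= e1, e0 <= e2 & e0 <= e3] by rewrite /e0 !ge_min !lexx ?orbT.
case: ee => ee1 ee2 ee3.
pose C := Num.max e1^-1 e2^-1.
have C0 : 0 <= C by rewrite /C le_max invr_ge0 ltW.
have CC : e1^-1 <= C /\ e2^-1 <= C by rewrite /C !le_max !lexx ?orbT.
case: CC => CC1 CC2.
have := @flux_bound R u dl a h (D + tau) tau R0 (r1 / 2) e0 C (corner_smooth cu) (corner_pos cu)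
  tau0 a0 (ltW h0) (addr_ge0 D0 (ltW tau0)) (corner_abreu cu) (fun x => @icpt_le u dl a x cu) R00 R4.
rewrite (_ : tau / 72 * (r1 / 2) = tau / 144 * r1); last by field.
apply => //.
- by move=> x Qx nu; apply: (le_trans (HR x Qx nu)); move: tau0; clear; lra.
- by rewrite divr_gt0.
- by move: r1r0 R0r0 r00; clear; lra.
- move=> x Qx xe xT; apply: (mono e1^-1 C u x CC1 Qx); apply: B1 => //.
  exact: lt_le_trans ee1.
- move=> x Qx xe xT; have Qs := quad_swap Qx.
  have := mono e2^-1 C (u \o swap) (swap x) CC2 Qs (B2 _ Qs (lt_le_trans xe ee2) xT).
  move=> [b1 b2 b3 b4 b5].
  rewrite (m12_swap (corner_smooth cu) Qs) swapK /= in b1.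
  rewrite (m22_swap (corner_smooth cu) Qs) swapK /= in b2.
  rewrite (V2_swap (corner_smooth cu) Qs) swapK /= in b3.
  rewrite (J1_swap (corner_smooth cu) Qs) swapK in b4.
  rewrite (J2_swap (corner_smooth cu) Qs) swapK in b5.
  by split.
- move=> x Qx xe xT; apply: B3 => //; first exact: lt_le_trans ee3.
  by move: xT; rewrite mulrC divfK.
Unshelve. all: by end_near. Qed.

End Corner.

(** * Iteration towards the vertex *)

Section Iteration.
Context {R : realType}.
Implicit Types (u : R * R -> R) (dl a m p : R).

(** The contrapositive of [edge_value_estimate] with tau = h p/16 and r1 = r0 (p/2)^4: then
    R = 32 r0 p^3, and 32^2, 144 and 16 * 16 make up the constant c. *)
Lemma dyadic_step u dl a (h := u (0, 0)) (r0 p c : R) (cE : c = 1024 * (144 * 256)) :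
  corner u dl a -> 0 <= a -> 1 < h ->
  0 < r0 -> 128 * r0 < dl -> (a + 2) * c * r0 < 1 -> 0 < p -> p <= 1 ->
  u (r0 * p ^+ 4, 0) <= h / 2 + h / 4 * (1 - p) ->
  u (0, r0 * p ^+ 4) <= h / 2 + h / 4 * (1 - p) ->
  u (r0 * (p / 2) ^+ 4, 0) <= h / 2 + h / 4 * (1 - p / 2).
Proof.
move=> cu a0 h1 r00 rdl ra p0 p1 f0 g0.
rewrite leNgt; apply/negP => f1.
have h0 : 0 < h by apply: lt_trans h1.
have pn0 : p != 0 by rewrite gt_eqF.
have hn0 : h != 0 by rewrite gt_eqF.
have t0 : 0 < h * p / 16 by rewrite divr_gt0 ?mulr_gt0.
have p4 : 0 < p ^+ 4 by rewrite exprn_gt0.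
have p3 : p ^+ 3 <= 1 by apply: exprn_ile1 => //; exact: ltW.
have q4 : (p / 2) ^+ 4 <= 1.
  by apply: exprn_ile1; [rewrite divr_ge0// ltW|move: p1; clear; lra].
have D0 : 0 <= h / 2 + h / 4 * (1 - p).
  have q0 : 0 <= h / 4 * (1 - p) by apply: mulr_ge0; [rewrite divr_ge0// ltW|rewrite subr_ge0].
  by move: q0 h0; clear; lra.
have R0E : 2 * h * (r0 * p ^+ 4) / (h * p / 16) = 32 * r0 * p ^+ 3.
  by field; rewrite hn0 pn0.
have r3 : r0 * p ^+ 3 <= r0 by rewrite ger_pMr.
have r4 : r0 * (p / 2) ^+ 4 <= r0 by rewrite ger_pMr.
have := @edge_value_estimate R u dl a (h / 2 + h / 4 * (1 - p)) (h * p / 16) (r0 * p ^+ 4) (r0 * (p / 2) ^+ 4)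
  cu a0 t0 D0 (mulr_gt0 r00 p4).
rewrite -/h R0E.
have c1 : 0 < r0 * (p / 2) ^+ 4 by rewrite mulr_gt0// exprn_gt0// divr_gt0.
have c2 : 4 * (32 * r0 * p ^+ 3) < dl.
  by apply: le_lt_trans rdl; rewrite (_ : 4 * _ = 128 * (r0 * p ^+ 3)); [move: r3; clear; lra|ring].
have c3 : h / 2 + h / 4 * (1 - p) + 2 * (h * p / 16) <= u (r0 * (p / 2) ^+ 4, 0).
  by apply: (le_trans _ (ltW f1)); move: (h); clear => k; lra.
have c4 : r0 * (p / 2) ^+ 4 < dl.
  by apply: (le_lt_trans r4); apply: le_lt_trans rdl; rewrite ler_peMl ?ler1n// ltW.
move=> /(_ c1 c2 f0 g0 c3 c4); apply/negP; rewrite -ltNge.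
have c0 : 0 < c by rewrite cE; clear; lra.
have k0 : 0 < (144 * 256)^-1 :> R by rewrite invr_gt0; clear; lra.
have P5 : 0 < r0 * p ^+ 5 / (144 * 256) by apply: mulr_gt0 k0; apply: mulr_gt0 => //; rewrite exprn_gt0.
rewrite (_ : h * p / 16 / 144 * _ = r0 * p ^+ 5 / (144 * 256) * h); last by move: (h); clear => k; field.
rewrite [ltLHS](_ : _ = r0 * p ^+ 5 / (144 * 256) * ((a * h + 2) * c * r0 * p)); last first.
  by rewrite cE; move: (h); clear => k; field.
rewrite ltr_pM2l//; move: {cE P5 k0} c0 ra => c0 ra.
have cr : 0 < c * r0 by rewrite mulr_gt0.
have ah : 0 <= a * h + 2 by rewrite addr_ge0// mulr_ge0// ltW.
rewrite -!mulrA; apply: (@le_lt_trans _ _ ((a + 2) * h * (c * r0))); last first.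
  by rewrite (_ : _ * _ * _ = h * ((a + 2) * c * r0)) ?gtr_pMr//; ring.
apply: (@le_trans _ _ ((a * h + 2) * (c * r0))).
  by apply: ler_wpM2l => //; rewrite mulrA ler_piMr// ltW.
by apply: ler_wpM2r; [exact: ltW|move: h1; move: (h); clear => k h1; lra].
Qed.

(** If h = u(0,0) were larger, [dyadic_step] would apply for all p = 2^-j, starting at
    r0 = 2m/h where the values are at most m/r0 = h/2; along r0 p^4 they would stay below 3h/4,
    against continuity at the vertex. *)
Lemma corner_bound u dl a m (c : R) (cE : c = 1024 * (144 * 256)) : corner u dl a -> 0 <= a -> 0 < m -> 0 < dl ->
  (forall t, 0 < t -> t < dl -> u (t, 0) <= m / t) ->
  (forall t, 0 < t -> t < dl -> u (0, t) <= m / t) ->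
  u (0, 0) <= 1 + 2 * c * m * (a + 2) + 256 * m / dl.
Proof.
move=> cu a0 m0 dl0 fm gm; set h := u (0, 0).
rewrite leNgt; apply/negP => hH.
have c0 : 0 < c by rewrite cE; clear; lra.
have A0 : 0 <= 2 * c * m * (a + 2).
  by rewrite mulr_ge0 ?mulr_ge0 ?addr_ge0 ?(ltW m0) ?(ltW c0).
have B0 : 0 <= 256 * m / dl by rewrite divr_ge0 ?mulr_ge0// ltW.
have h1 : 1 < h by move: hH A0 B0; clear; lra.
have hA : 2 * c * m * (a + 2) < h by move: hH A0 B0; clear; lra.
have hB : 256 * m / dl < h by move: hH A0 B0; clear; lra.
have h0 : 0 < h by apply: lt_trans h1.
have hn0 : h != 0 by rewrite gt_eqF.
pose r0 := 2 * m / h; have r00 : 0 < r0 by rewrite divr_gt0 ?mulr_gt0.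
have rdl : 128 * r0 < dl.
  by rewrite /r0 mulrA ltr_pdivrMr// -ltr_pdivrMl// mulrC (_ : 128 * (2 * m) = 256 * m)//; ring.
have r0dl : r0 < dl by apply: le_lt_trans rdl; rewrite ler_peMl ?ler1n// ltW.
have ra : (a + 2) * c * r0 < 1.
  rewrite /r0 mulrA ltr_pdivrMr// mul1r.
  by rewrite (_ : _ * _ = 2 * c * m * (a + 2))//; ring.
have mr : m / r0 = h / 2 by rewrite /r0; field; rewrite hn0 gt_eqF.
have cs := corner_swap cu.
have steps n (p := (2^-1 : R) ^+ n) : u (r0 * p ^+ 4, 0) <= h / 2 + h / 4 * (1 - p) /\
    u (0, r0 * p ^+ 4) <= h / 2 + h / 4 * (1 - p).
  rewrite /p {p}; elim: n => [|n [IHf IHg]].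
    by rewrite !expr0 expr1n mulr1 subrr mulr0 addr0 -mr; split; [exact: fm|exact: gm].
  have p0 : 0 < (2^-1 : R) ^+ n by rewrite exprn_gt0// invr_gt0.
  have p1 : (2^-1 : R) ^+ n <= 1 by rewrite exprn_ile1// ?invr_ge0// invf_le1// ler1n.
  have -> : (2^-1 : R) ^+ n.+1 = (2^-1 : R) ^+ n / 2 by rewrite exprSr.
  split; first exact: (dyadic_step cE cu a0 h1 r00 rdl ra p0 p1 IHf IHg).
  exact: (dyadic_step cE cs a0 h1 r00 rdl ra p0 p1 IHg IHf).
have C0 : cquad dl (0, 0) by split => //=; rewrite addr0.
have h8 : 0 < h / 8 by rewrite divr_gt0.
have /nbhs_ballP[r /= r_0 Br] := corner_cont cu C0 h8.
have [n nr] : exists n, r0 * (2^-1 : R) ^+ n < r.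
  have r0r : 0 <= r0 / r by rewrite divr_ge0 ?ltW.
  exists (Num.trunc (r0 / r)).+1.
  set n := (Num.trunc _).+1; have nlt : r0 / r < n%:R by exact: truncnS_gt.
  rewrite exprVn ltr_pdivrMr ?exprn_gt0// mulrC -ltr_pdivrMr//.
  apply: (lt_trans nlt); rewrite -natrX ltr_nat; exact: ltn_expl.
have [+ _] := steps n; set p := (2^-1 : R) ^+ n in nr *.
have p0 : 0 < p by rewrite exprn_gt0// invr_gt0.
have p1 : p <= 1 by rewrite exprn_ile1// ?invr_ge0// invf_le1// ler1n.
have p4 : p ^+ 4 <= p by rewrite -[leRHS]expr1 ler_wiXn2l// ltW.
have p40 : 0 < p ^+ 4 by rewrite exprn_gt0.
have rp : r0 * p ^+ 4 <= r0 * p by rewrite ler_pM2l.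
have rp1 : r0 * p <= r0 by rewrite ger_pMr.
have Cr : cquad dl (r0 * p ^+ 4, 0).
  split => //=; first by rewrite mulr_ge0 ?ltW.
  by rewrite addr0; apply: (le_lt_trans rp); exact: (le_lt_trans rp1 r0dl).
have : `|u (0, 0) - u (r0 * p ^+ 4, 0)| < h / 8.
  apply: Br => //; split; rewrite /ball /= sub0r normrN ?normr0//.
  by rewrite (gtr0_norm (mulr_gt0 r00 p40)); exact: (le_lt_trans rp nr).
rewrite -/h ltr_norml => /andP[_ k1] k2.
have : h / 4 * p > 0 by rewrite mulr_gt0// divr_gt0.
by move: k1 k2 h0; clear; lra.
Qed.

End Iteration.

(** * The polygon near a vertex *)

Section EdgeFunctional.
Context {R : realType}.
Variables (n : nat) (v : 'I_n -> R * R).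
Implicit Types (i j : 'I_n) (x y z : R * R).

(** A positive multiple of the distance to the line of the edge, signed. *)
Definition edge_fun i x : R := cross (edge_vec v i) (x - v i).

Lemma edge_fun_affine i x y z (a b c : R) : a + b + c = 1 ->
  edge_fun i (a * x.1 + b * y.1 + c * z.1, a * x.2 + b * y.2 + c * z.2) =
  a * edge_fun i x + b * edge_fun i y + c * edge_fun i z.
Proof.
move=> abc; have -> : c = 1 - a - b by rewrite -abc; ring.
by rewrite /edge_fun /cross /=; ring.
Qed.

Lemma edge_fun_src i : edge_fun i (v i) = 0.
Proof. by rewrite /edge_fun subrr /cross /= !mulr0 subrr. Qed.

Lemma edge_fun_tgt i : edge_fun i (v (ordS i)) = 0.
Proof. by rewrite /edge_fun /edge_vec /cross mulrC subrr. Qed.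

Lemma closed_edge_fun i q : closed_edge v i q -> edge_fun i q = 0.
Proof.
move=> [t _ <-]; have := @edge_fun_affine i (v (ordS i)) (v i) (v i) t (1 - t) 0.
rewrite edge_fun_src edge_fun_tgt !mulr0 !addr0 => <-; last by ring.
congr edge_fun; rewrite /edge_path /edge_vec.
by congr pair; rewrite /= /GRing.scale /=; ring.
Qed.

End EdgeFunctional.

Section PolygonCorner.
Context {R : realType}.
Variables (n : nat) (v : 'I_n -> R * R) (P : set (R * R)) (o : 'I_n) (l1 l2 : R).
Hypotheses (cP : convex_polygon v P) (vo : v o = (0, 0)) (l1_gt0 : 0 < l1) (l2_gt0 : 0 < l2).
Hypotheses (vs : v (ordS o) = (2 * l1, 0)) (vp : v (ord_pred o) = (0, 2 * l2)).
Implicit Types (i j : 'I_n) (x q : R * R).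
Let L := edge_fun v.
Let p := ord_pred o.

Lemma edge_fun_vertex i j : 0 <= L i (v j) /\ (L i (v j) = 0 -> j = i \/ j = ordS i).
Proof.
have [->|ji] := eqVneq j i; first by rewrite /L edge_fun_src; split => //; left.
have [->|js] := eqVneq j (ordS i); first by rewrite /L edge_fun_tgt; split => //; right.
by have Lp := polygon_ccw cP ji js; split; [exact: ltW|move/eqP; rewrite gt_eqF].
Qed.

Lemma ordS_neq : ordS o != o.
Proof.
apply/eqP => e; move: vs; rewrite e vo => -[]/eqP.
by rewrite eq_sym mulf_eq0 pnatr_eq0 /= gt_eqF.
Qed.

Lemma ord_pred_neq : p != o.
Proof.
apply/eqP => e; move: vp; rewrite -/p e vo => -[]/eqP.
by rewrite eq_sym mulf_eq0 pnatr_eq0 /= gt_eqF.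
Qed.

Lemma ordS_neq_pred : ordS o != p.
Proof.
apply/eqP => e; move: vs; rewrite e vp => -[]/eqP.
by rewrite eq_sym mulf_eq0 pnatr_eq0 /= gt_eqF.
Qed.

Lemma ordSp : ordS p = o. Proof. exact: ord_predK. Qed.

(** Barycentric coordinates with respect to the vertex at the origin and its two neighbours;
    the edge functionals are nonnegative at the vertices, so near the origin their sign can
    be read off from the coefficients. *)
Lemma edge_fun_quadrant i x : L i x =
  (1 - (x.1 / (2 * l1) + x.2 / (2 * l2))) * L i (v o) + x.1 / (2 * l1) * L i (v (ordS o))
    + x.2 / (2 * l2) * L i (v p).
Proof.
rewrite /L -edge_fun_affine; last by ring.
rewrite vo vs vp /= !mulr0 !add0r !addr0 !divfK ?gt_eqF ?mulr_gt0//; case: x.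
Qed.

Definition triangle : set (R * R) := [set x | [/\ 0 <= x.1, 0 <= x.2 & x.1 / (2 * l1) + x.2 / (2 * l2) < 1]].

(** All three barycentric coefficients are positive, and no edge contains three vertices. *)
Lemma triangle_in x : triangle x -> 0 < x.1 -> 0 < x.2 -> P x.
Proof.
move=> [_ _ x12] x1 x2; rewrite (polygonE cP) => i; change (0 < L i x).
have a0 : 0 < 1 - (x.1 / (2 * l1) + x.2 / (2 * l2)) by rewrite subr_gt0.
have b0 : 0 < x.1 / (2 * l1) by rewrite divr_gt0 ?mulr_gt0.
have c0 : 0 < x.2 / (2 * l2) by rewrite divr_gt0 ?mulr_gt0.
have [w0 w1] := edge_fun_vertex i o; have [s0 s1] := edge_fun_vertex i (ordS o).
have [p0 p1] := edge_fun_vertex i p.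
have ka : 0 <= (1 - (x.1 / (2 * l1) + x.2 / (2 * l2))) * L i (v o) by apply: mulr_ge0 => //; exact: ltW.
have kb : 0 <= x.1 / (2 * l1) * L i (v (ordS o)) by apply: mulr_ge0 => //; exact: ltW.
have kc : 0 <= x.2 / (2 * l2) * L i (v p) by apply: mulr_ge0 => //; exact: ltW.
rewrite lt_def (edge_fun_quadrant i x) !addr_ge0// andbT; apply/eqP => /eqP.
rewrite paddr_eq0 ?addr_ge0// paddr_eq0// !(mulf_eq0 _ (L _ _)) (gt_eqF a0) (gt_eqF b0) (gt_eqF c0) /=.
move=> /andP[/andP[/eqP/w1 e1 /eqP/s1 e2] /eqP/p1 e3].
have N1 := ordS_neq; have N2 := ord_pred_neq; have N3 := ordS_neq_pred.
by case: e1 e2 e3 N1 N2 N3 => e1 [] e2 [] e3; rewrite e3 e2 e1 ?eqxx.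
Qed.

(** Such an edge passes through both ends of the edge that contains (t,0). *)
Lemma edge_bottom i (t : R) : 0 < t -> t < 2 * l1 -> L i (t, 0) = 0 -> i = o.
Proof.
move=> t0 tl; rewrite edge_fun_quadrant /= mul0r addr0 mul0r addr0.
have l10 : 0 < 2 * l1 by rewrite mulr_gt0.
have a0 : 0 < 1 - t / (2 * l1) by rewrite subr_gt0 ltr_pdivrMr// mul1r.
have b0 : 0 < t / (2 * l1) by rewrite divr_gt0.
have [w0 w1] := edge_fun_vertex i o; have [s0 s1] := edge_fun_vertex i (ordS o).
have ka : 0 <= (1 - t / (2 * l1)) * L i (v o) by apply: mulr_ge0 => //; exact: ltW.
have kb : 0 <= t / (2 * l1) * L i (v (ordS o)) by apply: mulr_ge0 => //; exact: ltW.
move=> /eqP; rewrite paddr_eq0// !(mulf_eq0 _ (L _ _)) (gt_eqF a0) (gt_eqF b0) /=.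
move=> /andP[/eqP/w1 [//|e1] /eqP/s1 [e2|]].
  by move: ordS_neq_pred; rewrite e2 /p e1 ordSK eqxx.
by move=> /(can_inj (@ordSK n)).
Qed.

Lemma edge_left i (t : R) : 0 < t -> t < 2 * l2 -> L i (0, t) = 0 -> i = p.
Proof.
move=> t0 tl; rewrite edge_fun_quadrant /= mul0r add0r mul0r addr0.
have l10 : 0 < 2 * l2 by rewrite mulr_gt0.
have a0 : 0 < 1 - t / (2 * l2) by rewrite subr_gt0 ltr_pdivrMr// mul1r.
have b0 : 0 < t / (2 * l2) by rewrite divr_gt0.
have [w0 w1] := edge_fun_vertex i o; have [s0 s1] := edge_fun_vertex i p.
have ka : 0 <= (1 - t / (2 * l2)) * L i (v o) by apply: mulr_ge0 => //; exact: ltW.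
have kb : 0 <= t / (2 * l2) * L i (v p) by apply: mulr_ge0 => //; exact: ltW.
move=> /eqP; rewrite paddr_eq0// !(mulf_eq0 _ (L _ _)) (gt_eqF a0) (gt_eqF b0) /=.
move=> /andP[/eqP/w1 [e1|e1] /eqP/s1 [//|]].
  rewrite -e1 => e2; move: ordS_neq_pred; by rewrite e2 eqxx.
by move=> e2; move: ord_pred_neq; rewrite e2 -e1 eqxx.
Qed.

Lemma edge_origin i : L i (0, 0) = 0 -> i = o \/ i = p.
Proof.
rewrite -vo => /(edge_fun_vertex i o).2 [e|e]; [left|right] => //.
by rewrite /p e ordSK.
Qed.

Lemma edge_funo x : L o x = 2 * l1 * x.2.
Proof. by rewrite /L /edge_fun /edge_vec vo vs /cross /=; ring. Qed.

Lemma edge_funp x : L p x = 2 * l2 * x.1.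
Proof. by rewrite /L /edge_fun /edge_vec ordSp vo vp /cross /=; ring. Qed.

Lemma edge_patho (t : R) : edge_path v o t = (2 * l1 * t, 0).
Proof.
rewrite /edge_path /edge_vec vo vs; congr pair; rewrite /= /GRing.scale /=; ring.
Qed.

Lemma edge_pathp (t : R) : edge_path v p t = (0, 2 * l2 * (1 - t)).
Proof.
rewrite /edge_path /edge_vec ordSp vo vp; congr pair; rewrite /= /GRing.scale /=; ring.
Qed.

Lemma enormo : enorm (edge_vec v o) = 2 * l1.
Proof.
rewrite /enorm /edge_vec vo vs /= !subr0 expr0n /= addr0 sqrtr_sqr ger0_norm//.
by rewrite mulr_ge0// ltW.
Qed.

Lemma enormp : enorm (edge_vec v p) = 2 * l2.
Proof.
rewrite /enorm /edge_vec ordSp vo vp /= !sub0r oppr0 expr0n /= add0r sqrtr_sqr normrN ger0_norm//.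
by rewrite mulr_ge0// ltW.
Qed.

Lemma triangle_closure x : triangle x -> closure P x.
Proof.
move=> [x1 x2 x12] B /nbhs_ballP[r /= r0 rB].
have l10 : 0 < 2 * l1 by rewrite mulr_gt0.
have l20 : 0 < 2 * l2 by rewrite mulr_gt0.
pose k := (2 * l1)^-1 + (2 * l2)^-1; have k0 : 0 < k by rewrite addr_gt0 ?invr_gt0.
pose g := 1 - (x.1 / (2 * l1) + x.2 / (2 * l2)); have g0 : 0 < g by rewrite subr_gt0.
near ((0:R)^'+) => e.
have e0 : 0 < e by near: e; exact: nbhs_right_gt.
have er : e < r by near: e; exact: nbhs_right_lt.
have eg : e < g / k by near: e; apply: nbhs_right_lt; rewrite divr_gt0.
have ek : e * k < g by rewrite -ltr_pdivlMr.
have y1 : 0 < x.1 + e by rewrite ltr_wpDl.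
have y2 : 0 < x.2 + e by rewrite ltr_wpDl.
exists (x.1 + e, x.2 + e); split; last first.
  apply: rB; split; rewrite /ball /= opprD addrA subrr sub0r normrN gtr0_norm//.
apply: triangle_in => //; split => /=; [exact: ltW|exact: ltW|].
by move: ek; rewrite /g /k !mulrDl mulrDr; move: (x.1 / _) (x.2 / _) (e / _) (e / _) => A1 A2 A3 A4; lra.
Unshelve. all: by end_near. Qed.

Lemma bottom_notin (t : R) : ~ P (t, 0).
Proof. by rewrite (polygonE cP) => /(_ o) h; have : 0 < L o (t, 0) := h; rewrite edge_funo mulr0 ltxx. Qed.

Lemma left_notin (t : R) : ~ P (0, t).
Proof. by rewrite (polygonE cP) => /(_ p) h; have : 0 < L p (0, t) := h; rewrite edge_funp mulr0 ltxx. Qed.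

Lemma closed_edge_bottom i (t : R) : 0 < t -> t < 2 * l1 -> `[< closed_edge v i (t, 0) >] = (i == o).
Proof.
move=> t0 tl; have l10 : 0 < 2 * l1 by rewrite mulr_gt0.
apply/idP/eqP => [/asboolP/closed_edge_fun/edge_bottom -> //|->].
apply/asboolP; exists (t / (2 * l1)); last by rewrite edge_patho mulrC divfK// gt_eqF.
by rewrite /= in_itv /= divr_ge0 ?(ltW t0) ?(ltW l10)//= ler_pdivrMr// mul1r ltW.
Qed.

Lemma closed_edge_left i (t : R) : 0 < t -> t < 2 * l2 -> `[< closed_edge v i (0, t) >] = (i == p).
Proof.
move=> t0 tl; have l20 : 0 < 2 * l2 by rewrite mulr_gt0.
apply/idP/eqP => [/asboolP/closed_edge_fun/edge_left -> //|->].
have tl1 : t / (2 * l2) <= 1 by rewrite ler_pdivrMr// mul1r ltW.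
have tl0 : 0 <= t / (2 * l2) by rewrite divr_ge0// ltW.
apply/asboolP; exists (1 - t / (2 * l2)).
  by rewrite /= in_itv /= subr_ge0 tl1 gerBl.
by rewrite edge_pathp opprB addrC subrK mulrC divfK// gt_eqF.
Qed.

Lemma closed_edge_origin i : `[< closed_edge v i (0, 0) >] = (i == o) || (i == p).
Proof.
apply/idP/idP => [/asboolP/closed_edge_fun/edge_origin [->|->]|/orP[]/eqP->]; rewrite ?eqxx ?orbT//.
  by apply/asboolP; exists 0; rewrite ?edge_patho ?mulr0//= in_itv /= lexx ler01.
by apply/asboolP; exists 1; rewrite ?edge_pathp ?subrr ?mulr0//= in_itv /= lexx ler01.
Qed.

Lemma edge_lambdao (s : 'I_n -> R) x : s o = 1 -> edge_lambda v s o x = x.2.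
Proof.
move=> so; rewrite /edge_lambda so divr1 enormo; have -> : cross (edge_vec v o) (x - v o) = L o x by [].
rewrite edge_funo.
by rewrite mulrC mulKf// mulf_neq0// gt_eqF.
Qed.

Lemma edge_lambdap (s : 'I_n -> R) x : s p = 1 -> edge_lambda v s p x = x.1.
Proof.
move=> so; rewrite /edge_lambda so divr1 enormp; have -> : cross (edge_vec v p) (x - v p) = L p x by [].
rewrite edge_funp.
by rewrite mulrC mulKf// mulf_neq0// gt_eqF.
Qed.

End PolygonCorner.

(** * Regularity along the edges *)

Section EdgeRegularity.
Context {R : realType}.
Implicit Types (u f g : R * R -> R) (dl t : R) (D V : set (R * R)).

Lemma extends_swap D f q : extends_smoothly_at D f q ->
  extends_smoothly_at (fun x => D (swap x)) (f \o swap) (swap q).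
Proof.
move=> [V [g [[oV Vq] sg gf]]]; exists (swap @^-1` V), (g \o swap); split.
- by split; [exact: open_swap|rewrite /= swapK].
- exact: smooth_swap.
- by move=> x Vx Dx; exact: gf.
Qed.

Lemma extends_sub D D' f q : D' `<=` D -> extends_smoothly_at D f q -> extends_smoothly_at D' f q.
Proof. by move=> DD [V [g [oV sg gf]]]; exists V, g; split => // x Vx /DD; exact: gf. Qed.

Lemma edge_reg_vertex u dl :
  extends_smoothly_at (quad dl) (fun x => u x - (xlnx x.1 + xlnx x.2)) (0, 0) -> edge_reg u dl 0.
Proof.
move=> [V [g [oV sg gf]]]; exists V, g, 1; split => //; last by rewrite mul0r addr0.
by move=> x Vx Qx; rewrite (gf x Vx Qx) mul1r; ring.
Qed.

Lemma xlnx_sqr_bound (r : R) : 0 < r -> r < 1 -> `|xlnx (r ^+ 2)| <= 2 * r.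
Proof.
move=> r0 r1; rewrite /xlnx lnXn// normrM gtr0_norm ?exprn_gt0// normrMn.
have l0 : ln r < 0 by apply: ln_lt0; rewrite r0.
rewrite ltr0_norm//.
have := ln_sublinear (x := r^-1); rewrite invr_gt0 r0 lnV ?posrE// => /(_ isT) h.
have : r ^+ 2 * - ln r <= r ^+ 2 * r^-1 by apply: ler_wpM2l; [exact: sqr_ge0|exact: ltW].
have -> : r ^+ 2 * r^-1 = r by rewrite expr2 mulfK// gt_eqF.
by rewrite mulrnAr mulr2n; move: (r ^+ 2 * _) => k; lra.
Qed.

(** Approach the edge point along y fixed, second coordinate d^2 with d tending to 0: there
    the logarithmic term is at most 2d in absolute value. *)
Lemma edge_trace u dl V g (y : R) : open V -> smooth_in V g ->
  (forall x, V x -> quad dl x -> u x = xlnx x.2 + g x) -> V (y, 0) -> 0 < y -> y < dl ->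
  (forall e, 0 < e -> \forall z \near ((y, 0) : R * R), cquad dl z -> `|u (y, 0) - u z| < e) ->
  u (y, 0) = g (y, 0).
Proof.
move=> oV sg uE Vy y0 yd cu; apply/eqP; rewrite -subr_eq0 -normr_le0; apply/ler_addgt0Pr => e e0; rewrite add0r.
have e4 : 0 < e / 4 by rewrite divr_gt0.
have cg := smooth_cont sg Vy; move/cvgrPdist_lt : cg => /(_ _ e4) ng.
have nV : \forall z \near ((y, 0) : R * R), V z by exact: open_nbhs_nbhs.
have /nbhs_ballP[r /= r0 rB] : \forall z \near ((y, 0) : R * R),
   [/\ V z, `|g (y, 0) - g z| < e / 4 & cquad dl z -> `|u (y, 0) - u z| < e / 4].
  by near=> z; split; near: z => //; exact: cu.
near ((0:R)^'+) => d.
have d0 : 0 < d by near: d; exact: nbhs_right_gt.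
have d1 : d < 1 by near: d; apply: nbhs_right_lt.
have dr : d < r by near: d; apply: nbhs_right_lt.
have de : d < e / 8 by near: d; apply: nbhs_right_lt; rewrite divr_gt0.
have ddl : d < dl - y by near: d; apply: nbhs_right_lt; rewrite subr_gt0.
have dd0 : 0 < d ^+ 2 by rewrite exprn_gt0.
have ddd : d ^+ 2 <= d by rewrite expr2 ger_pMr// ltW.
have Qz : quad dl (y, d ^+ 2) by split => //=; move: ddl ddd; lra.
have Bz : ball ((y, 0) : R * R) r (y, d ^+ 2).
  split; rewrite /ball /= ?subrr ?normr0// sub0r normrN gtr0_norm//.
  exact: le_lt_trans dr.
have [Vz g4 /(_ (quadW Qz)) u4] := rB _ Bz.
have x8 := xlnx_sqr_bound d0 d1.
move: g4 u4 x8; rewrite (uE _ Vz Qz) /= ler_norml.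
move: (u (y, 0)) (g (y, 0)) (g (y, _)) (xlnx _) => A1 A2 A3 A4.
rewrite !ltr_norml => /andP[b1 b2] /andP[b3 b4] /andP[b5 b6].
by rewrite ler_norml; apply/andP; split; move: b1 b2 b3 b4 b5 b6 de; clear; lra.
Unshelve. all: by end_near. Qed.

(** On the edge u agrees with the smooth part g by [edge_trace], so the second derivative
    of u along an affine parametrization of the edge is k^2 times that of g. *)
Lemma edge_reg_interior u dl t (k b tau : R) : 0 < t -> t < dl ->
  (forall y, 0 < y -> y < dl -> forall e, 0 < e ->
    \forall z \near ((y, 0) : R * R), cquad dl z -> `|u (y, 0) - u z| < e) ->
  extends_smoothly_at (quad dl) (fun x => u x - xlnx x.2) (t, 0) ->
  k * tau + b = t -> 0 < derive1n 2 (fun s => u (k * s + b, 0)) tau -> edge_reg u dl t.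
Proof.
move=> t0 td cu [V [g [[oV Vt] sg gf]]] kt d2; exists V, g, 0; split => //.
  by move=> x Vx Qx; rewrite (gf x Vx Qx) mul0r; ring.
rewrite add0r mulr_gt0//.
have uE x : V x -> quad dl x -> u x = xlnx x.2 + g x.
  by move=> Vx Qx; rewrite (gf x Vx Qx); ring.
have sg1 := smooth_pd 0 sg.
have dline (f : R * R -> R) (s : R) : smooth_in V f -> V (k * s + b, 0) ->
    is_derive s 1 (fun s => f (k * s + b, 0)) (k * pd 0 f (k * s + b, 0)).
  move=> sf Vs; have := @is_derive_line_pd R f (b, 0) (k, 0) s.
  rewrite /= !mulr0 !mul0r !addr0.
  have e s' : b + s' * k = k * s' + b by ring.
  have -> : (fun t => f (b + t * k, 0 + t * 0)) = (fun s => f (k * s + b, 0)).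
    by apply/funext => s'; rewrite e mulr0 addr0.
  by rewrite e; apply; exact: smooth_diff Vs.
have c1 : {for tau, continuous (fun s : R => k * s + b)}.
  by apply: cvgD; [apply: cvgM; [exact: cvg_cst|exact: cvg_id]|exact: cvg_cst].
have cl : {for tau, continuous (fun s : R => (k * s + b, 0 : R))}.
  exact: (cvg_pair c1 (@cvg_cst _ (0 : R) _ _ _)).
have nV : \forall s \near tau, [/\ V (k * s + b, 0), 0 < k * s + b & k * s + b < dl].
  have n1 : \forall s \near tau, V (k * s + b, 0).
    by apply: cl; rewrite kt; exact: open_nbhs_nbhs.
  have n2 : \forall s \near tau, 0 < k * s + b by apply: (cvgr_gt _ c1); rewrite kt.
  have n3 : \forall s \near tau, k * s + b < dl by apply: (cvgr_lt _ c1); rewrite kt.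
  by near=> s; split; near: s.
have n0 : \forall s \near tau, u (k * s + b, 0) = g (k * s + b, 0).
  by apply: filterS nV => s [Vs s0 sd]; apply: (edge_trace oV sg uE Vs s0 sd); exact: cu.
have n1 : \forall s \near tau, derive1 (fun s => u (k * s + b, 0)) s = k * pd 0 g (k * s + b, 0).
  have := near_join n0; apply: filterS2 nV => s [Vs _ _] Es.
  rewrite derive1E (near_eq_derive _ Es).
  by have [_ ->] := dline g s sg Vs.
have Vk : V (k * tau + b, 0) by rewrite kt.
move: d2; rewrite /derive1n /= derive1E (near_eq_derive _ n1).
have [_ ->] := is_derive_mul (is_derive_const k tau) (dline _ tau sg1 Vk).
rewrite mul0r add0r mulrA -expr2 kt => d2.
rewrite ltNge; apply/negP => h0; move: d2; rewrite ltNge; apply/negP; rewrite negbK.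
by rewrite mulr_ge0_le0 ?sqr_ge0.
Unshelve. all: by end_near. Qed.

End EdgeRegularity.

(** * The supremum norm and integrals over edges *)

Section SupNorm.
Context {R : realType}.
Local Notation mu2 := (@lebesgue_measure R \x @lebesgue_measure R)%E.
Implicit Types (P : set (R * R)) (x : R * R).

Lemma ball_rect x (r : R) :
  ball x r = `]x.1 - r, x.1 + r[%classic `*` `]x.2 - r, x.2 + r[%classic.
Proof.
by rewrite -!ball_itv; apply/seteqP; split => y [].
Qed.

Lemma measurable_ball2 x (r : R) : measurable (ball x r).
Proof. by rewrite ball_rect; apply: measurableX. Qed.

Lemma ball2_gt0 x (r : R) : 0 < r -> (0 < mu2 (ball x r))%E.
Proof.
move=> r0; rewrite ball_rect product_measure1E//.
have E (a : R) : lebesgue_measure `]a - r, a + r[%classic = (r + r)%:E.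
  rewrite lebesgue_measure_itv /= lte_fin ltrD2l gtrN// -EFinD; congr (_%:E); ring.
by apply: mule_gt0; rewrite [X in (_ < X)%E]E lte_fin addr_gt0.
Qed.

(** Squares have positive measure. *)
Lemma ae_nbhs (Q : R * R -> Prop) x (B : set (R * R)) : {ae mu2, forall y, Q y} ->
  nbhs x B -> exists2 y, B y & Q y.
Proof.
move=> [N [mN N0 QN]] /nbhs_ballP[r /= r0 rB].
apply: contrapT => nex; have BN : ball x r `<=` N.
  by move=> y yB; apply: QN => Qy; apply: nex; exists y => //; exact: rB.
have := ball2_gt0 x r0; rewrite ltNge => /negP; apply; rewrite -N0.
by apply: le_measure => //; rewrite inE//; exact: measurable_ball2.
Qed.

Lemma plane_gt0 : (0 < mu2 [set: R * R])%E.
Proof.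
apply: lt_le_trans (ball2_gt0 (0, 0) ltr01) _.
by apply: le_measure => //; rewrite inE//; exact: measurable_ball2.
Qed.

Lemma bounded_compact_closure P : bounded_set P -> compact (closure P).
Proof.
move=> [M [_ /(_ (M + 1))]]; rewrite ltrDl => /(_ ltr01) PM.
have PB : P `<=` `[- (M + 1), M + 1]%classic `*` `[- (M + 1), M + 1]%classic.
  move=> x /PM h; have : Num.max `|x.1| `|x.2| <= M + 1 by exact: h.
  rewrite ge_max => /andP[h1 h2].
  by split => /=; rewrite in_itv /= -ler_norml.
have cB : compact (`[- (M + 1), M + 1]%classic `*` `[- (M + 1), M + 1]%classic : set (R * R)).
  by apply: compact_setX; exact: segment_compact.
apply: (subclosed_compact _ cB); first exact: closed_closure.
have /closure_id -> := compact_closed (@norm_hausdorff _ _) cB.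
by move=> x; apply: closureS.
Qed.

Lemma smooth_on_bounded P (A : R * R -> R) : bounded_set P -> smooth_on (closure P) A ->
  exists M, forall x, P x -> `|A x| <= M.
Proof.
move=> /bounded_compact_closure/compact_near_coveringP cP sA.
have /(_ _ +oo (fun M y => P y -> `|A y| <= M)) := cP.
have ok x : closure P x -> \forall x' \near x & M \near +oo, P x' -> `|A x'| <= M.
  move=> /[dup] Cx /sA[V [g [[oV Vx] sg gA]]].
  have nb := near_bounded (smooth_cont sg Vx).
  exists ([set y | V y /\ `|g y| <= `|g x| + 1], [set M | `|g x| + 1 <= M]) => /=.
    split; last exact: nbhs_pinfty_ge.
    by apply: filterI => //; exact: open_nbhs_nbhs.
  move=> [y M] /= [[Vy gy] xM] Py.
  by rewrite -(gA y Vy (subset_closure Py)); exact: le_trans xM.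
move=> /(_ _ ok) nM; near (+oo : set_system R) => M; exists M => x Px.
have : closure P `<=` (fun y => P y -> `|A y| <= M) by near: M.
by apply => //; exact: subset_closure.
Unshelve. all: by end_near. Qed.

(** The essential supremum bounds the values of the function at points arbitrarily near
    x, and the function is continuous there.  Boundedness makes the norm finite; otherwise its
    real value would say nothing. *)
Lemma Linfty_normP P (A : R * R -> R) x : nbhs x P -> bounded_set P ->
  smooth_on (closure P) A -> `|A x| <= Linfty_norm P A.
Proof.
move=> nP bP sA; have Px := nbhs_singleton nP; have [M AM] := smooth_on_bounded bP sA.
rewrite /Linfty_norm unlock /Lnorm plane_gt0.
set f := (abse \o _); set L := ess_sup _ _.
have LM : (L <= (Num.max M 0)%:E)%E.
  apply/ess_supP; apply: nearW => y; rewrite /f /= lee_fin.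
  rewrite indicE; have [Py|Py] := pselect (P y).
    by rewrite mem_set// mulr1 le_max AM.
  by rewrite memNset// mulr0 normr0 le_max lexx orbT.
have low e : 0 < e -> ((`|A x| - e)%:E <= L)%E.
  move=> e0; have [V [g [[oV Vx] sg gA]]] := sA x (subset_closure Px).
  have /cvgrPdist_lt/(_ e e0) ng := smooth_cont sg Vx.
  have nB : \forall y \near x, [/\ V y, P y & `|g x - g y| < e].
    by near=> y; split; near: y => //; exact: open_nbhs_nbhs.
  have [y [Vy Py gy] yL] := ae_nbhs (ess_sup_ge _ f) nB.
  apply: le_trans yL; rewrite /f /= lee_fin indicE mem_set// mulr1.
  rewrite -(gA y Vy (subset_closure Py)) -(gA x Vx (subset_closure Px)).
  rewrite lerBlDl -lerBlDr; apply: le_trans (ltW gy); exact: lerB_dist.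
have Lf : L \is a fin_num.
  rewrite fin_numElt (lt_le_trans _ (low 1 ltr01)) ?ltNyr//=.
  exact: le_lt_trans LM (ltry _).
apply/ler_addgt0Pr => e e0; rewrite -lerBlDr -lee_fin fineK//; exact: low.
Unshelve. all: by end_near. Qed.

End SupNorm.

Section EdgeIntegral.
Context {R : realType}.
Implicit Types (f : R -> R).

Lemma Rintegral_ge_const f (a b c : R) : {within `[0, 1], continuous f} ->
  (forall t, 0 <= t <= 1 -> 0 <= f t) -> 0 <= a -> a <= b -> b <= 1 ->
  (forall t, a <= t <= b -> c <= f t) ->
  c * (b - a) <= \int[lebesgue_measure]_(t in `[0, 1]) f t.
Proof.
move=> cf f0 a0 ab b1 cf'.
have iF : lebesgue_measure.-integrable `[0, 1] (EFin \o f).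
  by apply: continuous_compact_integrable => //; exact: segment_compact.
have S : `[a, b]%classic `<=` `[0, 1]%classic.
  move=> t /=; rewrite !in_itv /= => /andP[h1 h2].
  by rewrite (le_trans a0 h1) (le_trans h2 b1).
have iF' : lebesgue_measure.-integrable `[a, b] (EFin \o f).
  by apply: continuous_compact_integrable; [exact: segment_compact|exact: continuous_subspaceW cf].
have -> : c * (b - a) = \int[lebesgue_measure]_(t in `[a, b]) c.
  rewrite Rintegral_cst//; congr (c * _).
  rewrite [X in fine X](lebesgue_measure_itv `[a, b]) /= lte_fin.
  by move: ab; rewrite le_eqVlt => /orP[/eqP->|->//]; rewrite ltxx subrr.
apply: (@le_trans _ _ (\int[lebesgue_measure]_(t in `[a, b]) f t)).
  have ic : lebesgue_measure.-integrable `[a, b] (EFin \o (fun=> c : R)).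
    by apply: continuous_compact_integrable; [exact: segment_compact|move=> x; exact: cvg_cst].
  by apply: le_Rintegral => // t /=; rewrite in_itv /= => /cf'.
rewrite /Rintegral fine_le//; [exact: integrable_fin_num|exact: integrable_fin_num|].
apply: ge0_subset_integral => //.
  by case/integrableP : iF.
Qed.

End EdgeIntegral.

(** * The inverse Hessian as a matrix; convex functions of one variable *)

Section Abreu.
Context {R : realType}.
Implicit Types (u : R * R -> R) (dl : R) (M : 'M[R]_2).

Lemma posdef2_form M (a b : R) : posdef2 M -> (a != 0) || (b != 0) ->
  0 < a * a * M 0 0 + a * b * (M 0 1 + M 1 0) + b * b * M 1 1.
Proof.
move=> pM ab; pose w : 'rV[R]_2 := \row_j (if j == 0 then a else b).
have w0 : w != 0.
  apply/eqP => /rowP w0; move: (w0 0) (w0 1) ab; rewrite !mxE /= => -> ->.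
  by rewrite eqxx.
have := pM w w0; rewrite !mxE !big_ord_recl !big_ord0 !mxE !big_ord_recl !big_ord0 !mxE /=.
have -> : lift ord0 ord0 = 1 :> 'I_2 by apply/val_inj.
have -> : ord0 = 0 :> 'I_2 by apply/val_inj.
rewrite /=; move: (M 0 0) (M 0 1) (M 1 0) (M 1 1) => A B C D.
by rewrite (_ : _ + _ = a * a * A + a * b * (B + C) + b * b * D)//; ring.
Qed.

Lemma sum22 (G : 'I_2 -> 'I_2 -> R) :
  \sum_(i < 2) \sum_(j < 2) G i j = G 0 0 + G 0 1 + (G 1 0 + G 1 1).
Proof.
rewrite !big_ord_recl !big_ord0 !addr0.
have -> : lift ord0 ord0 = 1 :> 'I_2 by apply/val_inj.
by have -> : ord0 = 0 :> 'I_2 by apply/val_inj.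
Qed.

Lemma hessian00 u x : hessian u x 0 0 = H11 u x.
Proof. by rewrite mxE /H11 !pdE. Qed.
Lemma hessian01 u x : hessian u x 0 1 = H12 u x.
Proof. by rewrite mxE /H12 !pdE. Qed.
Lemma hessian11 u x : hessian u x 1 1 = H22 u x.
Proof. by rewrite mxE /H22 !pdE. Qed.

Lemma hessian10 u dl x : smooth_in (quad dl) u -> quad dl x -> hessian u x 1 0 = H12 u x.
Proof. by move=> su Qx; rewrite -(schwarz_u su Qx) mxE !pdE. Qed.

(** The second inequality is positivity on the vector (- u_12, u_11), where the form equals
    u_11 det D^2u. *)
Lemma posdef2_pos u dl x : smooth_in (quad dl) u -> quad dl x -> posdef2 (hessian u x) ->
  0 < H11 u x /\ 0 < hdet u x.
Proof.
move=> su Qx pM.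
have h1 : 0 < H11 u x.
  have := @posdef2_form _ 1 0 pM; rewrite oner_neq0 hessian00 => /(_ isT).
  by rewrite !mulr0 !mul0r !addr0 !mul1r.
split=> //; have := @posdef2_form _ (- H12 u x) (H11 u x) pM.
rewrite (gt_eqF h1) orbT hessian00 hessian01 (hessian10 su Qx) hessian11 => /(_ isT).
rewrite hdetE; move: h1; move: (H11 u x) (H12 u x) (H22 u x) => A B C A0.
by rewrite (_ : _ + _ = A * (A * C - B * B)) ?pmulr_rgt0//; ring.
Qed.

Section OnQuad.
Variables (u : R * R -> R) (dl : R).
Hypotheses (su : smooth_in (quad dl) u) (pu : forall x, quad dl x -> 0 < H11 u x /\ 0 < hdet u x).
Let oQ := @open_quad R dl.

(** Cramer's rule. *)
Definition inv_hessian x : 'M[R]_2 := \matrix_(i, j)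
  (if i == 0 then if j == 0 then m11 u x else m12 u x else if j == 0 then m12 u x else m22 u x).

Lemma invmx_hessian x : quad dl x -> invmx (hessian u x) = inv_hessian x.
Proof.
move=> Qx; have [_ d0] := pu Qx.
suff E : hessian u x *m inv_hessian x = 1%:M.
  have [ux _] := mulmx1_unit E.
  by rewrite -[LHS]mulmx1 -E mulmxA mulVmx// mul1mx.
have d0' : hdet u x != 0 by rewrite gt_eqF.
have e1 : lift ord0 ord0 = 1 :> 'I_2 by apply/val_inj.
have e0 : ord0 = 0 :> 'I_2 by apply/val_inj.
apply/matrixP => i j; rewrite !mxE !big_ord_recl big_ord0 addr0 e1 e0.
have h0 := hessian00 u x; have h1 := hessian01 u x; have h2 := hessian10 su Qx.
have h3 := hessian11 u x.
have [->|->] := ord2P i; have [->|->] := ord2P j;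
  rewrite ?h0 ?h1 ?h2 ?h3 !mxE /= ?m11E ?m12E ?m22E; move: d0'; rewrite hdetE;
  move: (H11 u x) (H12 u x) (H22 u x) => A B C k0; field; exact: k0.
Qed.

Lemma abreuE x : quad dl x -> abreu u x = pd 0 (V1 u) x + pd 1 (V2 u) x.
Proof.
move=> Qx.
have E i j (F : R * R -> R) : (forall y, quad dl y -> inv_hessian y i j = F y) ->
    partial i (partial j (fun y => invmx (hessian u y) i j)) x = pd i (pd j F) x.
  move=> EF; rewrite !pdE; apply: (partial_eq (V := quad dl)) => // y Qy.
  by apply: (partial_eq (V := quad dl)) => // z Qz; rewrite invmx_hessian// EF.
have E00 := E 0 0 (m11 u) (fun y _ => mxE _ _ _ _).
have E01 := E 0 1 (m12 u) (fun y _ => mxE _ _ _ _).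
have E10 := E 1 0 (m12 u) (fun y _ => mxE _ _ _ _).
have E11 := E 1 1 (m22 u) (fun y _ => mxE _ _ _ _).
rewrite (pdD 0 (smooth_diff (smooth_pd 0 (smooth_m11 su pu)) Qx) (smooth_diff (smooth_pd 1 (smooth_m12 su pu)) Qx)).
rewrite (pdD 1 (smooth_diff (smooth_pd 0 (smooth_m12 su pu)) Qx) (smooth_diff (smooth_pd 1 (smooth_m22 su pu)) Qx)).
rewrite -E00 -E01 -E10 -E11 /abreu.
exact: (sum22 (fun i j => partial i (partial j (fun y => invmx (hessian u y) i j)) x)).
Qed.

End OnQuad.
End Abreu.

Section Chord.
Context {R : realType}.

(** To the left of l the function takes values larger than f(l) at points close to l;
    by convexity, f(s) >= f(l) for every s < l, and the chord from s to l lies below f(s). *)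
Lemma convex_antitone (f : R -> R) (l : R) :
  (forall x y t, 0 <= x <= l -> 0 <= y <= l -> 0 <= t <= 1 ->
     f (t * x + (1 - t) * y) <= t * f x + (1 - t) * f y) ->
  derivable f l 1 -> 'D_1 f l < 0 -> forall s t, 0 <= s -> s <= t -> t < l -> f t <= f s.
Proof.
move=> cf df f'0 s t s0 st tl.
have sl : s < l by exact: le_lt_trans tl.
have l0 : 0 <= l by apply: le_trans (ltW sl).
have smooth_icpt : 0 <= s <= l by rewrite s0 ltW.
have lI : 0 <= l <= l by rewrite l0 lexx.
have chord (y : R) : s <= y -> y <= l -> exists2 w : R, 0 <= w <= 1 /\ w * (l - s) = l - y & f y <= w * f s + (1 - w) * f l.
  move=> sy yl; have ls : 0 < l - s by rewrite subr_gt0.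
  pose w := (l - y) / (l - s).
  have wI : 0 <= w <= 1.
    by rewrite divr_ge0 ?subr_ge0 ?(ltW sl)//= ler_pdivrMr// mul1r lerD2l lerN2.
  have wE : w * (l - s) = l - y by rewrite divfK// gt_eqF.
  exists w => //; have := cf s l w smooth_icpt lI wI.
  by rewrite (_ : w * s + _ = y)//; move: wE; lra.
have fl : f l <= f s.
  have dn : h^-1 *: (f (h *: 1 + l) - f l) @[h --> (0:R)^'] --> 'D_1 f l by exact: df.
  have dl' := cvg_dnbhs_at_left dn.
  have nl : \forall h \near (0:R)^'-, h^-1 *: (f (h *: 1 + l) - f l) < 0.
    exact: (cvgr_lt _ dl').
  near ((0:R)^'-) => h.
  have h0 : h < 0 by near: h; exact: nbhs_left_lt.
  have hs : s - l < h by near: h; apply: nbhs_left_gt; rewrite subr_lt0.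
  have : h^-1 *: (f (h *: 1 + l) - f l) < 0 by near: h.
  rewrite /GRing.scale /= mulr1 nmulr_rlt0 ?invr_lt0// subr_gt0 => fh.
  have [||w [/andP[w0 w1] wE] fw] := chord (h + l); first by move: hs; lra.
    by move: h0; lra.
  rewrite leNgt; apply/negP => fls.
  have : w * f s <= w * f l by apply: ler_wpM2l => //; exact: ltW.
  by move: fh fw; lra.
have [w [/andP[w0 w1] _] fw] := chord t st (ltW tl).
apply: (le_trans fw).
have : (1 - w) * f l <= (1 - w) * f s by apply: ler_wpM2l => //; rewrite subr_ge0.
by lra.
Unshelve. all: by end_near. Qed.

End Chord.

(** * The value at the vertex *)

Section GuilleminCorner.
Context {R : realType}.
Variables (n : nat) (v : 'I_n -> R * R) (P : set (R * R)) (o : 'I_n) (l1 l2 : R).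
Hypotheses (cP : convex_polygon v P) (vo : v o = (0, 0)) (l1_gt0 : 0 < l1) (l2_gt0 : 0 < l2).
Hypotheses (vs : v (ordS o) = (2 * l1, 0)) (vp : v (ord_pred o) = (0, 2 * l2)).
Variables (s : 'I_n -> R) (A u : R * R -> R).
Hypotheses (s_gt0 : forall i, 0 < s i) (so : s o = 1) (sp : s (ord_pred o) = 1).
Hypotheses (sA : smooth_on (closure P) A) (gu : guillemin v s P u).
Hypotheses (abu : forall x, P x -> abreu u x = - A x).
Hypotheses (du1 : derive1 (fun t : R => u (t, 0)) l1 = -1).
Hypotheses (du2 : derive1 (fun t : R => u (0, t)) l2 = -1).
Hypotheses (Pne : exists2 x, P x & u x = 0) (u_ge0 : forall x, P x -> 0 <= u x).
Let dl := Num.min l1 l2.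
Let p := ord_pred o.
Let tri := triangle_closure cP vo l1_gt0 l2_gt0 vs vp.

Lemma dl_gt0 : 0 < dl. Proof. by rewrite /dl lt_min l1_gt0. Qed.
Lemma dl_le1 : dl <= l1. Proof. by rewrite /dl ge_min lexx. Qed.
Lemma dl_le2 : dl <= l2. Proof. by rewrite /dl ge_min lexx orbT. Qed.

Lemma cquad_triangle x : cquad dl x -> triangle l1 l2 x.
Proof.
move=> [x1 x2 xd]; split => //.
have h1 : x.1 / (2 * l1) < 1 / 2.
  by rewrite ltr_pdivrMr ?mulr_gt0//; move: dl_le1 l1_gt0 => k1 k2; lra.
have h2 : x.2 / (2 * l2) < 1 / 2.
  by rewrite ltr_pdivrMr ?mulr_gt0//; move: dl_le2 l2_gt0 => k1 k2; lra.
by move: h1 h2; lra.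
Qed.

Lemma cquad_closure x : cquad dl x -> closure P x.
Proof. by move=> /cquad_triangle/tri. Qed.

Lemma quad_in x : quad dl x -> P x.
Proof.
move=> Qx; have [x1 x2 _] := Qx.
exact: (triangle_in cP vo l1_gt0 l2_gt0 vs vp (cquad_triangle (quadW Qx))).
Qed.

Lemma continuous_near x e : closure P x -> 0 < e ->
  \forall z \near x, closure P z -> `|u x - u z| < e.
Proof.
move=> Cx e0; have /subspace_continuousP/(_ x Cx) := guillemin_continuous gu.
by move=> /cvgrPdist_lt/(_ e e0).
Qed.

Lemma closure_ge0 x : closure P x -> 0 <= u x.
Proof.
move=> Cx; rewrite leNgt; apply/negP => ux.
have ux0 : 0 < - u x by rewrite oppr_gt0.
have [y [Py]] := Cx _ (continuous_near Cx ux0).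
move=> /(_ (subset_closure Py)); have := u_ge0 Py.
by rewrite ltr_norml => ? /andP[]; lra.
Qed.

(** The edge functionals are nonnegative on the edges and positive at an interior point;
    move slightly towards the latter. *)
Lemma edge_closure i (t : R) : 0 <= t <= 1 -> closure P (edge_path v i t).
Proof.
move=> /andP[t0 t1]; have [x0 Px0 _] := Pne.
set q := edge_path v i t.
have Lq j : 0 <= edge_fun v j q.
  have -> : q = (t * (v (ordS i)).1 + (1 - t) * (v i).1 + 0 * (v i).1,
                 t * (v (ordS i)).2 + (1 - t) * (v i).2 + 0 * (v i).2).
    rewrite /q /edge_path /edge_vec; congr pair; rewrite /= /GRing.scale /=; ring.
  rewrite edge_fun_affine ?mul0r ?addr0; last by ring.
  have [h1 _] := edge_fun_vertex cP j i; have [h2 _] := edge_fun_vertex cP j (ordS i).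
  by rewrite addr_ge0// mulr_ge0// subr_ge0.
have L0 j : 0 < edge_fun v j x0 by move: Px0; rewrite (polygonE cP); exact.
have Pq (e : R) : 0 < e -> e <= 1 -> P (q + e *: (x0 - q)).
  move=> e0 e1; rewrite (polygonE cP) => j.
  have -> : q + e *: (x0 - q) = (e * x0.1 + (1 - e) * q.1 + 0 * q.1, e * x0.2 + (1 - e) * q.2 + 0 * q.2).
    by congr pair; rewrite /= /GRing.scale /=; ring.
  have E : e + (1 - e) + 0 = 1 by ring.
  rewrite -/(edge_fun v j _) (edge_fun_affine v j x0 q q E) mul0r addr0.
  by apply: ltr_pwDl; [exact: mulr_gt0|apply: mulr_ge0 => //; rewrite subr_ge0].
have cq : q + e *: (x0 - q) @[e --> (0:R)^'+] --> q.
  rewrite -[X in _ --> X]addr0; apply: cvgD; first exact: cvg_cst.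
  rewrite -(scale0r (x0 - q)); apply: cvgZr_tmp.
  by apply: cvg_within_filter; exact: cvg_id.
move=> B /cq nB; near ((0:R)^'+) => e.
exists (q + e *: (x0 - q)); split; last by near: e.
by apply: Pq; near: e; [exact: nbhs_right_gt|exact: nbhs_right_le].
Unshelve. all: by end_near. Qed.

Lemma convexP x z (t : R) : closure P x -> closure P z -> 0 <= t <= 1 ->
  u (t * x.1 + (1 - t) * z.1, t * x.2 + (1 - t) * z.2) <= t * u x + (1 - t) * u z.
Proof.
move=> Cx Cz tI.
have /andP[t0 t1] := tI.
have := @guillemin_convex R n v s P u gu (Itv01 t0 t1) x z; rewrite !inE => /(_ Cx Cz).
by [].
Qed.


Lemma axis1_closure (y : R) : 0 <= y <= l1 -> closure P (y, 0).
Proof.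
move=> /andP[y0 yl]; apply: tri; split => //=.
by rewrite mul0r addr0 ltr_pdivrMr ?mulr_gt0//; move: yl l1_gt0 => k1 k2; lra.
Qed.

Lemma axis2_closure (y : R) : 0 <= y <= l2 -> closure P (0, y).
Proof.
move=> /andP[y0 yl]; apply: tri; split => //=.
by rewrite mul0r add0r ltr_pdivrMr ?mulr_gt0//; move: yl l2_gt0 => k1 k2; lra.
Qed.

Lemma derivable_rescale (F f : R -> R) (k b l : R) : (forall t, f t = F (k * t + b)) ->
  derivable F (k * l + b) 1 -> derivable f l 1.
Proof.
move=> fF /derivableP dF; have -> : f = F \o (fun t => k * t + b) by apply/funext.
have dg := is_derive_add (is_derive_mul (is_derive_const k l) (is_derive_var l)) (is_derive_const b l).
by have [] := @is_derive_comp R F (fun t => k * t + b) l _ _ dF dg.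
Qed.

Lemma antitone1 (x t : R) : 0 <= x -> x <= t -> t < l1 -> u (t, 0) <= u (x, 0).
Proof.
apply: (@convex_antitone R (fun t => u (t, 0)) l1).
- move=> y z w yI zI wI; have := convexP (axis1_closure yI) (axis1_closure zI) wI.
  by rewrite /= !mulr0 addr0.
- have h : 0 < (2^-1 : R) < 1 by apply/andP; split; lra.
  have := @guillemin_edge_smooth R n v s P u gu o 0%N 2^-1 h; rewrite /derive1n /= => dF.
  apply: (@derivable_rescale (u \o edge_path v o) _ (2 * l1)^-1 0) => [y|].
    by rewrite /= (edge_patho vo vs) addr0 mulVKf// mulf_neq0// gt_eqF.
  by rewrite (_ : _ + 0 = 2^-1)//; have := gt_eqF l1_gt0 => /negbT k; field.
- by rewrite -derive1E du1 oppr_lt0.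
Qed.

Lemma antitone2 (x t : R) : 0 <= x -> x <= t -> t < l2 -> u (0, t) <= u (0, x).
Proof.
apply: (@convex_antitone R (fun t => u (0, t)) l2).
- move=> y z w yI zI wI; have := convexP (axis2_closure yI) (axis2_closure zI) wI.
  by rewrite /= !mulr0 addr0.
- have h : 0 < (2^-1 : R) < 1 by apply/andP; split; lra.
  have := @guillemin_edge_smooth R n v s P u gu p 0%N 2^-1 h; rewrite /derive1n /= => dF.
  have k2 : l2 != 0 by rewrite gt_eqF.
  apply: (@derivable_rescale (u \o edge_path v p) _ (- (2 * l2)^-1) 1) => [y|].
    rewrite /= (edge_pathp vo vp); congr (u (0, _)); by field.
  by rewrite (_ : _ + 1 = 2^-1)//; field.
- by rewrite -derive1E du2 oppr_lt0.
Qed.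

Lemma sum_origin (F : 'I_n -> R) :
  \sum_(i < n | `[< closed_edge v i (0, 0) >]) F i = F o + F p.
Proof.
under eq_bigl do rewrite (closed_edge_origin cP vo vs vp).
rewrite (bigD1 o) ?eqxx//=; congr (_ + _).
apply: big_pred1 => i; have := ord_pred_neq vo l2_gt0 vp; rewrite -/p /=.
have [->|_] := eqVneq i p; first by rewrite orbT => ->.
by rewrite orbF andbN.
Qed.

Lemma sum_bottom (t : R) (F : 'I_n -> R) : 0 < t -> t < 2 * l1 ->
  \sum_(i < n | `[< closed_edge v i (t, 0) >]) F i = F o.
Proof.
by move=> t0 tl; apply: big_pred1 => i; rewrite (closed_edge_bottom cP vo l1_gt0 l2_gt0 vs vp).
Qed.

Lemma sum_left (t : R) (F : 'I_n -> R) : 0 < t -> t < 2 * l2 ->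
  \sum_(i < n | `[< closed_edge v i (0, t) >]) F i = F p.
Proof.
by move=> t0 tl; apply: big_pred1 => i; rewrite (closed_edge_left cP vo l1_gt0 l2_gt0 vs vp).
Qed.

Let lo x : edge_lambda v s o x = x.2 := edge_lambdao vo l1_gt0 vs x so.
Let lp x : edge_lambda v s p x = x.1 := edge_lambdap vo l2_gt0 vp x sp.

Lemma boundary_origin : extends_smoothly_at (quad dl) (fun x => u x - (xlnx x.1 + xlnx x.2)) (0, 0).
Proof.
have C0 : cquad dl (0, 0) by split => //=; rewrite addr0 dl_gt0.
have := guillemin_boundary gu (conj (cquad_closure C0) (bottom_notin cP vo vs (t := 0))).
move=> /(extends_sub (D' := quad dl) quad_in).
congr (extends_smoothly_at _ _ _); apply/funext => x.
by rewrite sum_origin lo lp (addrC (xlnx x.1)).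
Qed.

Lemma boundary_bottom (t : R) : 0 < t -> t < dl ->
  extends_smoothly_at (quad dl) (fun x => u x - xlnx x.2) (t, 0).
Proof.
move=> t0 td; have C0 : cquad dl (t, 0) by split => //=; rewrite ?addr0// ltW.
have tl : t < 2 * l1 by move: td dl_le1 l1_gt0 => k1 k2 k3; lra.
have := guillemin_boundary gu (conj (cquad_closure C0) (bottom_notin cP vo vs (t := t))).
move=> /(extends_sub (D' := quad dl) quad_in).
by congr (extends_smoothly_at _ _ _); apply/funext => x; rewrite sum_bottom// lo.
Qed.

Lemma boundary_left (t : R) : 0 < t -> t < dl ->
  extends_smoothly_at (quad dl) (fun x => u x - xlnx x.1) (0, t).
Proof.
move=> t0 td; have C0 : cquad dl (0, t) by split => //=; rewrite ?add0r// ltW.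
have tl : t < 2 * l2 by move: td dl_le2 l2_gt0 => k1 k2 k3; lra.
have := guillemin_boundary gu (conj (cquad_closure C0) (left_notin cP vo vp (t := t))).
move=> /(extends_sub (D' := quad dl) quad_in).
by congr (extends_smoothly_at _ _ _); apply/funext => x; rewrite sum_left// lp.
Qed.

Lemma cquad_cont x e : cquad dl x -> 0 < e -> \forall z \near x, cquad dl z -> `|u x - u z| < e.
Proof.
move=> Cx e0; have := continuous_near (cquad_closure Cx) e0.
by apply: filterS => z H Cz; apply: H; exact: cquad_closure.
Qed.

Lemma edge_reg1 (t : R) : 0 <= t -> t < dl -> edge_reg u dl t.
Proof.
rewrite le_eqVlt => /orP[/eqP<- _|t0 td]; first exact: edge_reg_vertex boundary_origin.
have tl : t < 2 * l1 by move: td dl_le1 l1_gt0 => k1 k2 k3; lra.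
have l10 : 0 < 2 * l1 by rewrite mulr_gt0.
apply: (@edge_reg_interior R u dl t (2 * l1) 0 (t / (2 * l1))) => //.
- move=> y y0 yd e e0; apply: cquad_cont => //.
  by split => //=; rewrite ?addr0// ltW.
- exact: boundary_bottom.
- by rewrite addr0 mulrC divfK// gt_eqF.
- have -> : (fun s' : R => u (2 * l1 * s' + 0, 0)) = u \o edge_path v o.
    by apply/funext => y /=; rewrite (edge_patho vo vs) addr0.
  by apply: (guillemin_edge_convex gu); rewrite divr_gt0//= ltr_pdivrMr// mul1r.
Qed.

Lemma edge_reg2 (t : R) : 0 <= t -> t < dl -> edge_reg (u \o swap) dl t.
Proof.
have Qs : quad dl `<=` (fun x => quad dl (swap x)) by move=> x; exact: quad_swap.
rewrite le_eqVlt => /orP[/eqP<- _|t0 td].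
  have := extends_sub Qs (extends_swap boundary_origin) => E.
  apply: edge_reg_vertex; move: E; congr (extends_smoothly_at _ _ _).
  by apply/funext => x /=; rewrite (addrC (xlnx x.2)).
have tl : t < 2 * l2 by move: td dl_le2 l2_gt0 => k1 k2 k3; lra.
have l20 : 0 < 2 * l2 by rewrite mulr_gt0.
have k2 : l2 != 0 by rewrite gt_eqF.
apply: (@edge_reg_interior R (u \o swap) dl t (- (2 * l2)) (2 * l2) (1 - t / (2 * l2))) => //.
- move=> y y0 yd e e0.
  have Cy : cquad dl (0, y) by split => //=; rewrite ?add0r// ltW.
  have nH : \forall z \near ((y, 0) : R * R), cquad dl (swap z) -> `|u (0, y) - u (swap z)| < e.
    exact: (@continuous_swap R (y, 0) _ (cquad_cont Cy e0)).
  by apply: filterS nH => z H /cquad_swap.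
- exact: (extends_sub Qs (extends_swap (boundary_left t0 td))).
- by field.
- have -> : (fun s' : R => (u \o swap) (- (2 * l2) * s' + 2 * l2, 0)) = u \o edge_path v p.
    by apply/funext => y /=; rewrite (edge_pathp vo vp); congr (u (_, _)); rewrite /=; ring.
  have t1 : t / (2 * l2) < 1 by rewrite ltr_pdivrMr// mul1r.
  by apply: (guillemin_edge_convex gu); rewrite subr_gt0 t1 gtrBl divr_gt0.
Qed.

Lemma smooth_quad : smooth_in (quad dl) u.
Proof. exact: smooth_sub quad_in (guillemin_smooth gu). Qed.

Lemma guillemin_pos x : quad dl x -> 0 < H11 u x /\ 0 < hdet u x.
Proof.
by move=> Qx; apply: (posdef2_pos smooth_quad Qx); apply: (guillemin_posdef gu); exact: quad_in.
Qed.

Lemma sup_quad x : quad dl x -> `|A x| <= Linfty_norm P A.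
Proof.
move=> Qx; apply: Linfty_normP sA; last exact: polygon_bounded cP.
by apply: filterS quad_in _; apply: open_nbhs_nbhs; split => //; exact: open_quad.
Qed.

Lemma guillemin_corner : corner u dl (Linfty_norm P A).
Proof.
split.
- exact: smooth_quad.
- exact: guillemin_pos.
- move=> x Qx; rewrite -(abreuE smooth_quad guillemin_pos Qx) (abu (quad_in Qx)) normrN.
  exact: sup_quad.
- by move=> x z t /cquad_closure Cx /cquad_closure Cz; exact: convexP.
- exact: cquad_cont.
- by move=> x /cquad_closure; exact: closure_ge0.
- by move=> x t x0 xt td; apply: antitone1 => //; exact: lt_le_trans dl_le1.
- by move=> x t x0 xt td; apply: antitone2 => //; exact: lt_le_trans dl_le2.
- exact: edge_reg1.
- exact: edge_reg2.
Qed.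

Lemma continuous_edge i : {within `[0, 1], continuous (u \o edge_path v i)}.
Proof.
apply/subspace_continuousP => t /=; rewrite in_itv /= => tI.
apply/cvgrPdist_lt => e e0; have := continuous_near (@edge_closure i t tI) e0 => nu.
have ce : {for t, continuous (edge_path v i)}.
  by apply: cvgD; [exact: cvg_cst|apply: cvgZr_tmp; exact: cvg_id].
have nt : \forall y \near t, closure P (edge_path v i y) ->
    `|u (edge_path v i t) - u (edge_path v i y)| < e by exact: (ce _ nu).
apply: filterS nt => y H; rewrite /= in_itv /= => yI.
by apply: H; exact: edge_closure.
Qed.

(** All terms of the boundary integral are nonnegative, and one of them is bounded from
    below on a part of its edge. *)
Lemma edge_integral_le i (a b c : R) : 0 <= a -> a <= b -> b <= 1 ->
  (forall t, a <= t <= b -> c <= u (edge_path v i t)) ->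
  s i * enorm (edge_vec v i) * (c * (b - a)) <= boundary_integral v s u.
Proof.
move=> a0 ab b1 cu; rewrite /boundary_integral (bigD1 i)//=.
have en j : 0 <= s j * enorm (edge_vec v j) by rewrite mulr_ge0 ?sqrtr_ge0// ltW.
have ug j t : 0 <= t <= 1 -> 0 <= u (edge_path v j t).
  by move=> tI; apply: closure_ge0; exact: edge_closure.
rewrite -[leLHS]addr0; apply: lerD.
  by apply: ler_wpM2l => //; apply: (@Rintegral_ge_const R (u \o edge_path v i)) => //;
    [exact: continuous_edge|exact: ug].
apply: sumr_ge0 => j _; apply: mulr_ge0 => //; apply: Rintegral_ge0 => t /=.
by rewrite in_itv /=; exact: ug.
Qed.

(** u decreases along the edge, so it is at least u(t,0) between the vertex and (t,0). *)
Lemma edge_value1 (t : R) : 0 < t -> t < dl -> t * u (t, 0) <= boundary_integral v s u.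
Proof.
move=> t0 td; have l10 : 0 < 2 * l1 by rewrite mulr_gt0.
have tl : t < l1 by exact: lt_le_trans dl_le1.
have b0 : 0 <= t / (2 * l1) by rewrite divr_ge0// ltW.
have b1 : t / (2 * l1) <= 1 by rewrite ler_pdivrMr// mul1r; move: tl l1_gt0 => k1 k2; lra.
have := @edge_integral_le o 0 (t / (2 * l1)) (u (t, 0)) (lexx 0) b0 b1.
rewrite so (enormo vo l1_gt0 vs) (_ : 1 * _ * _ = t * u (t, 0)); last first.
  by have := gt_eqF l1_gt0 => /negbT k; field.
apply => y /andP[y0 yb]; rewrite (edge_patho vo vs); apply: antitone1 => //.
  by rewrite mulr_ge0// ltW.
by rewrite mulrC -ler_pdivlMr.
Qed.

Lemma edge_value2 (t : R) : 0 < t -> t < dl -> t * u (0, t) <= boundary_integral v s u.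
Proof.
move=> t0 td; have l20 : 0 < 2 * l2 by rewrite mulr_gt0.
have tl : t < l2 by exact: lt_le_trans dl_le2.
have b0 : 0 <= t / (2 * l2) by rewrite divr_ge0// ltW.
have b1 : t / (2 * l2) <= 1 by rewrite ler_pdivrMr// mul1r; move: tl l2_gt0 => k1 k2; lra.
have a0 : 0 <= 1 - t / (2 * l2) by rewrite subr_ge0.
have a1 : 1 - t / (2 * l2) <= 1 by rewrite gerBl.
have := @edge_integral_le p (1 - t / (2 * l2)) 1 (u (0, t)) a0 a1 (lexx 1).
rewrite sp (enormp vo l2_gt0 vp) (_ : 1 * _ * _ = t * u (0, t)); last first.
  by have := gt_eqF l2_gt0 => /negbT k; field.
apply => y /andP[y0 yb]; rewrite (edge_pathp vo vp); apply: antitone2 => //.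
  by rewrite mulr_ge0 ?subr_ge0// ltW.
by rewrite mulrC -ler_pdivlMr//; move: y0; lra.
Qed.

(** [corner_bound] needs a positive constant in place of the boundary integral m, which may
    be 0 a priori: m + 1 serves. *)
Lemma vertex_value_bound (a := Linfty_norm P A) (m := boundary_integral v s u) :
  u (0, 0) <= 1 + 2 * (1024 * (144 * 256)) * (m + 1) * (a + 2) + 256 * (m + 1) / dl.
Proof.
have d0 := dl_gt0.
have a0 : 0 <= a.
  have Q : quad dl (dl / 4, dl / 4) by split => /=; [rewrite divr_gt0|rewrite divr_gt0|move: d0; lra].
  exact: le_trans (sup_quad Q).
have C (x : R * R) : cquad dl x -> 0 <= u x by move=> /cquad_closure; exact: closure_ge0.
have Cx (t : R) : 0 < t -> t < dl -> cquad dl (t, 0).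
  by move=> t0 td; split => //=; rewrite ?addr0// ltW.
have m0 : 0 < m + 1.
  have d2 : 0 < dl / 2 by rewrite divr_gt0.
  have d2d : dl / 2 < dl by move: d0; lra.
  have := edge_value1 d2 d2d; have := mulr_ge0 (ltW d2) (C _ (Cx _ d2 d2d)).
  by rewrite -/m; move=> k1 /(le_trans k1) k2; rewrite ltr_wpDl.
apply: (corner_bound (erefl _) guillemin_corner a0 m0 d0) => t t0 td.
  rewrite ler_pdivlMr// mulrC; apply: le_trans (edge_value1 t0 td) _; by rewrite lerDl.
rewrite ler_pdivlMr// mulrC; apply: le_trans (edge_value2 t0 td) _; by rewrite lerDl.
Qed.

End GuilleminCorner.

Theorem theorem2 (R : realType) :
  exists H : R -> R -> R -> R -> R,
  forall (n : nat) (v : 'I_n -> R * R) (P : set (R * R)) (o : 'I_n)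
         (l1 l2 : R) (s : 'I_n -> R) (A u : R * R -> R),
    convex_polygon v P ->
    v o = (0, 0) ->
    (\forall x \near ((0, 0) : R * R), P x <-> 0 < x.1 /\ 0 < x.2) ->
    0 < l1 -> 0 < l2 ->
    v (ordS o) = (2 * l1, 0) ->
    v (ord_pred o) = (0, 2 * l2) ->
    (forall i, 0 < s i) ->
    s o = 1 ->
    s (ord_pred o) = 1 ->
    smooth_on (closure P) A ->
    guillemin v s P u ->
    (forall x, P x -> abreu u x = - A x) ->
    derive1 (fun t : R => u (t, 0)) l1 = -1 ->
    derive1 (fun t : R => u (0, t)) l2 = -1 ->
    (exists2 x, P x & u x = 0) ->
    (forall x, P x -> 0 <= u x) ->
    u (0, 0) <= H l1 l2 (Linfty_norm P A) (boundary_integral v s u).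
Proof.
exists (fun l1 l2 a m =>
  1 + 2 * (1024 * (144 * 256)) * (m + 1) * (a + 2) + 256 * (m + 1) / Num.min l1 l2).
move=> n v P o l1 l2 s A u cP vo _ l10 l20 vs vp s0 so sp sA gu abu du1 du2 Pne u0.
exact: (vertex_value_bound cP vo l10 l20 vs vp s0 so sp sA gu abu du1 du2 Pne u0).
Qed.
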